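(* Let $\beta = \log_2 3 - 1$ (so $\beta < 0.585$). The Asymmetric Travelling Salesman Problem can be solved in time $\mathcal{O}^*(2^{(n - t_1(G))/3 + \beta S(G)})$ and polynomial space, where $G$ is the input digraph on $n$ vertices, $t_1(G)$ is the number of vertices of $G$ with outdegree exactly $1$, and $S(G) = \sum_{v:\ \mathrm{outdeg}(v)\ge 2} (\mathrm{outdeg}(v) - 2)$.
   Context: Asymmetric Travelling Salesman Problem (ATSP): given a directed graph $G$ and integer weights $w:E(G)\to\mathbb{Z}$, find a directed Hamiltonian cycle of minimum total weight, or report that none exists. $\mathcal{O}^*(f)$ means $f\cdot n^{\mathcal{O}(1)}$. *)

(* Defs.v *)
From HB Require Import structures.
From mathcomp Require Import all_boot all_order all_algebra.
From mathcomp Require Import reals exp.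
Set Implicit Arguments.
Unset Strict Implicit.
Unset Printing Implicit Defensive.
Import Order.TTheory GRing.Theory Num.Theory.
Local Open Scope ring_scope.

(* A digraph on n vertices is a relation [e : rel 'I_n]; antiparallel arcs are
   allowed, and so are loops, which count towards the outdegree.  Arc weights
   are given by [w : 'I_n -> 'I_n -> int], only ever consulted on arcs. *)

Definition outdeg n (e : rel 'I_n) (u : 'I_n) : nat := #|[set v | e u v]|.

Definition t1 n (e : rel 'I_n) : nat := #|[set u | outdeg e u == 1%N]|.

Definition excess n (e : rel 'I_n) : nat :=
  (\sum_(u < n | 2 <= outdeg e u) (outdeg e u - 2))%N.

Definition beta (R : realType) : R := ln 3%:R / ln 2%:R - 1.

(* The vertices in cyclic order.  For n = 1 the only candidate is a loop; for
   n = 2 a Hamiltonian cycle is a pair of antiparallel arcs; for n = 0 there is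
   none. *)
Definition ham_cycle n (e : rel 'I_n) (c : seq 'I_n) : bool :=
  [&& c != [::], uniq c, size c == n & path.cycle e c].

Definition cycle_weight n (w : 'I_n -> 'I_n -> int) (c : seq 'I_n) : int :=
  \sum_(u <- c) w u (next c u).

Definition optimal_ham_cycle n (e : rel 'I_n) (w : 'I_n -> 'I_n -> int)
    (c : seq 'I_n) : Prop :=
  ham_cycle e c /\
  forall c', ham_cycle e c' -> cycle_weight w c <= cycle_weight w c'.

(* Model of computation: a word RAM given by structured programs over integer
   registers and a random-access memory.  The only arithmetic is addition and
   subtraction; a guard tests whether its value is positive. *)

Inductive expr : Type :=
  | Lit of int
  | Reg of nat
  | Mem of expr
  | Add of expr & expr
  | Sub of expr & expr.

Inductive cmd : Type :=
  | Skip
  | Assign of nat & expr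
  | Store of expr & expr
  | Seq of cmd & cmd
  | If of expr & cmd & cmd
  | While of expr & cmd.

Record state : Type := State { reg : nat -> int; ram : int -> int }.

Definition set_reg (s : state) (x : nat) (v : int) : state :=
  State (fun y => if y == x then v else reg s y) (ram s).

Definition set_ram (s : state) (a v : int) : state :=
  State (reg s) (fun b => if b == a then v else ram s b).

Fixpoint eval (s : state) (b : expr) : int :=
  match b with
  | Lit z => z
  | Reg x => reg s x
  | Mem a => ram s (eval s a)
  | Add b1 b2 => eval s b1 + eval s b2
  | Sub b1 b2 => eval s b1 - eval s b2
  end.

Fixpoint expr_cost (b : expr) : nat :=
  match b with
  | Lit _ | Reg _ => 1
  | Mem a => (expr_cost a).+1
  | Add b1 b2 | Sub b1 b2 => (expr_cost b1 + expr_cost b2).+1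
  end%N.

(* [fits M W s]: every register and memory cell holds a signed W-bit word, and
   only the cells 0, ..., M - 1 are in use.  A fixed program mentions finitely
   many registers, so the space taken by s is O(1) + M words of W bits.  (The
   intermediate values of an expression exceed a word by at most as many bits
   as the size of the expression, a constant of the program.) *)
Definition fits (M W : nat) (s : state) : Prop :=
  [/\ forall x, `|reg s x| < (2 ^ W)%N%:Z,
      forall a, `|ram s a| < (2 ^ W)%N%:Z
    & forall a, ~~ (0 <= a < M%:Z) -> ram s a = 0].

(* [exec M W c s t s']: started in s, the command c halts in s' after t unit
   cost operations, and every state it produces on the way fits in M words of W
   bits.  An execution that would exceed this space has no derivation. *)
Inductive exec (M W : nat) : cmd -> state -> nat -> state -> Prop :=
  | exec_skip s :
      exec M W Skip s 1 s
  | exec_assign s x b :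
      fits M W (set_reg s x (eval s b)) ->
      exec M W (Assign x b) s (expr_cost b).+1 (set_reg s x (eval s b))
  | exec_store s a b :
      fits M W (set_ram s (eval s a) (eval s b)) ->
      exec M W (Store a b) s (expr_cost a + expr_cost b).+1
        (set_ram s (eval s a) (eval s b))
  | exec_seq s1 s2 s3 c1 c2 k1 k2 :
      exec M W c1 s1 k1 s2 -> exec M W c2 s2 k2 s3 ->
      exec M W (Seq c1 c2) s1 (k1 + k2) s3
  | exec_if_true s s' b c1 c2 k :
      0 < eval s b -> exec M W c1 s k s' ->
      exec M W (If b c1 c2) s ((expr_cost b).+1 + k) s'
  | exec_if_false s s' b c1 c2 k :
      eval s b <= 0 -> exec M W c2 s k s' ->
      exec M W (If b c1 c2) s ((expr_cost b).+1 + k) s'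
  | exec_while_false s b c :
      eval s b <= 0 ->
      exec M W (While b c) s (expr_cost b).+1 s
  | exec_while_true s1 s2 s3 b c k1 k2 :
      0 < eval s1 b -> exec M W c s1 k1 s2 -> exec M W (While b c) s2 k2 s3 ->
      exec M W (While b c) s1 ((expr_cost b).+1 + k1 + k2) s3.

(* Input: n in register 0; the n x n adjacency matrix, in row-major order, from
   memory cell 0 on, followed by the n x n weight matrix with 0 at non-arcs. *)
Definition input_seq n (e : rel 'I_n) (w : 'I_n -> 'I_n -> int) : seq int :=
  [seq (e u v : nat)%:Z | u <- enum 'I_n, v <- enum 'I_n] ++
  [seq if e u v then w u v else 0 | u <- enum 'I_n, v <- enum 'I_n].

Definition input_state n (e : rel 'I_n) (w : 'I_n -> 'I_n -> int) : state :=
  State (fun x => if x == 0%N then n%:Z else 0)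
        (fun a => if a is Posz i then nth 0 (input_seq e w) i else 0).

(* Output: either register 0 is 1 and cells 0, ..., n - 1 list the vertices of a
   minimum weight Hamiltonian cycle in order, or register 0 is 0 and there is
   no Hamiltonian cycle. *)
Definition atsp_output n (e : rel 'I_n) (w : 'I_n -> 'I_n -> int)
    (s : state) : Prop :=
  (reg s 0%N = 1 /\
   exists2 c, optimal_ham_cycle e w c &
     forall i : nat, (i < n)%N ->
       ram s i%:Z = nth 0 [seq (nat_of_ord u)%:Z | u <- c] i) \/
  (reg s 0%N = 0 /\ forall c, ~~ ham_cycle e c).

Definition bitlen (z : int) : nat := (trunc_log 2 `|z|).+1.

Definition word_bits n (e : rel 'I_n) (w : 'I_n -> 'I_n -> int) : nat :=
  ((trunc_log 2 n).+1 +
   \max_(p : 'I_n * 'I_n | e p.1 p.2) bitlen (w p.1 p.2))%N.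

(* ATSP is solved in time O^*(f) and polynomial space: a single program solves
   every instance in at most f * n^O(1) operations on words of
   O(log n + weight length) bits, using n^O(1) such words.  The polynomial is
   written in n + 1 so that the bound is also meaningful for n = 0. *)
Definition ATSP_Ostar_polyspace (R : realType)
    (f : forall n, rel 'I_n -> R) : Prop :=
  exists (p : cmd) (C k : nat),
  forall (n : nat) (e : rel 'I_n) (w : 'I_n -> 'I_n -> int),
  let M := (C * n.+1 ^ k)%N in
  let W := (C * word_bits e w)%N in
  exists (t : nat) (s : state),
    [/\ fits M W (input_state e w),
        exec M W p (input_state e w) t s,
        atsp_output e w s
      & t%:R <= C%:R * f n e * n.+1%:R ^+ k].

(* Main.v *)
Require Import Defs.
From mathcomp Require Import all_boot all_order all_algebra.
From mathcomp Require Import reals exp.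
From mathcomp Require Import all_fingroup zify ring lra.
Set Implicit Arguments.
Unset Strict Implicit.
Unset Printing Implicit Defensive.
Import Order.TTheory GRing.Theory Num.Theory.
Local Open Scope ring_scope.

(** A tour picks one arc out of every vertex, and an arc may be discarded as
    soon as it would rob another vertex of its last out-arc or last in-arc.  In
    an arc set reduced in this way let a vertex of outdegree d >= 2 weigh
    2^(1/3 + beta (d - 2)).  Take or discard an arc u -> v with outdeg u >= 3:
    if v has indegree at least 3, the product of the weights drops to a fraction
    1/3, respectively 2/3; if v has indegree 2, discarding the arc forces the
    other one into v and the two fractions add up to less than 1.  Once all
    outdegrees are at most 2, double counting bounds the indegrees by 2 as well,
    so the undecided arcs form alternating cycles.  Taking or discarding an arc
    of a cycle that is not a square decides at least three vertices, which
    halves the product.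

    When only squares {a, b} x {c, d} are left, no branching is needed: they are
    settled in the order of decreasing gap between their two matchings, always
    in favour of the cheap one unless this makes some vertex unreachable.
    Indeed, switching the square in a tour that uses the dear matching leaves
    two cycles; if everything is still reachable, an arc of another square joins
    them, and switching that square costs no more than was gained. *)

(** * Tours and exchanges *)

(** The weights are those that make the branchings balance. Deciding three vertices of outdegree 2
    should halve the product, whence 2^(1/3) for such a vertex, and 2^beta = 3/2 is the price of
    each further arc. Taking an arc into a vertex of indegree at least 3 then gains at least 2 * 3/2
    = 3, discarding it gains 3/2, and 1/3 + 2/3 = 1 leaves nothing over.

    The machine has no recursion, so the open arc sets are kept on a stack, one matrix each, and a
    single loop works on the top. A pushed set is a proper subset of the one it was cut from and
    lies one level higher, which limits the height of the stack to about n^2. Time is measured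
    separately: a potential summed over the stack falls by at least 1 per round.

    Subtours are not excluded while branching. Once every vertex has one out-arc and one in-arc the
    set is a permutation, and it is a tour if and only if everything can be reached from vertex 0.
    Settling a square preserves some tour that is no heavier, not every tour, so correctness is an
    invariant about weights. *)

Section ArcSets.
Variables (T : finType) (r : T) (w : T -> T -> int).
Implicit Types (A B : {set T * T}) (s : {perm T}).

Definition out A u := [set v | (u, v) \in A].
Definition inn A v := [set u | (u, v) \in A].

(** This, [dead], [branching] and [max_square] are spelled out with boolean quantifiers over single
    arcs instead of degrees, because the program decides them literally, by searching through the
    vertices. *)
Definition useless A u v :=
  ((u, v) \in A) &&
  ([exists x, [&& x != u, (x, v) \in A & ~~ [exists y, (y != v) && ((x, y) \in A)]]]
   || [exists y, [&& y != v, (u, y) \in A & ~~ [exists x, (x != u) && ((x, y) \in A)]]]).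

Definition dead A :=
  [exists u, ~~ [exists v, (u, v) \in A]] || [exists v, ~~ [exists u, (u, v) \in A]].

Definition two_more A u v :=
  [exists y, [exists z, [&& y != v, z != v, y != z, (u, y) \in A & (u, z) \in A]]].

(** The second alternative, open only when no vertex has three out-arcs, says that [u -> v] and a
    further arc [u -> y] lie in no common square. *)
Definition branching A u v :=
  ((u, v) \in A) &&
  (two_more A u v
   || ~~ [exists x, [exists y, ((x, y) \in A) && two_more A x y]]
      && [exists y, [&& y != v, (u, y) \in A
          & ~~ [exists x, [&& x != u, (x, v) \in A & (x, y) \in A]]]]).

Definition square A a b c d :=
  [&& a != b, c != d, (a, c) \in A, (a, d) \in A, (b, c) \in A & (b, d) \in A].

Definition swap_cost a b c d : int := w a d + w b c - w a c - w b d.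

(** Exchanging [c] and [d] negates [swap_cost], so the maximum over all labelled squares is
    nonnegative: a maximal labelling has its cheap matching on [a -> c], [b -> d]. *)
Definition max_square A a b c d :=
  square A a b c d &&
  ~~ [exists a', [exists b', [exists c', [exists d',
      square A a' b' c' d' && (0 < swap_cost a' b' c' d' - swap_cost a b c d)]]]].

Definition reaches A := [forall x, connect (fun u v => (u, v) \in A) r x].

Definition ham A s := [forall u, (u, s u) \in A] && (porbit s r == setT).
Definition wt s := \sum_u w u (s u).

Lemma hamP A s : reflect ((forall u, (u, s u) \in A) /\ porbit s r = setT) (ham A s).
Proof. by apply: (iffP andP) => -[/forallP ? /eqP ?]. Qed.

Lemma ham_sub A B s : ham A s -> (forall u, (u, s u) \in B) -> ham B s.
Proof. by move=> /hamP[_ o] h; apply/hamP. Qed.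

Lemma ham_subset A B s : A \subset B -> ham A s -> ham B s.
Proof.
by move=> /subsetP AB h; apply: (ham_sub h) => u; case/hamP: h => /(_ u)/AB.
Qed.

(** In the first case [x] can only go to [v], so [s u = v] would break injectivity; in the second,
    [y] can only be entered from [u]. *)
Lemma ham_useless A s u v : ham A s -> useless A u v -> s u != v.
Proof.
case/hamP => sA _ /andP[_ /orP[]] /existsP[x] /and3P[xu xv] /existsPn h.
  apply/eqP => suv; have := h (s x); rewrite sA andbT negbK => /eqP sxv.
  by move: xu; rewrite -(inj_eq (@perm_inj _ s)) sxv suv eqxx.
apply/eqP => suv; have := h (s^-1 x)%g; have := sA (s^-1 x)%g; rewrite permKV => ->.
rewrite andbT negbK => /eqP su; have: s u = x by rewrite -su permKV.
by rewrite suv => xv'; rewrite -xv' eqxx in xu.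
Qed.

Lemma ham_dead A s : ham A s -> ~~ dead A.
Proof.
case/hamP => sA _; rewrite negb_or; apply/andP; split; apply/existsPn => u; rewrite negbK.
  by apply/existsP; exists (s u).
by apply/existsP; exists (s^-1 u)%g; have := sA (s^-1 u)%g; rewrite permKV.
Qed.

Lemma ham_reaches A s : ham A s -> reaches A.
Proof.
case/hamP => sA so; apply/forallP => x.
have: x \in porbit s r by rewrite so inE.
case/porbitP => i ->; elim: i => [|i IH]; first by rewrite expg0 perm1 connect0.
by apply: connect_trans IH _; apply: connect1; rewrite expgSr permM.
Qed.

Lemma porbit_step s x : porbit s (s x) = porbit s x.
Proof. by have := porbit_perm s 1 x; rewrite expg1. Qed.

(** Tours are recognised by counting cycles, since composing with a transposition of two distinct
    points changes their number by exactly one. *)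
Lemma porbits1 s : #|porbits s| = 1%N -> porbit s r = setT.
Proof.
move=> h; apply/setP => x; rewrite inE.
move/eqP/cards1P: h => [X hX].
have: porbit s x \in porbits s by apply: imset_f.
have: porbit s r \in porbits s by apply: imset_f.
by rewrite hX !inE => /eqP -> /eqP <-; apply: porbit_id.
Qed.

Lemma card_porbits1 s : porbit s r = setT -> #|porbits s| = 1%N.
Proof.
move=> h; suff ->: porbits s = [set setT] by rewrite cards1.
apply/setP => X; rewrite inE; apply/imsetP/eqP => [[x _ ->]|->]; last by exists r.
by rewrite -h; apply/eqP; rewrite eq_porbit_mem h inE.
Qed.

Lemma wt_tperm s a b : a != b ->
  wt (tperm a b * s)%g = wt s + swap_cost a b (s a) (s b).
Proof.
move=> ab; have ba : b != a by rewrite eq_sym.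
rewrite /wt (bigD1 a) // (bigD1 b) //= [\sum_u w u (s u)](bigD1 a) // (bigD1 b) //=.
rewrite !permM tpermL tpermR /swap_cost.
under eq_bigr => i /andP[ia ib]. rewrite permM tpermD 1?eq_sym //. over.
ring.
Qed.

(* Outdegrees are at most 2, and every undecided vertex belongs to a square. *)
Definition squared A :=
  (forall u v y z, (u, v) \in A -> (u, y) \in A -> (u, z) \in A ->
     [|| v == y, v == z | y == z]) /\
  (forall u v y, (u, v) \in A -> (u, y) \in A -> v != y ->
     exists x, [&& x != u, (x, v) \in A & (x, y) \in A]).

(** Failure of the first alternative of [branching] bounds the outdegrees by 2. That is the proviso
    of the second alternative, whose failure then supplies the squares. *)
Lemma squaredP A : (forall u v, ~~ branching A u v) -> squared A.
Proof.
move=> nb.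
have n3 u v y z : (u, v) \in A -> (u, y) \in A -> (u, z) \in A ->
     [|| v == y, v == z | y == z].
  move=> uv uy uz; have := nb u v; rewrite /branching uv /= negb_or => /andP[+ _].
  move=> /existsPn/(_ y)/existsPn/(_ z).
  by rewrite uy uz !andbT !negb_and !negbK ![_ == v]eq_sym.
split=> // u v y uv uy vy; have := nb u v; rewrite /branching uv /= negb_or => /andP[_].
rewrite negb_and negbK => /orP[/existsP[x /existsP[y' /andP[xy]]]|].
  move=> /existsP[a /existsP[b /and5P[a1 a2 a3 a4 a5]]].
  by have := n3 _ _ _ _ xy a4 a5; rewrite ![y' == _]eq_sym (negbTE a1) (negbTE a2) (negbTE a3).
move=> /existsPn/(_ y); rewrite uy eq_sym vy /= negbK => /existsP[x h].
by exists x.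
Qed.

(** The tails [a] and [b] have no out-arc that leaves the square, so an injective choice is one of
    its two matchings. *)
Lemma ham_square A s a b c d : squared A -> square A a b c d -> ham A s ->
  (s a = c /\ s b = d) \/ (s a = d /\ s b = c).
Proof.
move=> [n3 _] /and5P[ab cd ac ad /andP[bc bd]] /hamP[sA _].
have: s a != s b by rewrite (inj_eq perm_inj).
have := n3 a c d (s a) ac ad (sA a); have := n3 b c d (s b) bc bd (sA b).
rewrite (negbTE cd) /= => /orP[]/eqP <- /orP[]/eqP <-; rewrite ?eqxx //; by [right|left].
Qed.

Definition keep_cheap A a b c d := A :\ (a, d) :\ (b, c).
Definition keep_dear A a b c d := A :\ (a, c) :\ (b, d).

Lemma ham_swap A s a b c d : squared A -> max_square A a b c d -> ham A s ->
  reaches (keep_cheap A a b c d) ->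
  exists2 s', ham (keep_cheap A a b c d) s' & wt s' <= wt s.
Proof.
move=> sq /andP[sqr mx] hs reach.
have [ab cd ac ad /andP[bc bd]] := and5P sqr.
have sA : forall u, (u, s u) \in A by case/hamP: hs.
have inK t : (forall u, (u, t u) \in A) -> t a = c -> t b = d ->
    forall u, (u, t u) \in keep_cheap A a b c d.
  move=> tA ta tb u; rewrite !inE tA andbT !xpair_eqE.
  have [->|] := eqVneq u a; first by rewrite ta !eqxx (negbTE ab) (negbTE cd).
  by have [->|] := eqVneq u b; rewrite // tb [d == c]eq_sym (negbTE cd) !andbF.
have [[sa sb]|[sa sb]] := ham_square sq sqr hs.
  by exists s => //; apply: (ham_sub hs); apply: inK.
pose t := (tperm a b * s)%g.
have ta : t a = c by rewrite /t permM tpermL.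
have tb : t b = d by rewrite /t permM tpermR.
have tA u : (u, t u) \in A.
  rewrite /t permM; case: tpermP => [->|->|_ _]; rewrite ?sa ?sb //.
have tK := inK _ tA ta tb.
have wtt : wt t = wt s - swap_cost a b c d.
  by rewrite /t wt_tperm // sa sb /swap_cost; ring.
(* [a] and [b] lie on the single cycle of [s], so exchanging their successors splits it in two. *)
have so : porbit s r = setT by case/hamP: hs.
have n2 : #|porbits t| = 2%N.
  have := porbits_mul_tperm s a b; rewrite -/t (card_porbits1 so) ab.
  suff -> : a \in porbit s b by rewrite /= addn0.
  suff -> : porbit s b = porbit s r by rewrite so inE.
  by apply/eqP; rewrite eq_porbit_mem so inE.
(* some arc leaves the cycle of t through r, as everything is reachable *)
have [x [y [xy xr yr]]] : exists x y,
    [/\ (x, y) \in keep_cheap A a b c d, x \in porbit t r & y \notin porbit t r].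
  have [/existsP[x /existsP[y /and3P[? ? ?]]]|/existsPn no] :=
    boolP [exists x, [exists y, [&& (x, y) \in keep_cheap A a b c d,
       x \in porbit t r & y \notin porbit t r]]]; first by exists x, y.
  suff h : porbit t r = setT by have := card_porbits1 h; rewrite n2.
  apply/setP => z; rewrite inE; have /forallP/(_ z)/connectP[p] := reach.
  elim/last_ind: p z => [|p y IH] z; first by move=> _ ->; apply: porbit_id.
  rewrite rcons_path last_rcons => /andP[/IH /(_ erefl) h1 h2 ->].
  by have := no (last r p) => /existsPn/(_ y); rewrite h2 h1 /= negbK.
have xyA : (x, y) \in A by move: xy; rewrite !inE => /and3P[].
have txr : t x \in porbit t r by rewrite -eq_porbit_mem porbit_step eq_porbit_mem.
have ytx : y != t x by apply: contraNneq yr => ->.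
(* The arcs from [x] to [y] and to [t x] differ, so they lie in a square. Its other tail [z] must
   have [y] as successor, hence is on the cycle of [y]; exchanging the successors of [x] and [z]
   merges the two cycles. *)
have [z /and3P[zx zy ztx]] := sq.2 _ _ _ xyA (tA x) ytx.
have tz : t z = y.
  have := sq.1 _ _ _ _ zy ztx (tA z); rewrite (negbTE ytx) /= => /orP[/eqP -> //|].
  by rewrite (inj_eq perm_inj) eq_sym (negbTE zx).
exists (tperm x z * t)%g; last first.
  rewrite wt_tperm 1?eq_sym // tz wtt.
  (* By maximality the second exchange costs at most [swap_cost a b c d], which is what the first
     one saved. *)
  move/existsPn/(_ x)/existsPn/(_ z)/existsPn/(_ (t x))/existsPn/(_ y): mx.
  rewrite /square [x == z]eq_sym zx [t x == y]eq_sym ytx tA xyA ztx zy /= -leNgt => le0.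
  by rewrite -addrA gerDl addrC.
apply/hamP; split => [u|].
  rewrite permM; case: tpermP => [->|->|_ _] //; first by rewrite tz.
  rewrite !inE ztx andbT !xpair_eqE !negb_and.
  (* If [z -> t x] were one of the two removed arcs, [x] would be the other tail of the square and
     [x -> y] the other removed arc, although [x -> y] was found among the arcs kept. *)
  apply/andP; split; rewrite -negb_and; apply/negP => /andP[/eqP zE /eqP txE].
    have xa : x = a by apply: (@perm_inj _ t); rewrite txE ta.
    by move: xy; rewrite xa -tz zE tb !inE !eqxx andbF.
  have xb : x = b by apply: (@perm_inj _ t); rewrite txE tb.
  by move: xy; rewrite xb -tz zE ta !inE !eqxx.
apply: porbits1; have := porbits_mul_tperm t x z; rewrite n2 [x == z]eq_sym zx.
suff -> : x \notin porbit t z by move/(@addIn 2 _ 1).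
apply: contra yr => h; rewrite porbit_sym in h.
have : z \in porbit t r by rewrite -eq_porbit_mem; move: xr h; rewrite -!eq_porbit_mem => /eqP <-.
by rewrite -!eq_porbit_mem -tz porbit_step.
Qed.

(** A tour through the cheap matching would survive in [keep_cheap] and reach every vertex there. *)
Lemma ham_keep_dear A s a b c d : squared A -> square A a b c d -> ham A s ->
  ~~ reaches (keep_cheap A a b c d) -> ham (keep_dear A a b c d) s.
Proof.
move=> sq sqr hs nreach; have [ab cd ac ad /andP[bc bd]] := and5P sqr.
have [[sa sb]|[sa sb]] := ham_square sq sqr hs.
  case/negP: nreach; apply: (@ham_reaches _ s); apply: (ham_sub hs) => u.
  case/hamP: hs => sA _; rewrite !inE sA andbT !xpair_eqE.
  have [->|] := eqVneq u a; first by rewrite sa !eqxx (negbTE ab) (negbTE cd).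
  by have [->|] := eqVneq u b; rewrite // sb [d == c]eq_sym (negbTE cd) !andbF.
apply: (ham_sub hs) => u; case/hamP: hs => sA _; rewrite !inE sA andbT !xpair_eqE.
have [->|] := eqVneq u a; first by rewrite sa !eqxx (negbTE ab) [d == c]eq_sym (negbTE cd).
by have [->|] := eqVneq u b; rewrite // sb (negbTE cd) !andbF.
Qed.

End ArcSets.

(** * Reduced arc sets and their potential *)

Section Reduced.
Variables (T : finType) (r : T) (w : T -> T -> int).
Implicit Types (A B : {set T * T}) (s : {perm T}).

Definition reduced A := ~~ dead A && [forall u, [forall v, ~~ useless A u v]].

Lemma out_gt0 A u : ~~ dead A -> (0 < #|out A u|)%N.
Proof.
rewrite negb_or => /andP[/existsPn/(_ u)]; rewrite negbK => /existsP[v uv] _.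
by apply/card_gt0P; exists v; rewrite inE.
Qed.

Lemma inn_gt0 A v : ~~ dead A -> (0 < #|inn A v|)%N.
Proof.
rewrite negb_or => /andP[_ /existsPn/(_ v)]; rewrite negbK => /existsP[u uv].
by apply/card_gt0P; exists u; rewrite inE.
Qed.

Lemma out1P A u v : (u, v) \in A ->
  (#|out A u| == 1%N) = ~~ [exists y, (y != v) && ((u, y) \in A)].
Proof.
move=> uv; apply/cards1P/existsPn => [[z e] y|h].
  apply/andP => -[yv uy]; have /set1P yz : y \in [set z] by rewrite -e inE.
  by have /set1P vz : v \in [set z]; [rewrite -e inE | rewrite yz vz eqxx in yv].
exists v; apply/setP => y; rewrite !inE; apply/idP/eqP => [uy|-> //].
by have := h y; rewrite uy andbT negbK => /eqP.
Qed.

Lemma inn1P A u v : (u, v) \in A ->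
  (#|inn A v| == 1%N) = ~~ [exists x, (x != u) && ((x, v) \in A)].
Proof.
move=> uv; apply/cards1P/existsPn => [[z e] y|h].
  apply/andP => -[yu yv]; have /set1P yz : y \in [set z] by rewrite -e inE.
  by have /set1P vz : u \in [set z]; [rewrite -e inE | rewrite yz vz eqxx in yu].
exists u; apply/setP => y; rewrite !inE; apply/idP/eqP => [uy|-> //].
by have := h y; rewrite uy andbT negbK => /eqP.
Qed.

(** If only one end of the arc had a second arc, that second arc would be useless. *)
Lemma reduced_deg A u v : reduced A -> (u, v) \in A ->
  (#|out A u| == 1%N) = (#|inn A v| == 1%N).
Proof.
move=> /andP[_ /forallP h] uv; rewrite (out1P uv) (inn1P uv); congr (~~ _).
apply/idP/idP => /existsP[x /andP[xu xv]]; apply: contraT => no.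
  have /forallP/(_ x)/negP[] := h u; rewrite /useless xv; apply/orP; right.
  by apply/existsP; exists v; rewrite uv no eq_sym xu.
have /forallP/(_ v)/negP[] := h x; rewrite /useless xv; apply/orP; left.
by apply/existsP; exists u; rewrite uv no eq_sym xu.
Qed.

Lemma sum_inv_out A (R : realFieldType) : ~~ dead A ->
  \sum_(p in A) (#|out A p.1|%:R^-1 : R) = #|T|%:R.
Proof.
move=> nd; rewrite (eq_bigl (fun p => true && (p.2 \in out A p.1))) => [|[u v]]; last by rewrite inE.
rewrite -(pair_big_dep xpredT (fun u v => v \in out A u) (fun u _ => #|out A u|%:R^-1)) /=.
rewrite -[RHS](@sumr_const _ _ T 1); apply: eq_bigr => u _.
by rewrite sumr_const -[_^-1 *+ _]mulr_natl mulfV // pnatr_eq0 -lt0n out_gt0.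
Qed.

Lemma sum_inv_inn A (R : realFieldType) : ~~ dead A ->
  \sum_(p in A) (#|inn A p.2|%:R^-1 : R) = #|T|%:R.
Proof.
move=> nd; rewrite (eq_bigl (fun p => true && (p.1 \in inn A p.2))) => [|[u v]]; last by rewrite inE.
rewrite -(pair_big_dep xpredT (fun u v => u \in inn A v) (fun _ v => #|inn A v|%:R^-1)) /=.
rewrite (exchange_big_dep xpredT) //= -[RHS](@sumr_const _ _ T 1); apply: eq_bigr => v _.
by rewrite sumr_const -[_^-1 *+ _]mulr_natl mulfV // pnatr_eq0 -lt0n inn_gt0.
Qed.

(* Summing 1/outdegree and 1/indegree over all arcs gives the number of
   vertices both times, so no indegree can exceed the outdegree. *)
Lemma inn_le2 A u v : reduced A -> (forall u, (#|out A u| <= 2)%N) ->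
  (u, v) \in A -> (#|inn A v| <= 2)%N.
Proof.
move=> rA o2 uv; have nd : ~~ dead A by case/andP: rA.
pose f (p : T * T) := (#|out A p.1|%:R^-1 - #|inn A p.2|%:R^-1 : rat).
(* Outdegree 1 goes with indegree 1, and outdegree 2 with indegree at least 2. So every difference
   is nonnegative, and as they sum to 0 each of them vanishes. *)
have f0 p : p \in A -> 0 <= f p.
  case: p => x y xy; rewrite /f subr_ge0 lef_pV2 ?posrE ?ltr0n ?out_gt0 ?inn_gt0 // ler_nat /=.
  have := reduced_deg rA xy; have := o2 x; have := out_gt0 x nd; have := inn_gt0 y nd.
  lia.
have: \sum_(p in A) f p = 0 by rewrite sumrB sum_inv_out // sum_inv_inn // subrr.
move/eqP; rewrite psumr_eq0 // => /allP/(_ (u, v) (mem_index_enum _)).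
rewrite uv /= subr_eq0 => /eqP/invr_inj/eqP; rewrite eqr_nat => /eqP <-.
exact: o2.
Qed.

Lemma square_max A a b c d : square A a b c d ->
  exists a' b' c' d', max_square w A a' b' c' d'.
Proof.
move=> sq.
pose P (p : T * T * T * T) := square A p.1.1.1 p.1.1.2 p.1.2 p.2.
pose D (p : T * T * T * T) := swap_cost w p.1.1.1 p.1.1.2 p.1.2 p.2.
have := @Order.TotalTheory.arg_maxP _ _ _ (a, b, c, d) P D sq.
case=> -[[[a' b'] c'] d'] Pi mx; exists a', b', c', d'; apply/andP; split=> //.
apply/existsPn => x; apply/existsPn => y; apply/existsPn => z; apply/existsPn => t.
apply/andP => -[sq']; have := mx (x, y, z, t) sq'; rewrite /D /= => le.
by rewrite ltNge subr_le0 le.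
Qed.

(** Two arcs out of one vertex would lie in a square, and then some square would be maximal. So all
    outdegrees are 1, and the indegrees follow by reducedness. *)
Lemma leaf_perm A : reduced A -> squared A ->
  (forall a b c d, ~~ max_square w A a b c d) ->
  exists s, forall u v, ((u, v) \in A) = (s u == v).
Proof.
move=> rA sq nm; have nd : ~~ dead A by case/andP: rA.
have o1 u v y : (u, v) \in A -> (u, y) \in A -> v = y.
  move=> uv uy; apply/eqP/negPn/negP => vy; have [x /and3P[xu xv xy]] := sq.2 _ _ _ uv uy vy.
  have /square_max[a [b [c [d]]]] : square A u x v y by rewrite /square eq_sym xu vy uv uy xv.
  by rewrite (negbTE (nm a b c d)).
have oc u : #|out A u| = 1%N.
  apply/eqP; have /card_gt0P[v] := out_gt0 u nd; rewrite inE => uv.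
  rewrite (out1P uv); apply/existsPn => y; apply/andP => -[yv uy].
  by rewrite (o1 _ _ _ uv uy) eqxx in yv.
have ex u : {v | (u, v) \in A}.
  by apply/sigW; have /card_gt0P[v] := out_gt0 u nd; rewrite inE; exists v.
pose f u := sval (ex u); have fP u : (u, f u) \in A by rewrite /f; case: (ex u).
have fi : injective f.
  move=> u x e; have := reduced_deg rA (fP u); rewrite oc => /esym/eqP/eqP/cards1P[z].
  move/setP => h; have := h u; have := h x; rewrite !inE fP e fP.
  by move/esym/eqP => -> /esym/eqP ->.
exists (perm fi) => u v; rewrite permE; apply/idP/eqP => [uv|<- //].
exact: o1 (fP u) uv.
Qed.

Lemma leaf_ham A s t : (forall u v, ((u, v) \in A) = (s u == v)) -> ham r A t -> t = s.
Proof. by move=> h /hamP[tA _]; apply/permP => u; have := tA u; rewrite h => /eqP. Qed.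

(** When the arcs are exactly those of [s], a path from [r] can only run along the cycle of [r]. *)
Lemma leaf_reaches A s : (forall u v, ((u, v) \in A) = (s u == v)) ->
  reaches r A -> ham r A s.
Proof.
move=> h /forallP reach; apply/hamP; split=> [u|]; first by rewrite h.
apply/setP => z; rewrite inE; have /connectP[p] := reach z.
elim/last_ind: p z => [|p y IH] z; first by move=> _ ->; apply: porbit_id.
rewrite rcons_path last_rcons h => /andP[/IH /(_ erefl) h1 /eqP h2 ->].
by move: h1; rewrite -!eq_porbit_mem -h2 porbit_step.
Qed.

End Reduced.

(** * The potential and the analysis of branching *)

Section Potential.
Variables (T : finType) (R : realType) (c : R).
Implicit Types (A B D : {set T * T}).

Definition undecided A := #|[set u | (1 < #|out A u|)%N]|.
Definition surplus A := (\sum_u (#|out A u| - 2))%N.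
(** With [c] the cube root of 2 this is the product of the weights, since 2^beta = 3/2. Keeping [c]
    abstract, known through c^3 = 2, reduces the estimates to rational arithmetic. *)
Definition Phi A : R := c ^+ undecided A * (3%:R / 2%:R) ^+ surplus A.
(* Maximizing over all reduced subsets makes this monotone, so that discarding
   useless arcs needs no analysis; an infeasible arc set weighs 0. *)
Definition maxPhi A : R := \big[Num.max/0]_(B : {set T * T} | (B \subset A) && reduced B) Phi B.
(* The polynomial factors pay for the rounds without branching and for the
   branches that turn out to be infeasible. *)
Definition potential A : R := (#|A|%:R + 1) ^+ 2 * maxPhi A + (#|A|%:R + 1).
Definition choose A u v := [set p in A | (p.1 != u) || (p.2 == v)].

Lemma out_sub A B u : B \subset A -> out B u \subset out A u.
Proof. by move=> /subsetP h; apply/subsetP => v; rewrite !inE => /h. Qed.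

Lemma card_out_sub A B u : B \subset A -> (#|out B u| <= #|out A u|)%N.
Proof. by move=> h; apply/subset_leq_card/out_sub. Qed.

Lemma undecided_drop A B (s : seq T) : B \subset A -> uniq s ->
  all (fun x => (1 < #|out A x|) && (#|out B x| <= 1))%N s ->
  (undecided B + size s <= undecided A)%N.
Proof.
move=> BA us /allP h; rewrite -(card_uniqP us) /undecided -[X in (_ + X)%N]cardsE -cardsUI.
rewrite [X in (_ + X)%N](_ : _ = 0)%N ?addn0.
  apply/subset_leq_card/subsetP => u; rewrite !inE => /orP[|/h /andP[] //].
  by move=> /leq_trans; apply; apply: card_out_sub.
apply/eqP; rewrite cards_eq0 -subset0; apply/subsetP => u.
by rewrite !inE => /andP[b /h /andP[_]]; rewrite leqNgt b.
Qed.

Lemma surplus_drop A B (s : seq T) : B \subset A -> uniq s ->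
  all (fun x => (2 < #|out A x|) && (#|out B x| < #|out A x|))%N s ->
  (surplus B + size s <= surplus A)%N.
Proof.
move=> BA us /allP h; rewrite -(card_uniqP us) -sum1_card big_mkcond -big_split /=.
apply: leq_sum => u _; have := card_out_sub u BA.
by case: ifPn => [/h|_]; lia.
Qed.

Hypotheses (c3 : c ^+ 3 = 2%:R) (c0 : 0 < c).

(** (5/4)^3 = 125/64 falls just short of 2. This bound, its square and c^3 = 2 itself carry all
    numerical estimates of the branchings. *)
Lemma c_ge : 5%:R / 4%:R <= c.
Proof.
rewrite leNgt; apply/negP => h.
have : c ^+ 3 < (5%:R / 4%:R) ^+ 3 by rewrite ltrXn2r ?nnegrE ?ltW //; lra.
by rewrite c3; lra.
Qed.

Lemma Phi_gt0 A : 0 < Phi A.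
Proof. by rewrite mulr_gt0 // exprn_gt0 //; lra. Qed.

Lemma Phi_ge1 A : 1 <= Phi A.
Proof.
by rewrite -[1]mulr1 ler_pM // exprn_ege1 //; have := c_ge; lra.
Qed.

Lemma Phi_drop A B i j : (undecided B + i <= undecided A)%N ->
  (surplus B + j <= surplus A)%N ->
  Phi B * (c ^+ i * (3%:R / 2%:R) ^+ j) <= Phi A.
Proof.
move=> h1 h2; rewrite mulrACA -!exprD.
by apply: ler_pM; rewrite ?exprn_ge0 ?ler_weXn2l ?ltW //; have := c_ge; lra.
Qed.

Lemma choose_sub A u v : choose A u v \subset A.
Proof. by apply/subsetP => p; rewrite inE => /andP[]. Qed.

Lemma maxPhi_ge0 A : 0 <= maxPhi A.
Proof. exact: bigmax_ge_id. Qed.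

Lemma maxPhi_sub A B : B \subset A -> maxPhi B <= maxPhi A.
Proof.
move=> BA; apply: bigmax_le => [|D /andP[DB rD]]; first exact: maxPhi_ge0.
by apply: le_bigmax_cond; rewrite rD (subset_trans DB BA).
Qed.

Lemma maxPhi_le A x : 0 <= x -> (forall B, B \subset A -> reduced B -> Phi B <= x) ->
  maxPhi A <= x.
Proof. by move=> x0 h; apply: bigmax_le => // B /andP[]; apply: h. Qed.

Lemma Phi_max A : reduced A -> Phi A <= maxPhi A.
Proof. by move=> rA; apply: le_bigmax_cond; rewrite subxx. Qed.

Lemma potential_ge1 A : 1 <= potential A.
Proof.
have : 0 <= (#|A|%:R + 1) ^+ 2 * maxPhi A by rewrite mulr_ge0 ?maxPhi_ge0 ?exprn_ge0 // addr_ge0.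
have : 0 <= #|A|%:R :> R by [].
rewrite /potential; lra.
Qed.

Lemma potential_proper A B : B \proper A -> potential B + 1 <= potential A.
Proof.
move=> BA; have lt := proper_card BA.
have h : #|B|%:R + 1 <= #|A|%:R :> R by rewrite natr1 ler_nat.
rewrite /potential -addrA lerD //; last by lra.
apply: ler_pM; rewrite ?maxPhi_ge0 ?exprn_ge0 ?maxPhi_sub ?proper_sub ?addr_ge0 //.
by rewrite lerXn2r ?nnegrE ?addr_ge0 //; lra.
Qed.

(** Let A have N arcs. The quadratic factor falls from (N + 1)^2 to at most N^2, which frees (2N +
    1) * [maxPhi A]. As [A] is reduced, [maxPhi A] is at least 1, so this pays for the second linear
    term and for the round. *)
Lemma potential_split A B D : B \proper A -> D \proper A -> reduced A ->
  maxPhi B + maxPhi D <= maxPhi A -> potential B + potential D + 1 <= potential A.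
Proof.
move=> BA DA rA le.
have hB : #|B|%:R + 1 <= #|A|%:R :> R by rewrite natr1 ler_nat proper_card.
have hD : #|D|%:R + 1 <= #|A|%:R :> R by rewrite natr1 ler_nat proper_card.
have b0 : 0 <= #|B|%:R :> R by []. have d0 : 0 <= #|D|%:R :> R by [].
have m1 := le_trans (Phi_ge1 A) (Phi_max rA).
rewrite /potential; set a := #|A|%:R in hB hD *.
have: (#|B|%:R + 1) ^+ 2 * maxPhi B <= a ^+ 2 * maxPhi B.
  by rewrite ler_wpM2r ?maxPhi_ge0 // lerXn2r ?nnegrE //; lra.
have: (#|D|%:R + 1) ^+ 2 * maxPhi D <= a ^+ 2 * maxPhi D.
  by rewrite ler_wpM2r ?maxPhi_ge0 // lerXn2r ?nnegrE //; lra.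
have: a ^+ 2 * (maxPhi B + maxPhi D) <= a ^+ 2 * maxPhi A by rewrite ler_wpM2l ?sqr_ge0.
have : 2 * a + 1 <= (2 * a + 1) * maxPhi A by rewrite ler_peMr //; lra.
rewrite !mulrDr; nra.
Qed.

(** [choose] discards only the other arcs out of [u]. Those into [v] go by reducedness: [u] needs an
    out-arc, only [u -> v] is left, and an arc alone at its tail is alone at its head. *)
Lemma row_choose A B u v : B \subset choose A u v -> reduced B ->
  (forall y, ((u, y) \in B) = (y == v)) /\ (forall x, ((x, v) \in B) = (x == u)).
Proof.
move=> /subsetP BA rB; have nd : ~~ dead B by case/andP: rB.
have sub y : (u, y) \in B -> y = v by move/BA; rewrite !inE eqxx /= => /andP[_ /eqP].
have uv : (u, v) \in B.
  by have /card_gt0P[y] := out_gt0 u nd; rewrite inE => h; rewrite -(sub _ h).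
split=> [y|x]; first by apply/idP/eqP => [/sub|->].
apply/idP/eqP => [xv|-> //]; apply/eqP; apply: contraT => xu; have := reduced_deg rB uv.
rewrite (inn1P uv) (out1P uv).
have -> : [exists x, (x != u) && ((x, v) \in B)] by apply/existsP; exists x; rewrite xu.
rewrite (_ : [exists y, _] = false) //; apply/existsP => -[y /andP[yv /sub e]].
by rewrite e eqxx in yv.
Qed.

Lemma undecided_row A u v x : reduced A -> (u, v) \in A -> (x, v) \in A -> x != u ->
  (1 < #|out A x|)%N.
Proof.
move=> rA uv xv xu; have nd : ~~ dead A by case/andP: rA.
rewrite ltn_neqAle out_gt0 // andbT eq_sym (reduced_deg rA xv) (inn1P xv) negbK.
by apply/existsP; exists u; rewrite uv eq_sym xu.
Qed.

Lemma out_lost A B x v : B \subset A -> (x, v) \in A -> (x, v) \notin B ->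
  (#|out B x| < #|out A x|)%N.
Proof.
move=> BA xv xvB; apply/proper_card/properP; split; first exact: out_sub.
by exists v; rewrite inE.
Qed.

(** Without [u -> v] the vertex [v] can only be entered from [x], and an arc alone at its head is
    alone at its tail. *)
Lemma forced_row A B u v x : B \subset A -> reduced B -> (u, v) \notin B ->
  (forall y, (y, v) \in A -> (y == u) || (y == x)) -> #|out B x| = 1%N.
Proof.
move=> /subsetP BA rB uvB col; have nd : ~~ dead B by case/andP: rB.
have sub y : (y, v) \in B -> y = x.
  move=> yv; have := col y (BA _ yv) => /orP[/eqP e|/eqP //].
  by rewrite e (negbTE uvB) in yv.
have xv : (x, v) \in B.
  by have /card_gt0P[y] := inn_gt0 v nd; rewrite inE => h; rewrite -(sub _ h).
apply/eqP; rewrite (reduced_deg rB xv) (inn1P xv).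
by apply/existsPn => y; apply/andP => -[yx /sub e]; rewrite e eqxx in yx.
Qed.

Lemma Phi_ratio A B (i j : nat) (k : R) : (undecided B + i <= undecided A)%N ->
  (surplus B + j <= surplus A)%N -> 0 < k ->
  1 <= k * (c ^+ i * (3%:R / 2%:R) ^+ j) -> Phi B <= k * Phi A.
Proof.
move=> h1 h2 k0 h; apply: (le_trans (y := k * (Phi B * (c ^+ i * (3%:R / 2%:R) ^+ j)))).
  by rewrite mulrCA ler_peMr // ltW // Phi_gt0.
by rewrite ler_pM2l // Phi_drop.
Qed.

Lemma col_le2 A v u x y : (#|inn A v| <= 2)%N -> (u, v) \in A -> (x, v) \in A -> x != u ->
  (y, v) \in A -> (y == u) || (y == x).
Proof.
move=> le uv xv xu yv; apply/negPn/negP; rewrite negb_or => /andP[yu yx].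
have: (#|[set u; x; y]| <= #|inn A v|)%N.
  by apply/subset_leq_card/subsetP => z; rewrite !inE => /orP[/orP[]|] /eqP ->.
have -> : #|[set u; x; y]| = 3%N.
  by rewrite setUC cardsU1 cards2 !inE negb_or yu yx eq_sym xu.
by lia.
Qed.

Lemma two_more_out A u v : (u, v) \in A -> two_more A u v -> (2 < #|out A u|)%N.
Proof.
move=> uv /existsP[y /existsP[z /and5P[yv zv yz uy uz]]].
have <- : #|[set v; y; z]| = 3%N.
  by rewrite setUC cardsU1 cards2 !inE negb_or zv eq_sym yz eq_sym yv.
by apply/subset_leq_card/subsetP => t; rewrite !inE => /orP[/orP[]|] /eqP ->.
Qed.

Lemma out_two_more A u v : (u, v) \in A -> (2 < #|out A u|)%N -> two_more A u v.
Proof.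
move=> uv h.
have : (1 < #|out A u :\ v|)%N by move: h; rewrite (cardsD1 v (out A u)) inE uv.
case/card_gt1P => y [z [+ + yz]]; rewrite !inE => /andP[yv uy] /andP[zv uz].
by apply/existsP; exists y; apply/existsP; exists z; apply/and5P.
Qed.

(** Both summands are maxima over reduced subsets, so it suffices to bound each such subset of the
    two children by fractions [k1] and [k2] of [Phi A] with k1 + k2 <= 1. Reducedness of the subsets
    is what decides vertices besides [u]. *)
Lemma maxPhi_branch A u v : reduced A -> branching A u v ->
  maxPhi (A :\ (u, v)) + maxPhi (choose A u v) <= maxPhi A.
Proof.
move=> rA /andP[uv br]; have nd : ~~ dead A by case/andP: rA.
apply: le_trans (Phi_max rA); have P0 := Phi_gt0 A; have c1 := c_ge.
have c2 : (5%:R / 4%:R) ^+ 2 <= c ^+ 2 by rewrite lerXn2r ?nnegrE //; lra.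
suff [k1 [k2 [k10 k20 k12 h1 h2]]] : exists k1 k2 : R, [/\ 0 < k1, 0 < k2, k1 + k2 <= 1,
   forall B, B \subset A :\ (u, v) -> reduced B -> Phi B <= k1 * Phi A &
   forall B, B \subset choose A u v -> reduced B -> Phi B <= k2 * Phi A].
  apply: (le_trans (y := k1 * Phi A + k2 * Phi A)).
    by apply: lerD; apply: maxPhi_le => //; rewrite mulr_ge0 // ltW.
  by rewrite -mulrDl ler_piMl // ltW.
have delA B : B \subset A :\ (u, v) -> B \subset A /\ (u, v) \notin B.
  move=> h; split; first by apply: subset_trans h (subsetDl _ _).
  by apply/negP => /(subsetP h); rewrite !inE eqxx.
have choA B : B \subset choose A u v -> reduced B ->
  [/\ B \subset A, (#|out B u| <= 1)%N & forall x, x != u -> (x, v) \notin B].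
  move=> h rB; have [row col] := row_choose h rB; split.
  - exact: subset_trans h (choose_sub _ _ _).
  - rewrite (eq_card (_ : _ =i pred1 v)) ?card1 // => y.
    by rewrite inE row.
  - by move=> x xu; rewrite col.
(* Taking [u -> v] costs every other tail [x] of [v] an arc: with outdegree 2 it becomes decided,
   worth c; with more it loses surplus, worth 3/2. *)
have lost B x : B \subset choose A u v -> reduced B -> x != u -> (x, v) \in A ->
   (((1 < #|out A x|) && (#|out B x| <= 1)) || ((2 < #|out A x|) && (#|out B x| < #|out A x|)))%N.
  move=> h rB xu xv; have [BA _ nB] := choA _ h rB.
  move: (undecided_row rA uv xv xu) (out_lost BA xv (nB _ xu)).
  by move: #|out A x| #|out B x| => i j; clear; lia.
case: (boolP (two_more A u v)) br => [tm _|_ /= /andP[no /existsP[y /and3P[yv uy /existsPn ny]]]].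
  have ou := two_more_out uv tm; have ou1 : (1 < #|out A u|)%N by apply: ltnW.
  have : (1 < #|inn A v|)%N.
    rewrite ltn_neqAle inn_gt0 // andbT eq_sym -(reduced_deg rA uv).
    by rewrite eqn_leq negb_and -ltnNge ou1.
  rewrite leq_eqVlt => /orP[in2|in3].
    have [x xu xv] : exists2 x, x != u & (x, v) \in A.
      have : (0 < #|inn A v :\ u|)%N by move: in2; rewrite (cardsD1 u) inE uv; case: #|_ :\ u|.
      by case/card_gt0P => x; rewrite !inE => /andP[]; exists x.
    have ox := undecided_row rA uv xv xu.
    have col y : (y, v) \in A -> (y == u) || (y == x).
      by apply: col_le2; rewrite ?(eqP in2).
    (* Discarding gains c * 3/2 >= 15/8, as [x] is forced. Taking gains c^2 * 3/2 >= 75/32 or c *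
       9/4 >= 45/16, both above 7/3. The sum 8/15 + 3/7 is 101/105. *)
    exists (8%:R / 15%:R), (3%:R / 7%:R); split; try lra.
      move=> B BA rB; have [{}BA uvB] := delA _ BA.
      apply: (@Phi_ratio _ _ 1 1); [| |lra|rewrite !expr1; lra].
        apply: (@undecided_drop _ _ [:: x]) => //=.
        by rewrite ox (forced_row BA rB uvB col).
      by apply: (@surplus_drop _ _ [:: u]) => //=; rewrite ou (out_lost BA uv uvB).
    move=> B BA' rB; have [BA ou2 nB] := choA _ BA' rB.
    have sp : (#|out B u| < #|out A u|)%N by apply: leq_ltn_trans ou2 _.
    have /orP[h|h] := lost _ _ BA' rB xu xv.
      apply: (@Phi_ratio _ _ 2 1); [| |lra|rewrite expr1; lra].
        by apply: (@undecided_drop _ _ [:: x; u]) => //=; rewrite ?inE ?xu ?h ?ou1 ?ou2.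
      by apply: (@surplus_drop _ _ [:: u]) => //=; rewrite ou sp.
    apply: (@Phi_ratio _ _ 1 2); [| |lra|rewrite expr1 expr2; lra].
      by apply: (@undecided_drop _ _ [:: u]) => //=; rewrite ou1 ou2.
    by apply: (@surplus_drop _ _ [:: x; u]) => //=; rewrite ?inE ?xu ?h ?ou ?sp.
  have [x [z [xu zu xz xv zv]]] : exists x z, [/\ x != u, z != u, x != z, (x, v) \in A & (z, v) \in A].
    have : (1 < #|inn A v :\ u|)%N by move: in3; rewrite (cardsD1 u) inE uv.
    case/card_gt1P => x [z [+ + xz]]; rewrite !inE => /andP[? ?] /andP[? ?].
    by exists x, z.
  (* Discarding is only sure to lower the surplus of [u]. Taking gains least when [x] and [z] both
     become decided: c^3 * 3/2 = 3. *)
  exists (2%:R / 3%:R), (1 / 3%:R); split; try lra.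
    move=> B BA rB; have [{}BA uvB] := delA _ BA.
    apply: (@Phi_ratio _ _ 0 1); [| |lra|rewrite expr0 expr1; lra].
      exact: (@undecided_drop _ _ [::]).
    by apply: (@surplus_drop _ _ [:: u]) => //=; rewrite ou (out_lost BA uv uvB).
  move=> B BA' rB; have [BA ou2 nB] := choA _ BA' rB.
  have sp : (#|out B u| < #|out A u|)%N by apply: leq_ltn_trans ou2 _.
  have /orP[hx|hx] := lost _ _ BA' rB xu xv; have /orP[hz|hz] := lost _ _ BA' rB zu zv.
  - apply: (@Phi_ratio _ _ 3 1); [| |lra|rewrite c3 expr1; lra].
      by apply: (@undecided_drop _ _ [:: x; z; u]) => //=; rewrite ?inE ?negb_or ?xu ?zu ?xz ?hx ?hz ?ou1 ?ou2.
    by apply: (@surplus_drop _ _ [:: u]) => //=; rewrite ou sp.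
  - apply: (@Phi_ratio _ _ 2 2); [| |lra|rewrite [_ ^+ 2 in X in _ * X]expr2; lra].
      by apply: (@undecided_drop _ _ [:: x; u]) => //=; rewrite ?inE ?xu ?hx ?ou1 ?ou2.
    by apply: (@surplus_drop _ _ [:: z; u]) => //=; rewrite ?inE ?zu ?hz ?ou ?sp.
  - apply: (@Phi_ratio _ _ 2 2); [| |lra|rewrite [_ ^+ 2 in X in _ * X]expr2; lra].
      by apply: (@undecided_drop _ _ [:: z; u]) => //=; rewrite ?inE ?zu ?hz ?ou1 ?ou2.
    by apply: (@surplus_drop _ _ [:: x; u]) => //=; rewrite ?inE ?xu ?hx ?ou ?sp.
  - apply: (@Phi_ratio _ _ 1 3); [| |lra|rewrite expr1 !exprS expr0; lra].
      by apply: (@undecided_drop _ _ [:: u]) => //=; rewrite ou1 ou2.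
    by apply: (@surplus_drop _ _ [:: x; z; u]) => //=; rewrite ?inE ?negb_or ?xu ?zu ?xz ?hx ?hz ?ou ?sp.
have o2 t : (#|out A t| <= 2)%N.
  rewrite leqNgt; apply/negP => ot; move/negP: no; apply.
  have /card_gt0P[s] : (0 < #|out A t|)%N by apply: ltn_trans ot.
  rewrite inE => ts; apply/existsP; exists t; apply/existsP; exists s.
  by rewrite ts out_two_more.
have ou1 : (1 < #|out A u|)%N.
  rewrite ltn_neqAle out_gt0 // andbT eq_sym (out1P uv) negbK.
  by apply/existsP; exists y; rewrite yv.
have [x xu xv] : exists2 x, x != u & (x, v) \in A.
  have : #|inn A v| != 1%N by rewrite -(reduced_deg rA uv) gtn_eqF.
  by rewrite (inn1P uv) negbK => /existsP[x /andP[]]; exists x.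
have [z zu zy] : exists2 z, z != u & (z, y) \in A.
  have : #|inn A y| != 1%N by rewrite -(reduced_deg rA uy) gtn_eqF.
  by rewrite (inn1P uy) negbK => /existsP[z /andP[]]; exists z.
(* No vertex other than [u] is a tail of both [v] and [y], so [u], [x], [z] are three vertices; both
   branches decide all of them. *)
have xz : x != z.
  by apply: contraTneq zy => <-; have := ny x; rewrite xu xv.
have ox := undecided_row rA uv xv xu; have oz := undecided_row rA uy zy zu.
have colv t : (t, v) \in A -> (t == u) || (t == x) by apply: col_le2; rewrite ?(inn_le2 rA o2 uv).
have coly t : (t, y) \in A -> (t == u) || (t == z) by apply: col_le2; rewrite ?(inn_le2 rA o2 uy).
have coly' t : (t, y) \in A -> (t == z) || (t == u) by move/coly; rewrite orbC.
have fin B : B \subset A -> (#|out B u| <= 1)%N -> (#|out B x| <= 1)%N ->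
    (#|out B z| <= 1)%N -> Phi B <= 1 / 2%:R * Phi A.
  move=> BA bu bx bz; apply: (@Phi_ratio _ _ 3 0); [| |lra|rewrite c3 expr0; lra].
    by apply: (@undecided_drop _ _ [:: x; z; u]) => //=; rewrite ?inE ?negb_or ?xu ?zu ?xz ?ou1 ?ox ?oz ?bu ?bx ?bz.
  exact: (@surplus_drop _ _ [::]).
have lt2 B t s : B \subset A -> (t, s) \in A -> (t, s) \notin B -> (#|out B t| <= 1)%N.
  move=> BA ts tsB; move: (out_lost BA ts tsB) (o2 t).
  by move: #|out A t| #|out B t| => i j; clear; lia.
exists (1 / 2%:R), (1 / 2%:R); split; try lra.
  move=> B BA rB; have [{}BA uvB] := delA _ BA; apply: fin => //.
  - exact: lt2 uv uvB.
  - by rewrite (forced_row BA rB uvB colv).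
  (* After [u -> v] is discarded, [u] is left with [y] alone; hence [y] can be entered only from
     [u], and [z] loses its arc into [y]. *)
  apply: (lt2 _ _ y) => //; apply/negP => zyB.
  have uyB : (u, y) \in B.
    have ndB : ~~ dead B by case/andP: rB.
    have /card_gt0P[t] := out_gt0 u ndB; rewrite inE => ut.
    have := o2 u; rewrite leqNgt; have [<- //|ty] := eqVneq t y; case/negP.
    apply: (two_more_out uv); apply/existsP; exists y; apply/existsP; exists t.
    rewrite yv [y == t]eq_sym ty uy (subsetP BA _ ut) !andbT /=.
    by apply: contraNneq uvB => <-.
  have := reduced_deg rB uyB; rewrite (_ : #|out B u| = 1%N); last first.
    by apply/eqP; rewrite eqn_leq (lt2 _ _ _ BA uv uvB) out_gt0 //; case/andP: rB.
  move/esym/eqP/eqP; rewrite (inn1P uyB) => /existsPn/(_ z).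
  by rewrite zyB zu.
(* Taking [u -> v] decides [u], costs [x] its arc into [v], and leaves [z] as the only tail of
   [y]. *)
move=> B BA' rB; have [BA ou2 nB] := choA _ BA' rB; have [row _] := row_choose BA' rB.
apply: fin => //; first by apply: lt2 xv (nB _ xu).
by rewrite (@forced_row A B u y z) // row.
Qed.

Lemma choose_proper A u v : branching A u v -> choose A u v \proper A.
Proof.
move=> /andP[uv h]; rewrite properE choose_sub /=; apply/subsetPn.
have [y yv uy] : exists2 y, y != v & (u, y) \in A.
  case/orP: h => [/existsP[y /existsP[z /and5P[yv _ _ uy _]]]|/andP[_ /existsP[y /and3P[yv uy _]]]].
    by exists y.
  by exists y.
by exists (u, y) => //; rewrite !inE uy eqxx (negbTE yv).
Qed.

Lemma potential_branch A u v : reduced A -> branching A u v ->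
  potential (A :\ (u, v)) + potential (choose A u v) + 1 <= potential A.
Proof.
move=> rA br; apply: potential_split => //; last exact: maxPhi_branch.
  by apply: properD1; case/andP: br.
exact: choose_proper.
Qed.

End Potential.

(** * A compiler for first-order tests *)

(** Each variable owns three registers from 20 on; those below 20 hold the input size, truth values,
    addresses and accumulators. *)
Definition vr (x : nat) : nat := (20 + 3 * x)%N.
Definition rr (x : nat) : nat := (21 + 3 * x)%N.
Definition cr (x : nat) : nat := (22 + 3 * x)%N.

(* Variable x ranges over the vertices; [rr x] caches the offset n * x of its
   row, since the machine has no multiplication, and [cr x] is a loop counter. *)
Definition advance x : cmd :=
  If (Defs.Sub (Defs.Sub (Reg 0) (Reg (vr x))) (Lit 1))
    (Seq (Assign (vr x) (Defs.Add (Reg (vr x)) (Lit 1)))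
         (Assign (rr x) (Defs.Add (Reg (rr x)) (Reg 0))))
    (Seq (Assign (vr x) (Lit 0)) (Assign (rr x) (Lit 0))).

(** The guard [b] breaks off the loop by clearing the counter without advancing, so a successful
    search leaves its witness in [x]. *)
Definition loop x b c : cmd :=
  Seq (Assign (vr x) (Lit 0)) (Seq (Assign (rr x) (Lit 0))
    (Seq (Assign (cr x) (Reg 0))
      (While (Reg (cr x))
        (Seq c
          (If b (Assign (cr x) (Lit 0))
            (Seq (Assign (cr x) (Defs.Sub (Reg (cr x)) (Lit 1))) (advance x))))))).

(* First-order conditions on matrices stored in memory: [Pos l] compares a
   signed sum of entries with 0, where [(sg, b, x, y)] stands for the entry in
   row x and column y of the matrix whose address is in register b. *)
Inductive form :=
  | Pos of seq (bool * nat * nat * nat)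
  | Same of nat & nat
  | Not of form
  | And of form & form
  | Ex of nat & form.

Definition Or f g := Not (And (Not f) (Not g)).

Definition entry b x y : expr := Defs.Mem (Defs.Add (Reg b) (Defs.Add (Reg (rr x)) (Reg (vr y)))).

Definition entry_sum (l : seq (bool * nat * nat * nat)) : expr :=
  foldr (fun '(sg, b, x, y) acc => (if sg then Defs.Add else Defs.Sub) acc (entry b x y)) (Lit 0) l.

(* The truth value is left in register 1.  After a successful search the
   outermost existential variables hold witnesses. *)
Fixpoint test (f : form) : cmd :=
  match f with
  | Pos l => If (entry_sum l) (Assign 1 (Lit 1)) (Assign 1 (Lit 0))
  | Same x y =>
      If (Defs.Sub (Reg (vr x)) (Reg (vr y))) (Assign 1 (Lit 0))
        (If (Defs.Sub (Reg (vr y)) (Reg (vr x))) (Assign 1 (Lit 0)) (Assign 1 (Lit 1)))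
  | Not f => Seq (test f) (Assign 1 (Defs.Sub (Lit 1) (Reg 1)))
  | And f g => Seq (test f) (If (Reg 1) (test g) Skip)
  | Ex x f => loop x (Reg 1) (test f)
  end.

Definition check f c1 c2 : cmd := Seq (test f) (If (Reg 1) c1 c2).

Fixpoint fv (f : form) : seq nat :=
  match f with
  | Pos l => flatten [seq [:: t.1.2; t.2] | t <- l]
  | Same x y => [:: x; y]
  | Not f => fv f
  | And f g => fv f ++ fv g
  | Ex x f => [seq y <- fv f | y != x]
  end.

Fixpoint bv (f : form) : seq nat :=
  match f with
  | Pos _ | Same _ _ => [::]
  | Not f => bv f
  | And f g => bv f ++ bv g
  | Ex x f => x :: bv f
  end.

(** Variables are global registers, so no search may overwrite what is still to be read: by the
    right side of [And], or by later rounds of an enclosing [Ex]. Matrix addresses avoid registers 0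
    and 1, which hold n and the truth value. *)
Fixpoint wff (f : form) : bool :=
  match f with
  | Pos l => all (fun t => 1 < t.1.1.2 < 20)%N l
  | Same _ _ => true
  | Not f => wff f
  | And f g => [&& wff f, wff g & ~~ has (mem (bv f)) (fv g)]
  | Ex x f => [&& wff f, x \notin bv f & ~~ has (mem (bv f)) (fv f)]
  end.

Fixpoint strip (f : form) : form := if f is Ex _ g then strip g else f.

Fixpoint mods (c : cmd) : seq nat :=
  match c with
  | Skip | Store _ _ => [::]
  | Assign x _ => [:: x]
  | Seq c1 c2 | If _ c1 c2 => mods c1 ++ mods c2
  | While _ c => mods c
  end.

Fixpoint pure (c : cmd) : bool :=
  match c with
  | Skip | Assign _ _ => true
  | Store _ _ => false
  | Seq c1 c2 | If _ c1 c2 => pure c1 && pure c2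
  | While _ c => pure c
  end.

(** A time bound read off the syntax, allowing N rounds to every [While]. It serves everything
    except the main loop, whose rounds are counted by the potential. *)
Fixpoint cost (N : nat) (c : cmd) : nat :=
  match c with
  | Skip => 1
  | Assign _ b => (expr_cost b).+1
  | Store a b => (expr_cost a + expr_cost b).+1
  | Seq c1 c2 => cost N c1 + cost N c2
  | If b c1 c2 => (expr_cost b).+1 + (cost N c1 + cost N c2)
  | While b c => (expr_cost b).+1 + N * ((expr_cost b).+1 + cost N c)
  end.

Lemma cost_poly c : exists K k, forall N, (0 < N)%N -> (cost N c <= K * N ^ k)%N.
Proof.
have up K k K' k' N : (0 < N)%N -> (K * N ^ k + K' * N ^ k' <= (K + K') * N ^ (k + k'))%N.
  move=> N0; rewrite mulnDl leq_add // leq_mul2l leq_pexp2l ?orbT //; lia.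
elim: c => [|x b|a b|c1 [K1 [k1 h1]] c2 [K2 [k2 h2]]|b c1 [K1 [k1 h1]] c2 [K2 [k2 h2]]
           |b c [K [k h]]].
- by exists 1%N, 0%N.
- by exists (expr_cost b).+1, 0%N => N _; rewrite muln1.
- by exists (expr_cost a + expr_cost b).+1, 0%N => N _; rewrite muln1.
- exists (K1 + K2)%N, (k1 + k2)%N => N N0 /=.
  by apply: leq_trans (up _ _ _ _ _ N0); rewrite leq_add ?h1 ?h2.
- exists ((expr_cost b).+1 + (K1 + K2))%N, (0 + (k1 + k2))%N => N N0 /=.
  apply: leq_trans (up _ 0%N _ _ _ N0); rewrite muln1 leq_add2l.
  by apply: leq_trans (up _ _ _ _ _ N0); rewrite leq_add ?h1 ?h2.
exists ((expr_cost b).+1 + ((expr_cost b).+1 + K))%N, (0 + (0 + k).+1)%N => N N0 /=.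
apply: leq_trans (up _ 0%N _ _ _ N0); rewrite muln1 leq_add2l expnS mulnCA leq_mul2l.
apply/orP; right; apply: leq_trans (up _ 0%N _ _ _ N0).
by rewrite muln1 leq_add2l h.
Qed.

Definition touched (f : form) : seq nat :=
  1%N :: flatten [seq [:: vr x; rr x; cr x] | x <- bv f].

Lemma mods_test f y : y \in mods (test f) -> y \in touched f.
Proof.
rewrite /touched; elim: f => [l|x x'|f IH|f IHf g IHg|x f IH] /=.
1,2: by rewrite !inE !orbb.
- by rewrite mem_cat => /orP[/IH|]; rewrite // inE => /eqP ->; rewrite inE.
- rewrite map_cat flatten_cat !mem_cat !inE mem_cat orbF.
  by move=> /orP[/IHf|/IHg]; rewrite inE => /orP[->|->]; rewrite ?orbT.
rewrite /= !(inE, mem_cat).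
repeat (case/orP => [|]); rewrite ?inE; try by move=> ->; rewrite ?orbT.
by move/IH; rewrite inE => /orP[->|->]; rewrite ?orbT.
Qed.

Lemma pure_test f : pure (test f).
Proof. by elim: f => [l|x y|f IH|f IHf g IHg|x f IH] //=; rewrite ?IH ?IHf ?IHg. Qed.

Lemma untouched z f : (z != 1)%N ->
  {in bv f, forall y, [&& z != vr y, z != rr y & z != cr y]} -> z \notin touched f.
Proof.
move=> z1 h; rewrite inE negb_or z1; apply/negP => /flattenP[l /mapP[y yf ->]].
by rewrite !inE; have /and3P[/negbTE -> /negbTE -> /negbTE ->] := h y yf.
Qed.

Lemma touched_var x f : x \notin bv f ->
  [/\ vr x \notin touched f, rr x \notin touched f & cr x \notin touched f].
Proof.
move=> xf; have ne y : y \in bv f -> x != y by move=> yf; apply: contraNneq xf => ->.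
split; apply: untouched => [|y /ne]; rewrite /vr /rr /cr; lia.
Qed.

Lemma touched_low b f : (1 < b < 20)%N -> b \notin touched f.
Proof. by move=> h; apply: untouched => [|y _]; rewrite /vr /rr /cr; lia. Qed.

Definition disjoint_vars f := ~~ has (mem (bv f)) (fv f).

Lemma wff_strip f : wff f -> wff (strip f).
Proof. by elim: f => //= x f IH /and3P[/IH]. Qed.

(** * Total correctness with time and space bounds *)

Section Machine.
Variables (m M W : nat).
Local Notation n := m.+1.
Local Notation vertex := 'I_n.
Implicit Types (s : state) (c : cmd).

(** Termination within the static time bound is part of the claim, and the space bound comes along
    because [exec] derives only runs that fit. *)
Definition wp c s (Q : state -> Prop) :=
  exists t s', [/\ exec M W c s t s', (t <= cost n c)%N & Q s'].

Lemma exec_frame c s t s' : exec M W c s t s' ->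
  (forall x, x \notin mods c -> reg s' x = reg s x) /\ (pure c -> ram s' = ram s).
Proof.
elim=> {c s t s'} //=.
- by move=> s x b _; split=> // y; rewrite inE => /negbTE ->.
- move=> s1 s2 s3 c1 c2 k1 k2 _ [IH1 IH1'] _ [IH2 IH2']; split=> [x|/andP[p1 p2]].
    by rewrite mem_cat negb_or => /andP[/IH1 <- /IH2 ->].
  by rewrite IH2' ?IH1'.
- move=> s s' b c1 c2 k _ _ [IH IH']; split=> [x|/andP[p1 _]]; last exact: IH'.
  by rewrite mem_cat negb_or => /andP[/IH].
- move=> s s' b c1 c2 k _ _ [IH IH']; split=> [x|/andP[_ p2]]; last exact: IH'.
  by rewrite mem_cat negb_or => /andP[_ /IH].
- move=> s1 s2 s3 b c k1 k2 _ _ [IH1 IH1'] _ [IH2 IH2']; split=> [x h|p].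
    by rewrite IH2 ?IH1.
  by rewrite IH2' ?IH1'.
Qed.

Lemma wp_mono c s (Q Q' : state -> Prop) : (forall s', Q s' -> Q' s') -> wp c s Q -> wp c s Q'.
Proof. by move=> h [t [s' [? ? /h]]]; exists t, s'. Qed.

Lemma wp_frame c s (Q Q' : state -> Prop) : wp c s Q ->
  (forall s', Q s' -> (forall x, x \notin mods c -> reg s' x = reg s x) ->
     (pure c -> ram s' = ram s) -> Q' s') -> wp c s Q'.
Proof. by move=> [t [s' [e ? q]]] h; exists t, s'; have [f1 f2] := exec_frame e; split=> //; apply: h. Qed.

Lemma wp_skip s (Q : state -> Prop) : Q s -> wp Skip s Q.
Proof. by move=> q; exists 1%N, s; split=> //; constructor. Qed.

Lemma wp_seq c1 c2 s Q : wp c1 s (fun s' => wp c2 s' Q) -> wp (Seq c1 c2) s Q.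
Proof.
move=> [t1 [s1 [e1 l1 [t2 [s2 [e2 l2 q]]]]]]; exists (t1 + t2)%N, s2.
by split=> //; [apply: exec_seq e1 e2 | apply: leq_add].
Qed.

Lemma fits_set_reg s x v : fits M W s -> `|v| < (2 ^ W)%N%:Z -> fits M W (set_reg s x v).
Proof. by move=> [h1 h2 h3] hv; split=> //= y; case: ifP. Qed.

Lemma fits_set_ram s a v : fits M W s -> 0 <= a < M%:Z -> `|v| < (2 ^ W)%N%:Z ->
  fits M W (set_ram s a v).
Proof.
move=> [h1 h2 h3] ha hv; split=> //= y; first by case: ifP.
by case: eqP => [->|_]; [rewrite ha | apply: h3].
Qed.

Lemma wp_assign x b s (Q : state -> Prop) : fits M W s -> `|eval s b| < (2 ^ W)%N%:Z ->
  Q (set_reg s x (eval s b)) -> wp (Assign x b) s Q.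
Proof.
move=> fs lt q; exists (expr_cost b).+1, (set_reg s x (eval s b)); split=> //.
exact/exec_assign/fits_set_reg.
Qed.

Lemma wp_store a b s (Q : state -> Prop) : fits M W s -> 0 <= eval s a < M%:Z ->
  `|eval s b| < (2 ^ W)%N%:Z -> Q (set_ram s (eval s a) (eval s b)) -> wp (Store a b) s Q.
Proof.
move=> fs ha lt q; exists (expr_cost a + expr_cost b).+1%N, (set_ram s (eval s a) (eval s b)).
by split=> //; apply/exec_store/fits_set_ram.
Qed.

Lemma wp_if b c1 c2 s Q : (0 < eval s b -> wp c1 s Q) -> (eval s b <= 0 -> wp c2 s Q) ->
  wp (If b c1 c2) s Q.
Proof.
case: (ltrP 0 (eval s b)) => h h1 h2.
  have [t [s' [e l q]]] := h1 erefl; exists ((expr_cost b).+1 + t)%N, s'.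
  by split=> //=; [apply: exec_if_true | rewrite leq_add2l (leq_trans l) ?leq_addr].
have [t [s' [e l q]]] := h2 erefl; exists ((expr_cost b).+1 + t)%N, s'.
by split=> //=; [apply: exec_if_false | rewrite leq_add2l (leq_trans l) ?leq_addl].
Qed.

(** The index of [I] bounds the rounds left. It may fall by more than one, as when a [loop] is
    broken off. *)
Lemma wp_while (I : nat -> state -> Prop) k b c s Q : (k <= n)%N -> I k s ->
  (forall k s, I k s -> eval s b <= 0 -> Q s) ->
  (forall k s, I k s -> 0 < eval s b ->
     exists2 k', k = k'.+1 & wp c s (fun s' => exists2 j, (j <= k')%N & I j s')) ->
  wp (While b c) s Q.
Proof.
move=> kn Ik stop step.
suff [t [s' [e l q]]] : exists t s', [/\ exec M W (While b c) s t s',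
    (t <= (expr_cost b).+1 + k * ((expr_cost b).+1 + cost n c))%N & Q s'].
  by exists t, s'; split=> //=; apply: leq_trans l _; rewrite leq_add2l leq_mul2r kn orbT.
elim/ltn_ind: k s {kn} Ik => k IH s Ik.
case: (ltrP 0 (eval s b)) => h; last first.
  exists (expr_cost b).+1, s; split; [exact: exec_while_false|exact: leq_addr|exact: stop Ik h].
have [k' ek [t1 [s1 [e1 l1 [j jk Ij]]]]] := step _ _ Ik h.
have [|t2 [s2 [e2 l2 q]]] := IH j _ s1 Ij; first by rewrite ek ltnS.
exists ((expr_cost b).+1 + t1 + t2)%N, s2; split=> //; first exact: exec_while_true h e1 e2.
rewrite ek mulSn; have: (j * ((expr_cost b).+1 + cost n c) <= k' * ((expr_cost b).+1 + cost n c))%N.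
  by rewrite leq_mul2r jk orbT.
by move: l1 l2; clear; move: (_ * _)%N (_ * _)%N; lia.
Qed.

Definition vtx s x : vertex := inord `|reg s (vr x)|%N.

(** Demanded of all variables at once: the initial zeros are vertex 0 with row offset 0, so the
    invariant holds from the start. *)
Definition wf s := [/\ fits M W s, reg s 0 = n%:Z &
  forall x, reg s (vr x) = (vtx s x : nat)%:Z /\ reg s (rr x) = (vtx s x * n)%N%:Z].

Lemma wf_fits s : wf s -> fits M W s. Proof. by case. Qed.
Lemma wf_n s : wf s -> reg s 0 = n%:Z. Proof. by case. Qed.
Lemma wf_vr s x : wf s -> reg s (vr x) = (vtx s x : nat)%:Z. Proof. by case=> _ _ /(_ x)[]. Qed.
Lemma wf_rr s x : wf s -> reg s (rr x) = (vtx s x * n)%N%:Z. Proof. by case=> _ _ /(_ x)[]. Qed.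

Lemma val_reg s s' x : reg s' (vr x) = reg s (vr x) -> vtx s' x = vtx s x.
Proof. by rewrite /vtx => ->. Qed.

Lemma wf_set_reg s x v : wf s -> (0 < x < 20)%N -> `|v| < (2 ^ W)%N%:Z -> wf (set_reg s x v).
Proof.
move=> [fs n0 vs] hx hv; split; first exact: fits_set_reg.
  by rewrite /= ifF //; lia.
move=> y; rewrite /vtx /= !ifF; first exact: vs; rewrite /vr /rr; lia.
Qed.

Lemma wf_set_cr s x v : wf s -> `|v| < (2 ^ W)%N%:Z -> wf (set_reg s (cr x) v).
Proof.
move=> [fs n0 vs] hv; split; [exact: fits_set_reg|by []|].
move=> y; rewrite /vtx /= !ifF; first exact: vs; rewrite /vr /rr /cr; lia.
Qed.

Lemma wf_set_ram s a v : wf s -> 0 <= a < M%:Z -> `|v| < (2 ^ W)%N%:Z -> wf (set_ram s a v).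
Proof. by move=> [fs n0 vs] ha hv; split=> //; apply: fits_set_ram. Qed.

Hypothesis word_square : (n * n < 2 ^ W)%N.

Lemma nat_word k : (k <= n * n)%N -> `|k%:Z| < (2 ^ W)%N%:Z.
Proof. by move=> h; rewrite ger0_norm // ltz_nat (leq_ltn_trans h). Qed.

Lemma vertex_word (u : vertex) : `|(u : nat)%:Z| < (2 ^ W)%N%:Z.
Proof. by apply: nat_word; rewrite (leq_trans (ltnW (ltn_ord u))) // leq_pmulr. Qed.

Lemma row_word (u : vertex) : `|(u * n)%N%:Z| < (2 ^ W)%N%:Z.
Proof. by apply: nat_word; rewrite leq_mul2r (ltnW (ltn_ord u)) orbT. Qed.

Lemma wf_move s x (u : vertex) :
  wf s -> wf (set_reg (set_reg s (vr x) (u : nat)%:Z) (rr x) (u * n)%N%:Z).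
Proof.
move=> [fs n0 vs]; split.
- by apply: fits_set_reg (row_word u); apply: fits_set_reg (vertex_word u).
- by [].
move=> y; rewrite /vtx /=.
have -> : (vr y == rr x) = false by rewrite /vr /rr; lia.
have -> : (rr y == vr x) = false by rewrite /vr /rr; lia.
have -> : (vr y == vr x) = (y == x) by rewrite /vr; lia.
have -> : (rr y == rr x) = (y == x) by rewrite /rr; lia.
by case: eqP => _; [rewrite absz_nat inord_val|apply: vs].
Qed.

Lemma val_move s x (u : vertex) :
  vtx (set_reg (set_reg s (vr x) (u : nat)%:Z) (rr x) (u * n)%N%:Z) x = u.
Proof.
rewrite /vtx /= eqxx ifF; last by rewrite /vr /rr; lia.
by rewrite absz_nat inord_val.
Qed.

Definition same_off x s s' := ram s' = ram s /\
  forall y, y \notin [:: vr x; rr x; cr x] -> reg s' y = reg s y.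

Lemma advance_ok x s (i : vertex) Q : wf s -> vtx s x = i ->
  (forall s', wf s' -> same_off x s s' -> reg s' (cr x) = reg s (cr x) ->
     vtx s' x = inord (if i.+1 == n then 0 else i.+1)%N -> Q s') -> wp (advance x) s Q.
Proof.
move=> ws vi q; have [fs n0 vs] := ws; have [v1 v2] := vs x.
have c1 : (cr x == rr x) = false by rewrite /cr /rr; lia.
have c2 : (cr x == vr x) = false by rewrite /cr /vr; lia.
have c3 : (rr x == vr x) = false by rewrite /rr /vr; lia.
have mv (j : vertex) : Q (set_reg (set_reg s (vr x) (j : nat)%:Z) (rr x) (j * n)%N%:Z) \/
    j <> inord (if i.+1 == n then 0 else i.+1)%N.
  have [->|/eqP] := eqVneq j (inord (if i.+1 == n then 0 else i.+1)%N); [left|by right].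
  apply: q; [exact: wf_move| |by rewrite /= c1 c2|exact: val_move].
  by split=> // y; rewrite !inE !negb_or /= => /and3P[/negbTE -> /negbTE -> _].
rewrite /advance; apply: wp_if => /=; rewrite n0 v1 vi => h.
  have lt : (i.+1 < n)%N by lia.
  apply: wp_seq; apply: wp_assign => //=; rewrite v1 vi -?PoszD ?addn1.
    exact: (vertex_word (Ordinal lt)).
  have fs1 : fits M W (set_reg s (vr x) i.+1) := fits_set_reg _ fs (vertex_word (Ordinal lt)).
  apply: wp_assign => //=; rewrite c3 v2 n0 vi -PoszD addnC -mulSn.
    exact: (row_word (Ordinal lt)).
  have [//|[]] := mv (Ordinal lt).
  by apply: val_inj; rewrite /= ifF ?inordK //; lia.
have e : i.+1 == n by have := ltn_ord i; lia.
have w0 : `|0 : int| < (2 ^ W)%N%:Z by rewrite normr0 ltz_nat expn_gt0.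
apply: wp_seq; apply: wp_assign => //=; apply: wp_assign => //=; first exact: fits_set_reg.
have [//|[]] := mv ord0; by apply: val_inj; rewrite /= e inordK.
Qed.

(** Between rounds the loop itself changes the registers of [x], so what is carried over has to be
    insensitive to them; this is what the [same_off] clauses demand. *)
Lemma loop_ok (I : nat -> state -> Prop) x b c s (Q : state -> Prop) :
  all (fun r => r \notin mods c) [:: vr x; rr x; cr x] ->
  wf s ->
  (forall s', wf s' -> same_off x s s' -> I 0%N s') ->
  (forall (i : vertex) s', wf s' -> I i s' -> vtx s' x = i ->
     wp c s' (fun s1 => wf s1 /\
       (0 < eval s1 b -> forall s2, wf s2 -> same_off x s1 s2 -> vtx s2 x = i -> Q s2) /\
       (eval s1 b <= 0 -> forall s2, wf s2 -> same_off x s1 s2 -> I i.+1 s2))) ->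
  (forall s', wf s' -> I n s' -> vtx s' x = ord0 -> Q s') ->
  wp (loop x b c) s Q.
Proof.
move=> /and4P[mv mr mc _] ws I0 Istep Iend; have [fs n0 vs] := ws.
have w0 : `|0 : int| < (2 ^ W)%N%:Z by rewrite normr0 ltz_nat expn_gt0.
have wn : `|n%:Z| < (2 ^ W)%N%:Z by apply: nat_word; rewrite leq_pmulr.
rewrite /loop; apply: wp_seq; apply: wp_assign => //=.
apply: wp_seq; apply: wp_assign => //=; first exact: fits_set_reg.
apply: wp_seq; apply: wp_assign; rewrite /= ?n0 //; first by apply: fits_set_reg => //; apply: fits_set_reg.
set s1 := set_reg (set_reg (set_reg _ _ _) _ _) _ _.
have ws1 : wf s1 by apply: wf_set_cr => //; apply: (wf_move x ord0).
have vs1 : vtx s1 x = ord0.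
  by rewrite -[RHS](val_move s x ord0); apply: val_reg; rewrite /s1 /= ifF // /vr /cr; lia.
(* Counter and current vertex add up to n. Counter 0 stands for both exits, by break and by
   exhaustion, and there [Q] holds already. *)
pose J k s := wf s /\ reg s (cr x) = k%:Z /\
   (if k is 0 then Q s else exists2 i : vertex, vtx s x = i & (i + k = n)%N /\ I i s).
apply: (@wp_while J n) => //.
- split=> //; split; first by rewrite /s1 /= eqxx.
  exists ord0 => //; split=> //; apply: I0 => //; split=> // y.
  by rewrite /s1 /= !inE !negb_or => /and3P[/negbTE -> /negbTE -> /negbTE ->].
- by move=> [|k] s2 [_ /= [-> q]].
move=> [|k] s2 [ws2 /= [ck]]; first by rewrite ck ltxx.
move=> [i vi [ik Ii]] _; exists k => //; apply: wp_seq.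
apply: wp_frame (Istep i s2 ws2 Ii vi) _ => s3 [ws3 [brk cont]] fr _.
have v3 : vtx s3 x = i by rewrite -vi; apply/val_reg/fr.
apply: wp_if => hb.
  apply: wp_assign => //; first by case: ws3.
  exists 0%N => //; set s4 := set_reg _ _ _.
  have ws4 : wf s4 by apply: wf_set_cr.
  split=> //; split; first by rewrite /= eqxx.
  apply: brk => //; last by rewrite -v3; apply: val_reg; rewrite /= ifF // /vr /cr; lia.
  by split=> // y; rewrite !inE !negb_or /= => /and3P[_ _ /negbTE ->].
have ck3 : reg s3 (cr x) - 1 = k%:Z by rewrite fr // ck; lia.
have wk : `|k%:Z| < (2 ^ W)%N%:Z.
  by apply: nat_word; rewrite (@leq_trans n) ?leq_pmulr // -ik addnS ltnW // ltnS leq_addl.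
apply: wp_seq; apply: wp_assign; rewrite /= ?ck3 //; first by case: ws3.
set s4 := set_reg _ _ _.
have ws4 : wf s4 by apply: wf_set_cr.
have v4 : vtx s4 x = i by rewrite -v3; apply: val_reg; rewrite /= ifF // /vr /cr; lia.
apply: (advance_ok ws4 v4) => s5 ws5 [r5 g5] c5 v5; exists k => //; split=> //.
split; first by rewrite c5 /= eqxx.
have Ii5 : I i.+1 s5.
  apply: cont => //; split=> // y h.
  by rewrite g5 //; move: h; rewrite !inE !negb_or /= => /and3P[_ _ /negbTE ->].
case: k ik {ck ck3 wk} s4 ws4 v4 r5 g5 c5 => [|k] ik s4 ws4 v4 r5 g5 c5.
  have e : i.+1 = n by move: ik; rewrite addn1.
  rewrite e eqxx in v5; apply: Iend => //; first by move: Ii5; rewrite e.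
  by rewrite v5; apply: val_inj; rewrite /= inordK.
have lt : (i.+1 < n)%N by move: ik; clear; lia.
exists (Ordinal lt); last by split=> //=; move: ik; clear; lia.
by rewrite v5; apply: val_inj; rewrite /= ifF ?inordK //; lia.
Qed.

Definition ent s b (u v : vertex) : int := ram s (reg s b + ((u * n)%N%:Z + (v : nat)%:Z)).

Definition upd (rho : nat -> vertex) x u := fun y => if y == x then u else rho y.

Definition sum_of (mat : nat -> vertex -> vertex -> int) (rho : nat -> vertex) l : int :=
  foldr (fun '(sg, b, x, y) acc => if sg then acc + mat b (rho x) (rho y)
                                   else acc - mat b (rho x) (rho y)) 0 l.

Fixpoint sem (mat : nat -> vertex -> vertex -> int) (rho : nat -> vertex) (f : form) : bool :=
  match f with
  | Pos l => 0 < sum_of mat rho l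
  | Same x y => rho x == rho y
  | Not f => ~~ sem mat rho f
  | And f g => sem mat rho f && sem mat rho g
  | Ex x f => [exists u, sem mat (upd rho x u) f]
  end.

Lemma sem_ext mat mat' rho rho' f : wff f ->
  (forall b, (1 < b < 20)%N -> mat b = mat' b) -> {in fv f, rho =1 rho'} ->
  sem mat rho f = sem mat' rho' f.
Proof.
elim: f rho rho' => [l|x y|f IH|f IHf g IHg|x f IH] rho rho' /= wf' hm hr.
- congr (_ < _); elim: l wf' hr => [//|[[[sg b] x] y] l IH] /= /andP[hb hl] hr.
  rewrite IH // => [|z zl]; last by apply: hr; rewrite !inE zl !orbT.
  by rewrite hm // !hr ?inE ?eqxx ?orbT.
- by rewrite !hr ?inE ?eqxx ?orbT.
- by rewrite (IH rho rho').
- move: wf' => /and3P[wf1 wg _]; rewrite (IHf rho rho') ?(IHg rho rho') //.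
    by move=> z zg; apply: hr; rewrite mem_cat zg orbT.
  by move=> z zf; apply: hr; rewrite mem_cat zf.
- move: wf' => /and3P[wf1 _ _]; apply: eq_existsb => u; apply: IH => // z zf.
  by rewrite /upd; case: eqP => // /eqP zx; apply: hr; rewrite mem_filter zx.
Qed.

Lemma eval_entry_sum s l : wf s -> eval s (entry_sum l) = sum_of (ent s) (vtx s) l.
Proof.
move=> ws; elim: l => [//|[[[sg b] x] y] l IH] /=.
by case: sg; rewrite /= IH (wf_rr x ws) (wf_vr y ws).
Qed.

Lemma val_touched s s' f x : (forall y, y \notin touched f -> reg s' y = reg s y) ->
  x \notin bv f -> vtx s' x = vtx s x.
Proof. by move=> h /touched_var[? _ _]; apply/val_reg/h. Qed.

Lemma ent_base s s' b : ram s' = ram s -> reg s' b = reg s b -> ent s' b = ent s b.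
Proof. by rewrite /ent => -> ->. Qed.

Definition tested f s s' :=
  [/\ wf s', ram s' = ram s, forall y, y \notin touched f -> reg s' y = reg s y,
      reg s' 1%N = (sem (ent s) (vtx s) f : nat)%:Z &
      disjoint_vars f -> sem (ent s) (vtx s) f -> sem (ent s) (vtx s') (strip f)].

(** What a test may change is known from its syntax. Unless [f] is an [Ex], [strip f] is [f] itself
    and its value is unaffected by the run, so only [Ex] has to account for witnesses. *)
Lemma wp_tested f s : wff f -> wf s ->
  wp (test f) s (fun s' => [/\ wf s', reg s' 1%N = (sem (ent s) (vtx s) f : nat)%:Z &
    if f is Ex _ g then disjoint_vars g -> sem (ent s) (vtx s) f -> sem (ent s) (vtx s') (strip g)
    else true]) ->
  wp (test f) s (tested f s).
Proof.
move=> wff0 ws h; apply: wp_frame h _ => s' [h1 h2 h3] fr pr.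
have fr' y : y \notin touched f -> reg s' y = reg s y.
  by move=> yf; apply: fr; apply: contra yf; apply: mods_test.
split=> //; first exact/pr/pure_test.
move=> dj; have agree : {in fv f, vtx s =1 vtx s'}.
  move=> z zf; apply/esym/(val_touched fr').
  by apply: contra dj => zb; apply/hasP; exists z.
have := @sem_ext (ent s) (ent s) _ _ f wff0 (fun _ _ => erefl) agree.
case: f wff0 h3 {h2 fr fr' pr dj agree} => [l|x y|g|g1 g2|x g] wff0 h3 ext.
1-4: by move: ext => <-.
by apply: h3; case/and3P: wff0.
Qed.

Lemma test_ok f s : wff f -> wf s -> wp (test f) s (tested f s).
Proof.
have w01 (b : bool) : `|(b : nat)%:Z| < (2 ^ W)%N%:Z.
  by apply: nat_word; apply: leq_trans (_ : 1 <= _)%N; case: b.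
have w0 := w01 false; have w1 := w01 true.
elim: f s => [l|x y|f IH|f IHf g IHg|x f IH] s wff0 ws; apply: wp_tested => //=.
- apply: wp_if; rewrite (eval_entry_sum _ ws) => h; apply: wp_assign => //; try exact: wf_fits.
    by rewrite h; split=> //; apply: wf_set_reg.
  by rewrite ltNge h; split=> //; apply: wf_set_reg.
- rewrite -val_eqE; apply: wp_if; rewrite /= !wf_vr // => h.
    apply: wp_assign => //; try exact: wf_fits.
    by rewrite gtn_eqF; [split=> //; apply: wf_set_reg|move: h; rewrite subr_gt0 ltz_nat].
  apply: wp_if; rewrite /= !wf_vr // => h'; apply: wp_assign => //; try exact: wf_fits.
    by rewrite ltn_eqF; [split=> //; apply: wf_set_reg|move: h'; rewrite subr_gt0 ltz_nat].
  move: h h'; rewrite !subr_le0 !lez_nat => h h'.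
  by rewrite eqn_leq h h'; split=> //; apply: wf_set_reg.
- apply: wp_seq; apply: wp_mono (IH _ wff0 ws) => s1 [ws1 _ _ r1 _].
  have e : 1 - (sem (ent s) (vtx s) f : nat)%:Z = (~~ sem (ent s) (vtx s) f : nat)%:Z.
    by case: (sem _ _ f).
  apply: wp_assign; rewrite /= ?r1 ?e ?w01 //; first exact: wf_fits.
  by split=> //; apply: wf_set_reg => //; apply: w01.
- move/and3P: wff0 => [wf1 wf2 dj].
  apply: wp_seq; apply: wp_mono (IHf _ wf1 ws) => s1 [ws1 er fr r1 _].
  have e : sem (ent s1) (vtx s1) g = sem (ent s) (vtx s) g.
    apply: sem_ext => // [b b20|z zg].
      by apply: ent_base => //; apply: fr; apply: touched_low.
    by apply: (val_touched fr); apply: contra dj => zb; apply/hasP; exists z.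
  apply: wp_if; rewrite /= r1 => h.
    apply: wp_mono (IHg _ wf2 ws1) => s2 [ws2 _ _ r2 _]; split=> //.
    by rewrite r2 e; case: (sem _ _ f) h.
  by apply: wp_skip; split=> //; rewrite r1; case: (sem _ _ f) h.
move/and3P: wff0 => [wf1 xb dj].
have [t1 t2 t3] := touched_var xb.
(* The last clause gives the value of a failed search: as n > 0, some round has left 0 in register
   1. *)
pose I (i : nat) s' := [/\ ram s' = ram s,
  forall y, y \notin touched (Ex x f) -> reg s' y = reg s y,
      forall j : vertex, (j < i)%N -> ~~ sem (ent s) (upd (vtx s) x j) f
  & (0 < i)%N -> reg s' 1%N = 0].
have so s1 s2 y : same_off x s1 s2 -> y \notin touched (Ex x f) -> reg s2 y = reg s1 y.
  move=> [_ h]; rewrite /touched /= !inE !negb_or => /and5P[_ y1 y2 y3 _].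
  by apply: h; rewrite !inE !negb_or y1 y2 y3.
have so1 s1 s2 : same_off x s1 s2 -> reg s2 1%N = reg s1 1%N.
  by move=> [_ h]; apply: h; rewrite !inE /vr /rr /cr; lia.
apply: (@loop_ok I) => //.
- by rewrite /=; apply/and4P; split=> //; [apply: contra t1|apply: contra t2|apply: contra t3];
    apply: mods_test.
- by move=> s' ws' off; split=> //; [case: off|move=> y; apply: so].
- move=> i s' ws' [er fr no _] vi; apply: wp_mono (IH s' wf1 ws') => s1 [ws1 er1 fr1 r1 wit].
  have bs b : (1 < b < 20)%N -> ent s' b = ent s b.
    by move=> b20; apply: ent_base => //; apply: fr; apply: touched_low.
  have vs z : z \in fv f -> vtx s' z = upd (vtx s) x i z.
    move=> zf; rewrite /upd; case: eqP => [->|/eqP zx]; first by [].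
    apply: (val_touched fr); rewrite /= inE negb_or zx.
    by apply: contra dj => zb; apply/hasP; exists z.
  have e : sem (ent s') (vtx s') f = sem (ent s) (upd (vtx s) x i) f by apply: sem_ext.
  have fr2 s2 : same_off x s1 s2 -> forall y, y \notin touched (Ex x f) -> reg s2 y = reg s y.
    move=> off y yt; rewrite (so _ _ _ off) // -fr // fr1 //.
    by move: yt; rewrite /touched /= !inE !negb_or => /and5P[-> _ _ _].
  split=> //; rewrite /= r1 e; split=> h s2 ws2 off; last first.
    split.
    + by case: off => ->; rewrite er1.
    + exact: fr2.
    + move=> j; rewrite ltnS leq_eqVlt => /orP[/eqP/val_inj ->|]; last exact: no.
      by move: h; case: (sem _ _ _).
    + by move=> _; rewrite (so1 _ _ off) r1 e; move: h; case: (sem _ _ _).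
  have h' : sem (ent s) (upd (vtx s) x i) f by move: h; case: (sem _ _ _).
  move=> v2; split=> //.
    rewrite (so1 _ _ off) r1 e h' (_ : [exists u, _] = true) //.
    by apply/existsP; exists i.
  move=> dj' _; have := wit dj'; rewrite e => /(_ h').
  suff -> : sem (ent s') (vtx s1) (strip f) = sem (ent s) (vtx s2) (strip f) by [].
  apply: sem_ext => // [|z _]; first exact: wff_strip.
  have [->|zx] := eqVneq z x; first by rewrite v2 -vi; apply: (val_touched fr1).
  apply: val_reg; case: off => _ -> //; move: zx; rewrite !inE /vr /rr /cr; clear; lia.
move=> s' ws' [_ _ no /(_ isT) r0] _.
have e : [exists u, sem (ent s) (upd (vtx s) x u) f] = false.
  by apply/existsP => -[u]; apply/negP/no/ltn_ord.
by rewrite e; split.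
Qed.

Lemma check_ok f c1 c2 s Q : wff f -> disjoint_vars f -> wf s ->
  (forall s', wf s' -> ram s' = ram s -> (forall y, y \notin touched f -> reg s' y = reg s y) ->
     sem (ent s) (vtx s) f -> sem (ent s) (vtx s') (strip f) -> wp c1 s' Q) ->
  (forall s', wf s' -> ram s' = ram s -> (forall y, y \notin touched f -> reg s' y = reg s y) ->
     ~~ sem (ent s) (vtx s) f -> wp c2 s' Q) ->
  wp (check f c1 c2) s Q.
Proof.
move=> wf1 dj ws h1 h2; apply: wp_seq; apply: wp_mono (test_ok wf1 ws).
move=> s' [ws' er fr r1 wit]; apply: wp_if; rewrite /= r1 => h.
  have h' : sem (ent s) (vtx s) f by case: (sem _ _ _) h.
  by apply: h1 => //; apply: wit.
by apply: h2 => //; case: (sem _ _ _) h.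
Qed.

End Machine.

(** * The program *)

Definition at_ b x y : expr := Defs.Add (Reg b) (Defs.Add (Reg (rr x)) (Reg (vr y))).
Definition put b x y k : cmd := Store (at_ b x y) (Lit k).
Definition for_ x c : cmd := loop x (Lit 0) c.

Definition arc x y := Pos [:: (true, 9%N, x, y)].
(** Formulas can read matrix entries only, so the mark of a vertex is a diagonal entry. *)
Definition vis x := Pos [:: (true, 8%N, x, x)].

Definition f_useless : form :=
  Ex 0 (Ex 1 (And (arc 0 1) (Or
    (Ex 2 (And (Not (Same 2 0)) (And (arc 2 1) (Not (Ex 3 (And (Not (Same 3 1)) (arc 2 3)))))))
    (Ex 4 (And (Not (Same 4 1)) (And (arc 0 4) (Not (Ex 5 (And (Not (Same 5 0)) (arc 5 4)))))))))).

Definition f_dead : form :=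
  Or (Ex 0 (Not (Ex 1 (arc 0 1)))) (Ex 2 (Not (Ex 3 (arc 3 2)))).

Definition f_more u v y z : form :=
  Ex y (Ex z (And (Not (Same y v)) (And (Not (Same z v)) (And (Not (Same y z))
    (And (arc u y) (arc u z)))))).

Definition f_branch : form :=
  Ex 0 (Ex 1 (And (arc 0 1) (Or (f_more 0 1 2 3)
    (And (Not (Ex 4 (Ex 5 (And (arc 4 5) (f_more 4 5 6 7)))))
         (Ex 8 (And (Not (Same 8 1)) (And (arc 0 8)
            (Not (Ex 9 (And (Not (Same 9 0)) (And (arc 9 1) (arc 9 8)))))))))))).

Definition f_sq a b c d : form :=
  And (Not (Same a b)) (And (Not (Same c d)) (And (arc a c) (And (arc a d)
    (And (arc b c) (arc b d))))).

Definition f_square : form :=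
  Ex 0 (Ex 1 (Ex 2 (Ex 3 (And (f_sq 0 1 2 3)
    (Not (Ex 4 (Ex 5 (Ex 6 (Ex 7 (And (f_sq 4 5 6 7)
      (Pos [:: (true, 6, 4, 7); (true, 6, 5, 6); (false, 6, 4, 6); (false, 6, 5, 7);
        (false, 6, 0, 3); (false, 6, 1, 2); (true, 6, 0, 2); (true, 6, 1, 3)])))))))))))%N.

(* Register 4 holds n * n, registers 6 to 9 the addresses of the weights, of
   the best tour so far, of the visited marks (on a diagonal) and of the top
   frame; 11 and 12 the weight and existence of the best tour, 13 the number of
   frames. *)
Definition copy : cmd :=
  for_ 10 (for_ 11 (Store (at_ 15 10 11) (entry 14 10 11))).

Definition pop : cmd :=
  Seq (Assign 9 (Defs.Sub (Reg 9) (Reg 4))) (Assign 13 (Defs.Sub (Reg 13) (Lit 1))).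

(** The frame is copied one page up before it is changed. The lower copy loses the arc; in the upper
    one the row of its tail is cleared and the arc put back, which is [choose]. *)
Definition push : cmd :=
  Seq (Assign 14 (Reg 9)) (Seq (Assign 15 (Defs.Add (Reg 9) (Reg 4))) (Seq copy
  (Seq (put 9 0 1 0) (Seq (Assign 9 (Reg 15)) (Seq (Assign 13 (Defs.Add (Reg 13) (Lit 1)))
  (Seq (for_ 12 (put 9 0 12 0)) (put 9 0 1 1))))))).

Definition f_cross : form := Ex 14 (Ex 15 (And (vis 14) (And (Not (vis 15)) (arc 14 15)))).

Definition reach : cmd :=
  Seq (for_ 13 (put 8 13 13 0)) (Seq (Store (Reg 8) (Lit 1))
  (Seq (for_ 13 (check f_cross (put 8 15 15 1) Skip)) (test (Ex 14 (Not (vis 14)))))).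

Definition settle : cmd :=
  Seq (put 9 0 3 0) (Seq (put 9 1 2 0) (Seq reach
    (If (Reg 1) (Seq (put 9 0 3 1) (Seq (put 9 1 2 1) (Seq (put 9 0 2 0) (put 9 1 3 0)))) Skip))).

Definition save : cmd :=
  Seq (Assign 11 (Reg 10)) (Seq (Assign 12 (Lit 1)) (Seq (Assign 14 (Reg 9))
    (Seq (Assign 15 (Reg 7)) copy))).

Definition weigh : cmd :=
  Seq (Assign 10 (Lit 0))
    (for_ 0 (check (Ex 1 (arc 0 1)) (Assign 10 (Defs.Add (Reg 10) (entry 6 0 1))) Skip)).

Definition leaf : cmd :=
  Seq reach (Seq (If (Reg 1) Skip (Seq weigh
    (If (Reg 12) (If (Defs.Sub (Reg 11) (Reg 10)) save Skip) save))) pop).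

Definition body : cmd :=
  check f_useless (put 9 0 1 0)
    (check f_dead pop (check f_branch push (check f_square settle leaf))).

Definition init : cmd :=
  Seq (Assign 4 (Lit 0)) (Seq (for_ 0 (Assign 4 (Defs.Add (Reg 4) (Reg 0))))
  (Seq (Assign 6 (Reg 4)) (Seq (Assign 7 (Defs.Add (Reg 6) (Reg 4)))
  (Seq (Assign 8 (Defs.Add (Reg 7) (Reg 4))) (Seq (Assign 9 (Defs.Add (Reg 8) (Reg 4)))
  (Seq (Assign 14 (Lit 0)) (Seq (Assign 15 (Reg 9)) (Seq copy
  (Seq (Assign 12 (Lit 0)) (Assign 13 (Lit 1))))))))))).

(** The successor of the current vertex is found by searching its row in the saved tour; the list is
    written over the adjacency matrix of the input. *)
Definition output : cmd :=
  If (Reg 12)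
    (Seq (Assign (vr 0) (Lit 0)) (Seq (Assign (rr 0) (Lit 0)) (Seq
      (for_ 1 (Seq (Store (Reg (vr 1)) (Reg (vr 0)))
        (check (Ex 2 (Pos [:: (true, 7, 0, 2)]))%N
          (Seq (Assign (vr 0) (Reg (vr 2))) (Assign (rr 0) (Reg (rr 2)))) Skip)))
      (Assign 0 (Lit 1)))))
    (Assign 0 (Lit 0)).

(** For n = 0 register 0 already holds the right answer, that there is no cycle. *)
Definition program : cmd :=
  If (Reg 0) (Seq init (Seq (While (Reg 13) body) output)) Skip.

(** * Memory pages, copying and reachability *)

Section Subroutines.
Variables (m M W : nat).
Local Notation n := m.+1.
Local Notation vertex := 'I_n.
Hypothesis sizeM : ((n * n + 5) * (n * n) <= M)%N.
Hypothesis sizeW : ((n * n + 6) * (n * n) < 2 ^ W)%N.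
Implicit Types (s : state) (c : cmd) (A : {set vertex * vertex}).

Lemma word_square : (n * n < 2 ^ W)%N.
Proof. by apply: leq_ltn_trans sizeW; rewrite leq_pmull // addnS. Qed.
Hint Resolve word_square : core.

Local Notation wp := (wp m M W).
Local Notation wf := (wf m M W).
Local Notation vtx := (@vtx m).

(** Memory is cut into pages of n^2 cells: 0 and 1 hold the input, 2 the best tour, 3 the marks, and
    4 + i the frame at height i of the stack. *)
Definition base p : int := (p * (n * n))%N%:Z.
Definition cell p (u v : vertex) : int := (p * (n * n) + (u * n + v))%N%:Z.
Definition page s p u v : int := ram s (cell p u v).

Lemma offset_lt (u v : vertex) : (u * n + v < n * n)%N.
Proof.
apply: (@leq_trans (u * n + n)); first by rewrite ltn_add2l.
by rewrite addnC -mulSn leq_mul2r ltn_ord orbT.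
Qed.

Lemma cell_inj p u v p' u' v' :
  (cell p u v == cell p' u' v') = [&& p == p', u == u' & v == v'].
Proof.
apply/eqP/and3P => [[e]|[/eqP -> /eqP -> /eqP ->]//].
have d (k q i : nat) : (i < k)%N -> ((q * k + i) %/ k = q)%N.
  by move=> ik; rewrite divnMDl ?divn_small ?addn0 //; apply: leq_ltn_trans ik.
have ep : p = p' by rewrite -(d _ p _ (offset_lt u v)) e d ?offset_lt.
move: e; rewrite ep => /addnI e.
have eu : u = u' by apply: ord_inj; rewrite -(d n u v) // e d.
by move: e; rewrite eu => /addnI/ord_inj ->.
Qed.

Lemma ent_page s b p u v : reg s b = base p -> ent s b u v = page s p u v.
Proof. by rewrite /ent => ->; rewrite /base -!PoszD. Qed.

Lemma page_set s p u v k p' u' v' :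
  page (set_ram s (cell p u v) k) p' u' v' =
  if [&& p' == p, u' == u & v' == v] then k else page s p' u' v'.
Proof. by rewrite /page /= cell_inj. Qed.

Lemma cell_bound p u v : (p < n * n + 5)%N -> 0 <= cell p u v < M%:Z.
Proof.
move=> h; rewrite /cell ltz_nat /=; apply: leq_trans sizeM.
apply: leq_trans (_ : p.+1 * (n * n) <= _)%N; last by rewrite leq_mul2r h orbT.
by rewrite [(p.+1 * _)%N]mulSn [leqRHS]addnC ltn_add2l offset_lt.
Qed.

Lemma base_word p : (p <= n * n + 6)%N -> `|base p| < (2 ^ W)%N%:Z.
Proof.
move=> h; rewrite ger0_norm // ltz_nat; apply: leq_ltn_trans sizeW.
by rewrite leq_mul2r h orbT.
Qed.

Lemma wp_put b x y k p s (Q : state -> Prop) : wf s -> reg s b = base p ->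
  (p < n * n + 5)%N -> `|k| <= 1 ->
  (wf (set_ram s (cell p (vtx s x) (vtx s y)) k) ->
   Q (set_ram s (cell p (vtx s x) (vtx s y)) k)) ->
  wp (put b x y k) s Q.
Proof.
move=> ws rb hp k1 q.
have kW : `|k| < (2 ^ W)%N%:Z.
  apply: le_lt_trans k1 _; rewrite -[1]/(1%N%:Z) ltz_nat; apply: leq_ltn_trans word_square; by [].
have e : eval s (at_ b x y) = cell p (vtx s x) (vtx s y).
  by rewrite /= rb (wf_rr x ws) (wf_vr y ws) -!PoszD.
apply: wp_store; rewrite ?e ?cell_bound //; first exact: wf_fits ws.
by apply: q; apply: wf_set_ram => //; apply: cell_bound.
Qed.

Lemma for_ok (I : nat -> state -> Prop) x c s (Q : state -> Prop) :
  all (fun r => r \notin mods c) [:: vr x; rr x; cr x] ->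
  wf s ->
  (forall s', wf s' -> same_off x s s' -> I 0%N s') ->
  (forall (i : vertex) s', wf s' -> I i s' -> vtx s' x = i ->
     wp c s' (fun s1 => wf s1 /\ forall s2, wf s2 -> same_off x s1 s2 -> I i.+1 s2)) ->
  (forall s', wf s' -> I n s' -> Q s') ->
  wp (for_ x c) s Q.
Proof.
move=> md ws I0 step fin; apply: (@loop_ok m M W _ I) => // [i s' ws' Ii vi|s' ws' In _].
  by apply: wp_mono (step i s' ws' Ii vi) => s1 [ws1 h]; split=> //; split.
exact: fin.
Qed.

Lemma same_off_page x s s' p u v : same_off x s s' -> page s' p u v = page s p u v.
Proof. by rewrite /page => -[-> _]. Qed.

Lemma same_off_low x s s' b : same_off x s s' -> (b < 20)%N -> reg s' b = reg s b.
Proof. by move=> [_ h] hb; apply: h; rewrite !inE /vr /rr /cr; move: hb; clear; lia. Qed.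

Lemma same_off_val x y s s' : same_off x s s' -> x != y -> vtx s' y = vtx s y.
Proof.
by move=> [_ h] xy; apply/val_reg/h; rewrite !inE /vr /rr /cr; move: xy; clear; lia.
Qed.

Lemma page_word s p u v : wf s -> `|page s p u v| < (2 ^ W)%N%:Z.
Proof. by case=> -[_ h _] _ _; apply: h. Qed.

Lemma copy_ok s p q (Q : state -> Prop) : wf s -> reg s 14 = base p -> reg s 15 = base q ->
  (q < n * n + 5)%N -> p != q ->
  (forall s', wf s' -> (forall r, r \notin mods copy -> reg s' r = reg s r) ->
     (forall u v, page s' q u v = page s p u v) ->
     (forall r u v, r != q -> page s' r u v = page s r u v) -> Q s') ->
  wp copy s Q.
Proof.
move=> ws r14 r15 hq pq fin; have small u v := page_word p u v ws.
suff : wp copy s (fun s' => wf s' /\ forall r u v,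
    page s' r u v = if r == q then page s p u v else page s r u v).
  move=> h; apply: wp_frame h _ => s' [ws' h] fr _; apply: fin => //.
    by move=> u v; rewrite h eqxx.
  by move=> r u v /negbTE rq; rewrite h rq.
pose J i j s' := [/\ reg s' 14 = base p, reg s' 15 = base q & forall r u v,
  page s' r u v = if (r == q) && ((u < i)%N || (u == i :> nat) && (v < j)%N)
                  then page s p u v else page s r u v].
apply: (@for_ok (fun i => J i 0%N)) => //.
- move=> s' _ off; split; rewrite ?(same_off_low off) // => r u v.
  by rewrite (same_off_page _ _ _ off) ltn0 !andbF.
- move=> i s1 ws1 [a14 a15 pg] vi.
  apply: (@for_ok (fun j s' => J i j s' /\ vtx s' 10 = i)) => //.
  + move=> s2 _ off; rewrite (same_off_val off) //; split=> //; split; rewrite ?(same_off_low off) // => r u v.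
    by rewrite (same_off_page _ _ _ off) pg.
  + move=> j s2 ws2 [[b14 b15 pg2] vi2] vj.
    have e : eval s2 (entry 14 10 11) = page s p i j.
      have -> : eval s2 (entry 14 10 11) = page s2 p i j.
        by rewrite /= b14 (wf_rr 10 ws2) (wf_vr 11 ws2) vi2 vj /page -!PoszD.
      by rewrite pg2 (negbTE pq).
    have ea : eval s2 (at_ 15 10 11) = cell q i j.
      by rewrite /= b15 (wf_rr 10 ws2) (wf_vr 11 ws2) vi2 vj -!PoszD.
    apply: wp_store; rewrite ?ea ?e ?cell_bound //; first exact: wf_fits ws2.
    split; first by apply: wf_set_ram => //; apply: cell_bound.
    move=> s3 ws3 off; split; last by rewrite (same_off_val off).
    split; rewrite ?(same_off_low off) // => r u v.
    rewrite (same_off_page _ _ _ off) page_set pg2 ltnS.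
    have [->|rq] := eqVneq r q => //=.
    rewrite [(v <= j)%N]leq_eqVlt -!val_eqE /=.
    case: eqP => [eu|_] //=; case: eqP => [ev|_] //=.
    by rewrite eu ltnn /=; congr page; apply: ord_inj.
  + move=> s2 ws2 [[b14 b15 pg2] vi2]; split=> // s3 ws3 off.
    split; rewrite ?(same_off_low off) // => r u v.
    by rewrite (same_off_page _ _ _ off) pg2 ltn_ord andbT ltn0 andbF orbF ltnS [(u <= i)%N]leq_eqVlt orbC.
- by move=> s' ws' [_ _ h]; split=> // r u v; rewrite h ltn_ord andbT.
Qed.

Definition graph_of s p : {set vertex * vertex} := [set a | 0 < page s p a.1 a.2].

(* Each round marks a vertex unless the marked set is closed already, hence n
   rounds suffice. *)
Lemma reach_ok s p (Q : state -> Prop) : wf s -> reg s 8 = base 3 -> reg s 9 = base p ->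
  p != 3%N ->
  (forall s', wf s' -> (forall r, r \notin mods reach -> reg s' r = reg s r) ->
     (forall r u v, r != 3%N -> page s' r u v = page s r u v) ->
     reg s' 1 = (~~ reaches ord0 (graph_of s p) : nat)%:Z -> Q s') ->
  wp reach s Q.
Proof.
move=> ws r8 r9 p3 fin.
suff : wp reach s (fun s' => [/\ wf s', (forall r u v, r != 3%N -> page s' r u v = page s r u v)
    & reg s' 1 = (~~ reaches ord0 (graph_of s p) : nat)%:Z]).
  by move=> h; apply: wp_frame h _ => s' [? ? ?] fr _; apply: fin.
pose E := [rel u v | (u, v) \in graph_of s p].
pose F s' := [/\ reg s' 8 = base 3, reg s' 9 = base p &
  forall r u v, r != 3%N -> page s' r u v = page s r u v].
have F_off x s1 s2 : F s1 -> same_off x s1 s2 -> F s2.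
  move=> [f8 f9 fp] off; split; rewrite ?(same_off_low off) // => r u v r3.
  by rewrite (same_off_page _ _ _ off) fp.
have F_set s1 u v k : F s1 -> F (set_ram s1 (cell 3 u v) k).
  by move=> [f8 f9 fp]; split=> // r u' v' r3; rewrite page_set (negbTE r3) fp.
have three : (3 < n * n + 5)%N by rewrite addnC.
have Fs : F s by split.
apply: wp_seq; apply: (@for_ok (fun i s' => F s' /\ forall u : vertex, (u < i)%N -> page s' 3 u u = 0)) => //.
- by move=> s' _ off; split=> //; apply: F_off off.
- move=> i s1 ws1 [Fs1 z] vi; have [f8 _ _] := Fs1.
  apply: wp_put ws1 f8 three _ _ => // ws2; split=> // s3 ws3 off.
  split; first by apply: F_off off; apply: F_set.
  move=> u; rewrite ltnS leq_eqVlt (same_off_page _ _ _ off) page_set vi /= andbb -val_eqE /=.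
  by case: eqP => //= _ /z.
move=> s1 ws1 [Fs1 zero]; have [f8 f9 fp] := Fs1.
have e8 : eval s1 (Reg 8) = cell 3 ord0 ord0 by rewrite /= f8 /cell /base mul0n !addn0.
apply: wp_seq; apply: wp_store; rewrite ?e8 ?cell_bound //; first exact: wf_fits ws1.
  by apply: (nat_word word_square); rewrite muln_gt0.
set s2 := set_ram _ _ _.
have ws2 : wf s2 by apply: wf_set_ram => //; [apply: cell_bound|apply: (nat_word word_square); rewrite muln_gt0].
have Fs2 : F s2 by apply: F_set.
pose V s' : {set vertex} := [set u | 0 < page s' 3 u u].
pose ok s' := [/\ ord0 \in V s' & forall u, u \in V s' -> connect E ord0 u].
pose closed s' := forall u v, u \in V s' -> E u v -> v \in V s'.
have ok2 : ok s2.
  split=> [|u]; first by rewrite inE page_set !eqxx.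
  rewrite inE page_set /= andbb; case: eqP => [->|_]; first by rewrite connect0.
  by rewrite zero ?ltxx.
have V_off x s3 s4 : same_off x s3 s4 -> V s4 = V s3.
  by move=> off; apply/setP => u; rewrite !inE (same_off_page _ _ _ off).
apply: wp_seq; apply: (@for_ok (fun i s' => [/\ F s', ok s' & closed s' \/ (i < #|V s'|)%N])) => //.
- move=> s' _ off; split; [exact: F_off off|by rewrite /ok (V_off _ _ _ off)|right].
  by rewrite (V_off _ _ _ off); apply/card_gt0P; exists ord0; case: ok2.
- move=> i s3 ws3 [Fs3 [ok30 ok3] pr] vi; have [g8 g9 gp] := Fs3.
  have p9 u v : ent s3 9 u v = page s p u v by rewrite (ent_page _ _ g9) gp.
  apply: check_ok => // s4 ws4 er fr.
    have Fs4 : F s4.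
      by split=> [||r u v r3]; rewrite ?fr ?touched_low // /page er; apply: gp.
    have V4 : V s4 = V s3 by apply/setP => u; rewrite !inE /page er.
    have [h8 _ _] := Fs4.
    move=> _; rewrite /= !add0r !(ent_page _ _ g8) p9 => /and3P[v14 v15 a].
    apply: wp_put ws4 h8 three _ _ => // ws5; split=> // s5 ws5' off.
    have V5 : V s5 = vtx s4 15 |: V s3.
      apply/setP => u; rewrite (V_off _ _ _ off) !inE page_set /= andbb /page er.
      by case: eqP.
    split; first by apply: F_off off; apply: F_set.
      rewrite /ok V5; split=> [|u]; first by rewrite inE ok30 orbT.
      rewrite inE => /orP[/set1P ->|]; last exact: ok3.
      by apply: connect_trans (ok3 (vtx s4 14) _) (connect1 _); rewrite /= inE.
    rewrite V5 cardsU1 inE v15 /=; case: pr => [cl|lt]; last by right.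
    by have := cl (vtx s4 14) (vtx s4 15); rewrite !inE (negbTE v15) => /(_ v14 a).
  rewrite /= => no; apply: wp_skip; split=> // s5 ws5 off.
  have V5 : V s5 = V s3 by rewrite (V_off _ _ _ off); apply/setP => u; rewrite !inE /page er.
  split; last 1 first.
  + left=> u v uV uv; rewrite V5 in uV *; apply: contraR no => vV.
    apply/existsP; exists u; apply/existsP; exists v.
    by move: uV vV uv; rewrite /upd /= !add0r !(ent_page _ _ g8) p9 !inE => -> ->.
  + by apply: F_off off; split=> [||r u v r3]; rewrite ?fr ?touched_low // /page er; apply: gp.
  + by rewrite /ok V5.
move=> s3 ws3 [Fs3 [ok30 ok3] pr]; have [g8 g9 gp] := Fs3.
apply: wp_mono (test_ok word_square _ ws3) => // s4 [ws4 er fr -> _]; split=> //.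
  by move=> r u v r3; rewrite /page er; apply: gp.
have cl : closed s3.
  case: pr => // lt u v _ _; suff -> : V s3 = setT by rewrite inE.
  by apply/eqP; rewrite eqEcard subsetT cardsT card_ord ltnW.
congr (Posz (nat_of_bool _)); rewrite /= /reaches negb_forall; apply: eq_existsb => u.
rewrite /upd /= add0r (ent_page _ _ g8); congr (~~ _).
apply/idP/idP => [uV|]; first by apply: (ok3 u); rewrite inE.
move=> /connectP[q]; elim/last_ind: q u => [|q v IH] u.
  by move=> _ ->; move: ok30; rewrite inE.
rewrite rcons_path last_rcons => /andP[/IH /(_ erefl) h1 h2 ->].
have /(_ h2) : E (last ord0 q) v -> v \in V s3 by apply: cl; rewrite inE.
by rewrite inE.
Qed.

End Subroutines.

(** * One round of the search *)

Lemma negb_andNN a b : ~~ (~~ a && ~~ b) = a || b.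
Proof. by rewrite negb_and !negbK. Qed.

Section Formulas.
Variables (m : nat).
Local Notation vertex := 'I_m.+1.
Variables (mat : nat -> vertex -> vertex -> int) (A : {set vertex * vertex}).
Hypothesis matA : forall u v, (0 < mat 9 u v) = ((u, v) \in A).
Implicit Types rho : nat -> vertex.

Ltac unfold_sem := repeat lazymatch goal with
  | |- ~~ FiniteQuant.quant0b _ = _ => apply: eq_existsb => ?
  | |- ~~ (~~ _ && ~~ _) = _ => rewrite negb_andNN; congr (_ || _)
  | |- ~~ _ = ~~ _ => congr (~~ _)
  | |- _ && _ = _ => congr (_ && _)
  | |- (0 < 0 + mat 9 _ _) = _ => by rewrite /upd /= add0r matA
  | |- (_ == _) = _ => by rewrite /upd
  end.

Lemma sem_useless rho : sem mat rho (strip f_useless) = useless A (rho 0%N) (rho 1%N).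
Proof. by rewrite /= /useless; unfold_sem. Qed.

Lemma sem_has_useless rho :
  sem mat rho f_useless = [exists u, [exists v, useless A u v]].
Proof. by rewrite /= /useless; unfold_sem. Qed.

Lemma sem_dead rho : sem mat rho f_dead = dead A.
Proof. by rewrite /= /dead; unfold_sem. Qed.

Lemma sem_branch rho : sem mat rho (strip f_branch) = branching A (rho 0%N) (rho 1%N).
Proof. by rewrite /= /branching /two_more; unfold_sem. Qed.

Lemma sem_has_branch rho :
  sem mat rho f_branch = [exists u, [exists v, branching A u v]].
Proof. by rewrite /= /branching /two_more; unfold_sem. Qed.

Lemma sem_square rho : sem mat rho (strip f_square) =
  max_square (mat 6) A (rho 0%N) (rho 1%N) (rho 2%N) (rho 3%N).
Proof.
rewrite /= /max_square /square; unfold_sem.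
by rewrite /upd /= /swap_cost; congr (0 < _); ring.
Qed.

Lemma sem_has_square rho : sem mat rho f_square =
  [exists a, [exists b, [exists c, [exists d, max_square (mat 6) A a b c d]]]].
Proof.
rewrite /= /max_square /square; unfold_sem.
by rewrite /upd /= /swap_cost; congr (0 < _); ring.
Qed.

End Formulas.

Section Step.
Variables (T : finType) (r : T) (w : T -> T -> int).
Implicit Types (A : {set T * T}) (L : seq {set T * T}) (o : option {perm T}).

(** One round of the main loop on the abstract data, a stack of arc sets and the best tour so far.
    Correctness and the number of rounds are proved for this relation, away from the machine. *)
Inductive step : {set T * T} -> seq {set T * T} -> option {perm T} ->
    seq {set T * T} -> option {perm T} -> Prop :=
| StepUseless A L o u v : useless A u v -> step A L o (A :\ (u, v) :: L) o
| StepDead A L o : dead A -> step A L o L o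
| StepBranch A L o u v : reduced A -> branching A u v ->
    step A L o (choose A u v :: A :\ (u, v) :: L) o
| StepCheap A L o a b c d : squared A -> max_square w A a b c d ->
    reaches r (keep_cheap A a b c d) -> step A L o (keep_cheap A a b c d :: L) o
| StepDear A L o a b c d : squared A -> max_square w A a b c d ->
    ~~ reaches r (keep_cheap A a b c d) -> step A L o (keep_dear A a b c d :: L) o
| StepDrop A L o : ~~ reaches r A -> step A L o L o
| StepWorse A L (s t : {perm T}) : (forall u v, ((u, v) \in A) = (s u == v)) -> wt w t <= wt w s ->
    step A L (Some t) L (Some t)
| StepBetter A L o (s : {perm T}) : (forall u v, ((u, v) \in A) = (s u == v)) -> reaches r A ->
    (forall t, o = Some t -> wt w s <= wt w t) -> step A L o L (Some s).

End Step.

(** * The loop body realizes the abstract rounds *)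

Section Body.
Variables (m M W B : nat) (w : 'I_m.+1 -> 'I_m.+1 -> int).
Local Notation n := m.+1.
Local Notation vertex := 'I_n.
Hypothesis sizeM : ((n * n + 5) * (n * n) <= M)%N.
Hypothesis sizeW : ((n * n + 6) * (n * n) < 2 ^ W)%N.
Hypothesis smallw : forall u v, `|w u v| <= B%:Z.
Hypothesis sumW : (n * B < 2 ^ W)%N.
Implicit Types (s : state) (c : cmd) (A : {set vertex * vertex}) (L : seq {set vertex * vertex}).
Implicit Types (o : option {perm vertex}).

Local Notation wp := (wp m M W).
Local Notation wf := (wf m M W).
Local Notation vtx := (@vtx m).
Local Notation base := (base m).
Local Notation n2 := (n * n)%N.

(** The inequality is the space bound: a frame at height i has at most n^2 - i arcs, so the height
    cannot exceed n^2. *)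
Fixpoint stored s L : Prop :=
  if L is A :: L' then
    [/\ (size L' + #|A| <= n2)%N,
        forall u v, (0 < page s (4 + size L') u v) = ((u, v) \in A) & stored s L']
  else True.

Definition best_of s o :=
  if o is Some t then
    [/\ reg s 12 = 1, reg s 11 = wt w t & forall u v, (0 < page s 2 u v) = (t u == v)]
  else reg s 12 = 0.

Record Rep s L o : Prop := MkRep {
  rep_wf : wf s;
  rep_low : [/\ reg s 4 = base 1, reg s 6 = base 1, reg s 7 = base 2 & reg s 8 = base 3];
  rep_top : reg s 9 = base (3 + size L);
  rep_size : reg s 13 = (size L)%:Z;
  rep_w : forall u v, page s 1 u v = w u v;
  rep_stored : stored s L;
  rep_best : best_of s o }.

Lemma stored_ext s s' L :
  (forall r (u v : vertex), (4 <= r < 4 + size L)%N -> page s' r u v = page s r u v) ->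
  stored s L -> stored s' L.
Proof.
elim: L => //= A L IH h [h1 h2 h3]; split=> //.
  by move=> u v; rewrite h // addnS ltnSn leq_addr.
by apply: IH h3 => r u v /andP[h4 h5]; apply: h; rewrite h4 addnS ltnW.
Qed.

Lemma best_ext s s' o : (forall b, b \in [:: 11; 12] -> reg s' b = reg s b) ->
  (forall u v : vertex, page s' 2 u v = page s 2 u v) -> best_of s o -> best_of s' o.
Proof.
move=> hr hp; case: o => [t|] /=; rewrite !hr ?inE //.
by move=> [-> -> h]; split=> // u v; rewrite hp.
Qed.

Lemma Rep_change s s' A A' L o : Rep s (A :: L) o -> wf s' ->
  (forall b, b \in [:: 4; 6; 7; 8; 9; 11; 12; 13]%N -> reg s' b = reg s b) ->
  (forall r (u v : vertex), r != 3%N -> r != (4 + size L)%N -> page s' r u v = page s r u v) ->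
  (forall u v, (0 < page s' (4 + size L) u v) = ((u, v) \in A')) -> (#|A'| <= #|A|)%N ->
  Rep s' (A' :: L) o.
Proof.
move=> [ws [r4 r6 r7 r8] r9 r13 hw [h1 h2 h3] ho] ws' hr hp hA le; split=> //.
- by split; rewrite hr.
- by rewrite hr.
- by rewrite hr.
- by move=> u v; rewrite hp.
- split=> //; first by apply: leq_trans h1; rewrite leq_add2l.
  apply: stored_ext h3 => r u v /andP[h4 h5]; apply: hp; move: h4 h5; clear; lia.
- apply: best_ext ho => [b|u v]; last by apply: hp.
  by rewrite !inE => /orP[]/eqP ->; apply: hr.
Qed.

Lemma Rep_graph s A L o : Rep s (A :: L) o -> graph_of m s (4 + size L) = A.
Proof. by case=> _ _ _ _ _ [_ h _] _; apply/setP => -[u v]; rewrite inE h. Qed.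

Lemma Rep_top_bound s A L o : Rep s (A :: L) o -> (4 + size L < n2 + 5)%N.
Proof. by case=> _ _ _ _ _ [h _ _] _; move: h; clear; lia. Qed.

Lemma Rep_test s s' A L o : Rep s (A :: L) o -> wf s' -> ram s' = ram s ->
  (forall b, b \in [:: 4; 6; 7; 8; 9; 11; 12; 13]%N -> reg s' b = reg s b) ->
  Rep s' (A :: L) o.
Proof.
move=> R ws' er hr; apply: (Rep_change R) => // [r u v _ _|u v].
  by rewrite /page er.
by have [_ h _] := rep_stored R; rewrite -h /page er.
Qed.

Lemma touched_rep (f : form) (b : nat) : b \in [:: 4; 6; 7; 8; 9; 11; 12; 13]%N -> b \notin touched f.
Proof.
move=> h; apply: touched_low.
have /allP : all (fun b => 1 < b < 20)%N [:: 4; 6; 7; 8; 9; 11; 12; 13]%N by [].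
exact.
Qed.

Lemma check_rep f c1 c2 s A L o (Q : state -> Prop) : wff f -> disjoint_vars f -> Rep s (A :: L) o ->
  (forall s', Rep s' (A :: L) o -> (forall y, y \notin touched f -> reg s' y = reg s y) ->
     sem (ent s) (vtx s) f -> sem (ent s) (vtx s') (strip f) -> wp c1 s' Q) ->
  (forall s', Rep s' (A :: L) o -> (forall y, y \notin touched f -> reg s' y = reg s y) ->
     ~~ sem (ent s) (vtx s) f -> wp c2 s' Q) ->
  wp (check f c1 c2) s Q.
Proof.
move=> wf1 dj R h1 h2; apply: check_ok => //; first exact: (word_square sizeW).
- exact: rep_wf R.
- move=> s' ws' er fr; apply: h1 => //; apply: (Rep_test R) => // b hb; exact/fr/touched_rep.
- move=> s' ws' er fr; apply: h2 => //; apply: (Rep_test R) => // b hb; exact/fr/touched_rep.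
Qed.

Lemma Rep_off x s s' A L o : Rep s (A :: L) o -> wf s' -> same_off x s s' -> Rep s' (A :: L) o.
Proof.
move=> R ws' off; apply: (Rep_test R) => //; first by case: off.
move=> b hb; apply: (same_off_low off); move: hb.
by have /allP : all (fun b => b < 20)%N [:: 4; 6; 7; 8; 9; 11; 12; 13]%N by []; apply.
Qed.

Lemma Rep_arc s A L o u v : Rep s (A :: L) o -> (0 < ent s 9 u v) = ((u, v) \in A).
Proof. by move=> R; have [_ <- _] := rep_stored R; rewrite (ent_page _ _ (rep_top R)). Qed.

Lemma pop_ok s A L o (Q : state -> Prop) : Rep s (A :: L) o ->
  (forall s', Rep s' L o -> Q s') -> wp pop s Q.
Proof.
move=> R fin; have lt := Rep_top_bound R.
have [ws [r4 r6 r7 r8] r9 r13 hw [h1 h2 h3] ho] := R.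
have e9 : reg s 9 - reg s 4 = base (3 + size L).
  by rewrite r9 r4 /base /= addnS mulSn mul1n PoszD addrC addKr.
apply: wp_seq; apply: wp_assign; rewrite /= ?e9; first exact: wf_fits ws.
  by apply: (base_word sizeW); move: lt; clear; lia.
have ws1 : wf (set_reg s 9 (base (3 + size L))).
  by apply: wf_set_reg => //; apply: (base_word sizeW); move: lt; clear; lia.
have e13 : reg s 13 - 1 = (size L)%:Z by rewrite r13 /=; clear; lia.
have w13 : `|(size L)%:Z| < (2 ^ W)%N%:Z.
  by apply: (nat_word (word_square sizeW)); move: h1; clear; lia.
apply: wp_assign; rewrite /= ?e13 //; first exact: wf_fits ws1.
apply: fin; split=> //; first exact: wf_set_reg.
exact: stored_ext h3.
Qed.

Lemma put_rep b x y k s A A' L o (Q : state -> Prop) : Rep s (A :: L) o -> b = 9%N -> `|k| <= 1 ->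
  (forall u v, ((u, v) \in A') = if (u == vtx s x) && (v == vtx s y) then 0 < k else (u, v) \in A) ->
  (#|A'| <= n2 - size L)%N ->
  (forall s', Rep s' (A' :: L) o -> vtx s' =1 vtx s -> Q s') -> wp (put b x y k) s Q.
Proof.
move=> R -> k1 hA' le fin; have [ws [r4 r6 r7 r8] r9 r13 hw [h1 h2 h3] ho] := R.
apply: (wp_put sizeM sizeW ws r9 (Rep_top_bound R) k1) => ws'.
apply: fin; last by [].
split=> //.
- by move=> u v; rewrite page_set hw.
- split=> //; first by move: le h1; clear; lia.
    by move=> u v; rewrite page_set eqxx /= hA' -h2; case: ifP.
  apply: stored_ext h3 => r u v /andP[h4 h5]; rewrite page_set ifF //.
  by apply/negP => /and3P[/eqP er _ _]; move: h5; rewrite er /=; clear; lia.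
- apply: best_ext ho => // u v; by rewrite page_set.
Qed.

Lemma push_ok s A L o (Q : state -> Prop) : Rep s (A :: L) o ->
  (vtx s 0, vtx s 1) \in A -> (#|choose A (vtx s 0) (vtx s 1)| < #|A|)%N ->
  (forall s', Rep s' (choose A (vtx s 0) (vtx s 1) :: A :\ (vtx s 0, vtx s 1) :: L) o -> Q s') ->
  wp push s Q.
Proof.
move=> R uvA less fin; have lt := Rep_top_bound R.
have [ws [r4 r6 r7 r8] r9 r13 hw [h1 h2 h3] ho] := R.
set u := vtx s 0 in uvA less fin *; set v := vtx s 1 in uvA less fin *.
have C0 : (0 < #|choose A u v|)%N.
  by apply/card_gt0P; exists (u, v); rewrite inE uvA /= !eqxx orbT.
(* There is room for another frame: [choose] is nonempty and smaller than [A], so [A] has at least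
   two arcs. *)
have lt' : (4 + (size L).+1 < n2 + 5)%N by move: h1 C0 less; clear; lia.
have e15 : base (3 + (size L).+1) + base 1 = base (4 + (size L).+1).
  by rewrite /base -PoszD -mulnDl; congr (Posz (_ * _)); clear; lia.
have bw p : (p < n2 + 5)%N -> `|base p| < (2 ^ W)%N%:Z.
  by move=> h; apply: (base_word sizeW); move: h; clear; lia.
have lt3 : (3 + (size L).+1 < n2 + 5)%N by move: lt'; clear; lia.
rewrite /push; apply: wp_seq.
apply: wp_assign; [exact: wf_fits ws|by rewrite /= r9; apply: bw|rewrite /= r9].
set s1 := set_reg _ _ _.
have ws1 : wf s1 by apply: wf_set_reg => //; apply: bw.
have e1 : eval s1 (Defs.Add (Reg 9) (Reg 4)) = base (4 + (size L).+1) by rewrite /= r9 r4.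
apply: wp_seq; apply: wp_assign; [exact: wf_fits ws1|by rewrite e1; apply: bw|rewrite e1].
set s2 := set_reg _ _ _.
have ws2 : wf s2 by apply: wf_set_reg => //; apply: bw.
apply: wp_seq; apply: (copy_ok sizeM sizeW (p := 3 + (size L).+1) (q := 4 + (size L).+1)) => //.
  by clear; lia.
move=> s3 ws3 fr3 pq3 po3.
have u3 : vtx s3 0 = u by apply/val_reg/fr3.
have v3 : vtx s3 1 = v by apply/val_reg/fr3.
have r93 : reg s3 9 = base (3 + (size L).+1) by rewrite fr3.
apply: wp_seq; apply: (wp_put sizeM sizeW ws3 r93) => //.
rewrite u3 v3; set s4 := set_ram _ _ _ => ws4.
have e15' : reg s4 15 = base (4 + (size L).+1) by rewrite /= fr3.
apply: wp_seq; apply: wp_assign; [exact: wf_fits ws4|by rewrite /= fr3 //; apply: bw|rewrite /= fr3 //=].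
set s5 := set_reg _ _ _.
have ws5 : wf s5 by apply: wf_set_reg => //; apply: bw.
have e13 : eval s5 (Defs.Add (Reg 13) (Lit 1)) = (size L).+2%:Z.
  by rewrite /= fr3 //= r13 /= addrC -PoszD.
have w13 : `|(size L).+2%:Z| < (2 ^ W)%N%:Z.
  apply: (nat_word (word_square sizeW)); move: h1 C0 less; clear; lia.
apply: wp_seq; apply: wp_assign; [exact: wf_fits ws5|by rewrite e13|rewrite e13].
set s6 := set_reg _ _ _.
have ws6 : wf s6 by apply: wf_set_reg.
have pg6 r x y : page s6 r x y = if (r == 4 + (size L).+1)%N then page s (4 + size L) x y
    else if [&& r == (4 + size L)%N, x == u & y == v] then 0 else page s r x y.
  rewrite [LHS](page_set s3 (3 + (size L).+1) u v 0 r x y).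
  have [->|ne] := eqVneq r (4 + (size L).+1)%N; last by rewrite po3.
  by rewrite ifF ?pq3 // !addSn !eqSS gtn_eqF.
pose top := (4 + (size L).+1)%N.
apply: wp_seq; apply: (@for_ok m M W sizeW (fun i s' => (forall b, (b < 20)%N -> reg s' b = reg s6 b) /\
  (forall z, z != 12%N -> vtx s' z = vtx s6 z) /\
  forall r x y, page s' r x y = if [&& r == top, x == u & (y < i)%N] then 0 else page s6 r x y)) => //.
- move=> s' _ off; split=> [b hb|]; first by rewrite (same_off_low off).
  split=> [z zx|r x y]; first by apply: (same_off_val m off); rewrite eq_sym.
  by rewrite (same_off_page _ _ _ off) !andbF.
- move=> i s7 ws7 [l7 [v7 p7]] vi.
  have u7 : vtx s7 0 = u by rewrite v7 //; apply/val_reg/fr3.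
  have r97 : reg s7 9 = base top by rewrite l7.
  apply: (wp_put sizeM sizeW ws7 r97) => // ws8; split=> // s8 ws8' off; split=> [b hb|].
    by rewrite (same_off_low off) //= l7.
  split=> [z zx|r x y]; first by rewrite (same_off_val m off) ?(eq_sym _ z) // -v7.
  rewrite (same_off_page _ _ _ off) page_set u7 vi p7 ltnS [(y <= i)%N]leq_eqVlt -val_eqE -(val_eqE y).
  by case: eqP => //= _; case: eqP => //= _; case: eqP.
move=> s7 ws7 [l7 [v7 p7]].
have u7 : vtx s7 0 = u by rewrite v7 //; apply/val_reg/fr3.
have vv7 : vtx s7 1 = v by rewrite v7 //; apply/val_reg/fr3.
have r97 : reg s7 9 = base top by rewrite l7.
apply: (wp_put sizeM sizeW ws7 r97) => //; rewrite u7 vv7 => ws8; apply: fin.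
have pg8 r (x y : vertex) : r != top -> page (set_ram s7 (cell top u v) 1) r x y = page s6 r x y.
  by move=> /negbTE rt; rewrite page_set p7 rt.
split=> //.
- by split; rewrite /= l7 //= fr3.
- by rewrite /= l7.
- by move=> x y; rewrite pg8 // pg6 hw.
- split; last split.
  + by apply: leq_trans h1; rewrite /= addSn -addnS leq_add2l.
  + move=> x y; rewrite page_set p7 pg6 ltn_ord andbT inE /= eqxx /=.
    have [->|xu] := eqVneq x u; last by rewrite /= andbT h2.
    by have [->|yv] := eqVneq y v; rewrite /= ?uvA ?andbF.
  + by apply: leq_trans h1; rewrite leq_add2l subset_leq_card // subsetDl.
  + move=> x y; rewrite pg8 ?pg6; last by rewrite /top addnS ltn_eqF.
    by rewrite addnS ltn_eqF // eqxx !inE xpair_eqE -h2 /=; case: ifP.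
  + apply: stored_ext h3 => r x y /andP[h4 h5]; rewrite pg8 ?pg6; last first.
      by move: h5; rewrite /top; clear; lia.
    by rewrite !ifF //; move: h5; rewrite ?addnS; clear; lia.
- by apply: best_ext ho => [b|x y]; [rewrite !inE => /orP[]/eqP -> /=; rewrite l7 //= fr3|rewrite pg8 ?pg6].
Qed.

Lemma reach_rep s A L o (Q : state -> Prop) : Rep s (A :: L) o ->
  (forall s', Rep s' (A :: L) o -> (forall z, (z < 13)%N -> vtx s' z = vtx s z) ->
     reg s' 1 = (~~ reaches ord0 A : nat)%:Z -> Q s') ->
  wp reach s Q.
Proof.
move=> R fin; have [ws [_ _ _ r8] r9 _ _ _ _] := R.
apply: (reach_ok sizeM sizeW ws r8 r9) => // s' ws' fr pg r1; apply: fin.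
- apply: (Rep_change R) => // [b hb|r u v r3 _|u v].
  + apply: fr; move: b hb; apply/allP; exact: isT.
  + exact: pg.
  + by rewrite pg //; have [_ -> _] := rep_stored R.
- move=> z hz; apply/val_reg/fr; rewrite /= !inE /vr /rr /cr; move: hz; clear; lia.
- by rewrite r1 (Rep_graph R).
Qed.

Lemma Rep_card s A A' L o : Rep s (A :: L) o -> A' \subset A -> (#|A'| <= n2 - size L)%N.
Proof.
move=> R sub; have [h1 _ _] := rep_stored R; rewrite leq_subRL.
  by apply: leq_trans h1; rewrite leq_add2l subset_leq_card.
by apply: leq_trans h1; rewrite leq_addr.
Qed.

Lemma settle_ok s A L o (Q : state -> Prop) : Rep s (A :: L) o -> squared A ->
  max_square w A (vtx s 0) (vtx s 1) (vtx s 2) (vtx s 3) ->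
  (forall s' L' o', Rep s' L' o' -> step ord0 w A L o L' o' -> Q s') -> wp settle s Q.
Proof.
move=> R sq mx fin; have /andP[/and5P[ab cd ac ad /andP[bc bd]] _] := mx.
set a := vtx s 0 in mx ab ac ad *; set b := vtx s 1 in mx ab bc bd *.
set c := vtx s 2 in mx cd ac bc *; set d := vtx s 3 in mx cd ad bd *.
have le A' : A' \subset A -> (#|A'| <= n2 - size L)%N := Rep_card R.
have sb A' p : A' \subset A -> A' :\ p \subset A.
  by apply: subset_trans; apply: subsetDl.
have norm0 : `|0 : int| <= 1 by rewrite normr0.
have norm1 : `|1 : int| <= 1 by rewrite normr1.
rewrite /settle; apply: wp_seq; apply: (put_rep (A' := A :\ (a, d)) R) => //.
- by move=> x y; rewrite !inE xpair_eqE; case: ifP.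
- by apply/le/sb.
move=> s1 R1 v1; apply: wp_seq; apply: (put_rep (A' := keep_cheap A a b c d) R1) => //.
- by move=> x y; rewrite !v1 [LHS]in_setD1 xpair_eqE; case: ifP.
- by apply/le/sb/sb.
move=> s2 R2 v2; apply: wp_seq; apply: (reach_rep R2) => s3 R3 v3 r1.
apply: wp_if; rewrite /= r1 => h; last first.
  apply: wp_skip; apply: fin R3 _; apply: StepCheap => //.
  by move: h; case: (reaches _ _).
have nr : ~~ reaches ord0 (keep_cheap A a b c d) by move: h; case: (reaches _ _).
have va : vtx s3 0 = a by rewrite v3 // v2 v1.
have vb : vtx s3 1 = b by rewrite v3 // v2 v1.
have vc : vtx s3 2 = c by rewrite v3 // v2 v1.
have vd : vtx s3 3 = d by rewrite v3 // v2 v1.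
apply: wp_seq; apply: (put_rep (A' := A :\ (b, c)) R3) => //.
- move=> x y; rewrite va vd !inE !xpair_eqE.
  have [->|_] := eqVneq x a; have [->|_] := eqVneq y d; rewrite ?ad ?(negbTE ab) //=.
- by apply/le/sb.
move=> s4 R4 v4; apply: wp_seq; apply: (put_rep (A' := A) R4) => //.
- move=> x y; rewrite !v4 vb vc !inE xpair_eqE.
  by have [->|_] := eqVneq x b; have [->|_] := eqVneq y c; rewrite ?bc.
- exact: le.
move=> s5 R5 v5; apply: wp_seq; apply: (put_rep (A' := A :\ (a, c)) R5) => //.
- by move=> x y; rewrite !v5 !v4 va vc !inE xpair_eqE; case: ifP.
- by apply/le/sb.
move=> s6 R6 v6; apply: (put_rep (A' := keep_dear A a b c d) R6) => //.
- by move=> x y; rewrite !v6 !v5 !v4 vb vd [LHS]in_setD1 xpair_eqE; case: ifP.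
- by apply/le/sb/sb.
by move=> s7 R7 _; apply: fin R7 _; apply: StepDear.
Qed.

Lemma weigh_ok s A L o (t : {perm vertex}) (Q : state -> Prop) : Rep s (A :: L) o ->
  (forall u v, ((u, v) \in A) = (t u == v)) ->
  (forall s', Rep s' (A :: L) o -> reg s' 10 = wt w t -> Q s') -> wp weigh s Q.
Proof.
move=> R tA fin; have ws := rep_wf R.
pose S i := \sum_(u : vertex | (u < i)%N) w u (t u).
have S0 : S 0%N = 0 by rewrite /S big_pred0.
have SS (i : vertex) : S i.+1 = S i + w i (t i).
  rewrite /S (bigD1 i) //= addrC; congr (_ + _); apply: eq_bigl => u.
  by rewrite ltnS andbC ltn_neqAle.
have Sn : S n = wt w t by rewrite /S; apply: eq_bigl => u; rewrite ltn_ord.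
(* The accumulator runs through all partial sums, and each of them must fit in a word. *)
have Sle i : (i <= n)%N -> `|S i| < (2 ^ W)%N%:Z.
  move=> _; apply: le_lt_trans (_ : (n * B)%N%:Z < _); last by rewrite ltz_nat.
  apply: le_trans (ler_norm_sum _ _ _) _.
  apply: le_trans (_ : \sum_(u : vertex) B%:Z <= _).
    rewrite big_mkcond /=; apply: ler_sum => u _; case: ifP => // _; exact: le_trans (smallw u (t u)).
  by rewrite sumr_const card_ord -mulr_natl natz PoszM.
rewrite /weigh; apply: wp_seq; apply: wp_assign; [exact: wf_fits ws|by rewrite -S0 Sle|].
have ws1 : wf (set_reg s 10 0) by apply: wf_set_reg => //; rewrite -S0 Sle.
apply: (@for_ok m M W sizeW (fun i s' => Rep s' (A :: L) o /\ reg s' 10 = S i)) => //.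
- move=> s' ws' off; split; last by rewrite (same_off_low off) // S0.
  apply: (Rep_off _ ws' off); apply: (Rep_test R) => // b hb.
  rewrite /= ifF //; apply/negbTE; move: b hb; apply/allP; exact: isT.
- move=> i s1 _ [R1 s10] vi; apply: (check_rep _ _ R1) => // s2 R2 fr.
    have vi2 : vtx s2 0 = i by rewrite -vi; apply/val_reg/fr.
    move=> _; rewrite /= add0r (Rep_arc _ _ R1) vi2 tA => /eqP ti.
    have e : eval s2 (Defs.Add (Reg 10) (entry 6 0 1)) = S i.+1.
      have -> : eval s2 (Defs.Add (Reg 10) (entry 6 0 1)) = reg s2 10 + ent s2 6 i (t i).
        by rewrite /= (wf_rr 0 (rep_wf R2)) (wf_vr 1 (rep_wf R2)) vi2 ti.
      have [_ [_ r6 _ _] _ _ hw _ _] := R2.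
      by rewrite (ent_page _ _ r6) hw fr // s10 SS.
    have lt : `|S i.+1| < (2 ^ W)%N%:Z by apply: Sle.
    apply: wp_assign; rewrite ?e //; first exact: wf_fits (rep_wf R2).
    have ws3 : wf (set_reg s2 10 (S i.+1)) by apply: wf_set_reg => //; exact: rep_wf R2.
    split=> // s4 ws4 off; split; last by rewrite (same_off_low off).
    apply: (Rep_off _ ws4 off); apply: (Rep_test R2) => // b hb.
    rewrite /= ifF //; apply/negbTE; move: b hb; apply/allP; exact: isT.
  move=> no; exfalso; move/negP: no; apply; apply/existsP; exists (t i).
  by rewrite /upd /= add0r (Rep_arc _ _ R1) vi tA.
- by move=> s' _ [R' e]; apply: fin => //; rewrite e Sn.
Qed.

Lemma save_ok s A L o (t : {perm vertex}) (Q : state -> Prop) : Rep s (A :: L) o ->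
  (forall u v, ((u, v) \in A) = (t u == v)) -> reg s 10 = wt w t ->
  (forall s', Rep s' (A :: L) (Some t) -> Q s') -> wp save s Q.
Proof.
move=> R tA e fin; have [ws [r4 r6 r7 r8] r9 r13 hw [h1 h2 h3] ho] := R.
have bw p : (p < n2 + 5)%N -> `|base p| < (2 ^ W)%N%:Z.
  by move=> h; apply: (base_word sizeW); move: h; clear; lia.
have small : `|wt w t| < (2 ^ W)%N%:Z by rewrite -e; case: ws => -[+ _ _] _ _.
rewrite /save; apply: wp_seq; apply: wp_assign; [exact: wf_fits ws|by rewrite /= e|rewrite /= e].
set s1 := set_reg _ _ _; have ws1 : wf s1 by apply: wf_set_reg.
have one : `|1 : int| < (2 ^ W)%N%:Z by apply: (nat_word (word_square sizeW)); rewrite muln_gt0.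
apply: wp_seq; apply: wp_assign; [exact: wf_fits ws1|by []|rewrite /=].
set s2 := set_reg _ _ _; have ws2 : wf s2 by apply: wf_set_reg.
have b9 : `|base (4 + size L)| < (2 ^ W)%N%:Z by apply/bw/(Rep_top_bound R).
apply: wp_seq; apply: wp_assign; [exact: wf_fits ws2|by rewrite /= r9|rewrite /= r9].
set s3 := set_reg _ _ _; have ws3 : wf s3 by apply: wf_set_reg.
have b2 : `|base 2| < (2 ^ W)%N%:Z by apply: bw; rewrite addnC.
apply: wp_seq; apply: wp_assign; [exact: wf_fits ws3|by rewrite /= r7|rewrite /= r7].
set s4 := set_reg _ _ _; have ws4 : wf s4 by apply: wf_set_reg.
apply: (copy_ok sizeM sizeW (p := 4 + size L) (q := 2)) => //.
  by rewrite addnC.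
move=> s5 ws5 fr pq po; apply: fin; split=> //.
- by split; rewrite fr.
- by rewrite fr.
- by rewrite fr.
- by move=> u v; rewrite po //; apply: hw.
- split=> //.
    by move=> u v; rewrite po //; apply: h2.
  apply: stored_ext h3 => r u v /andP[h4 h5]; rewrite po //.
  by move: h4; case: eqP => // ->.
- by split; rewrite ?fr // => u v; rewrite pq -tA -h2.
Qed.

Lemma leaf_ok s A L o (t : {perm vertex}) (Q : state -> Prop) : Rep s (A :: L) o ->
  (forall u v, ((u, v) \in A) = (t u == v)) ->
  (forall s' L' o', Rep s' L' o' -> step ord0 w A L o L' o' -> Q s') -> wp leaf s Q.
Proof.
move=> R tA fin; rewrite /leaf; apply: wp_seq; apply: (reach_rep R) => s1 R1 _ r1.
apply: wp_seq; apply: wp_if; rewrite /= r1 => h.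
  apply: wp_skip; apply: (pop_ok R1) => s2 R2; apply: fin R2 _; apply: StepDrop.
  by move: h; case: (reaches _ _).
have re : reaches ord0 A by move: h; case: (reaches _ _).
apply: wp_seq; apply: (weigh_ok R1 tA) => s2 R2 r10.
have sv : (forall t', o = Some t' -> wt w t <= wt w t') ->
    wp save s2 (fun s' => wp pop s' Q).
  move=> le; apply: (save_ok R2 tA r10) => s3 R3; apply: (pop_ok R3) => s4 R4.
  by apply: fin R4 _; apply: StepBetter tA re le.
have := rep_best R2; case: o R R1 R2 fin sv => [t'|] R R1 R2 fin sv /=.
  move=> [r12 r11 _]; apply: wp_if; rewrite /= r12 // => _.
  apply: wp_if; rewrite /= r11 r10 => h'.
    by apply: sv => t'' [<-]; rewrite ltW // -subr_gt0.
  apply: wp_skip; apply: (pop_ok R2) => s3 R3; apply: fin R3 _.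
  by apply: StepWorse tA _; rewrite -subr_le0.
by move=> r12; apply: wp_if; rewrite /= r12 ?ltxx // => _; apply: sv.
Qed.

Lemma body_ok s A L o (Q : state -> Prop) : Rep s (A :: L) o ->
  (forall s' L' o', Rep s' L' o' -> step ord0 w A L o L' o' -> Q s') -> wp body s Q.
Proof.
move=> R fin; have hA := fun u v => Rep_arc u v R.
apply: (check_rep _ _ R) => // s1 R1 fr1.
  rewrite (sem_useless hA) => _ us; apply: (put_rep (A' := A :\ (vtx s1 0, vtx s1 1)) R1) => //.
  - by move=> x y; rewrite !inE xpair_eqE; case: ifP.
  - by apply: (Rep_card R1); apply: subsetDl.
  - by move=> s2 R2 _; apply: fin R2 _; apply: StepUseless.
rewrite (sem_has_useless hA) => nu.
have hA1 := fun u v => Rep_arc u v R1.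
apply: (check_rep _ _ R1) => // s2 R2 fr2.
  rewrite (sem_dead hA1) => de _; apply: (pop_ok R2) => s3 R3; apply: fin R3 _.
  exact: StepDead.
rewrite (sem_dead hA1) => nd; have hA2 := fun u v => Rep_arc u v R2.
have rA : reduced A.
  by rewrite /reduced nd; apply/forallP => u; apply/forallP => v;
    move/existsPn/(_ u)/existsPn/(_ v): nu.
apply: (check_rep _ _ R2) => // s3 R3 fr3.
  rewrite (sem_branch hA2) => _ br; apply: (push_ok R3).
  - by case/andP: br.
  - exact/proper_card/choose_proper.
  - by move=> s4 R4; apply: fin R4 _; apply: StepBranch.
rewrite (sem_has_branch hA2) => nb; have hA3 := fun u v => Rep_arc u v R3.
have sq : squared A.
  by apply: squaredP => u v; move/existsPn/(_ u)/existsPn/(_ v): nb.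
have we : ent s3 6 =2 w.
  by move=> u v; have [_ [_ r6 _ _] _ _ hw _ _] := R3; rewrite (ent_page _ _ r6).
have mxe (a b c d : vertex) : max_square (ent s3 6) A a b c d = max_square w A a b c d.
  rewrite /max_square; congr (_ && ~~ _); do 4!(apply: eq_existsb => ?).
  by rewrite /swap_cost !we.
apply: (check_rep _ _ R3) => // s4 R4 fr4.
  rewrite (sem_square hA3) mxe => _ mx; exact: (settle_ok R4 sq mx).
rewrite (sem_has_square hA3) => ns.
have [t tA] : exists t : {perm vertex}, forall u v, ((u, v) \in A) = (t u == v).
  apply: (leaf_perm (w := w) rA sq) => a b c d; rewrite -mxe.
  by move/existsPn/(_ a)/existsPn/(_ b)/existsPn/(_ c)/existsPn/(_ d): ns.
exact: (leaf_ok R4 tA).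
Qed.

End Body.

(** * Correctness and termination of the search *)

Section Search.
Variables (T : finType) (r : T) (w : T -> T -> int) (E : {set T * T}).
Implicit Types (A : {set T * T}) (L : seq {set T * T}) (o : option {perm T}).

(** Settling a square may lose tours, even optimal ones. So each tour of [E] is only promised a
    rival that is no heavier, in some open frame or already saved. *)
Definition covers L o :=
  [/\ {in L, forall A, A \subset E}, forall t, o = Some t -> ham r E t &
      forall s, ham r E s ->
        (exists t A, [/\ A \in L, ham r A t & wt w t <= wt w s]) \/
        (exists2 t, o = Some t & wt w t <= wt w s)].

Lemma step_covers A L o L' o' : covers (A :: L) o -> step r w A L o L' o' -> covers L' o'.
Proof.
move=> [sub best cov] st.
have AE : A \subset E by apply: sub; rewrite inE eqxx.
have LE (B : {set T * T}) : B \in L -> B \subset E by move=> BL; apply: sub; rewrite inE BL orbT.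
(* it is enough to account for the tours of the frame [A] *)
have reduce (Ls : seq {set T * T}) o2 : {subset L <= Ls} ->
    (forall t, o = Some t -> exists2 t', o2 = Some t' & wt w t' <= wt w t) ->
    {in Ls, forall B : {set T * T}, B \subset E} -> (forall t, o2 = Some t -> ham r E t) ->
    (forall s, ham r A s -> (exists t (B : {set T * T}), [/\ B \in Ls, ham r B t & wt w t <= wt w s]) \/
        (exists2 t, o2 = Some t & wt w t <= wt w s)) -> covers Ls o2.
  move=> sL so sE sb h; split=> // s /cov [[t [B [+ hB le]]]|[t ot le]].
    rewrite inE => /orP[/eqP eB|BL]; last by left; exists t, B; split=> //; apply: sL.
    rewrite eB in hB; case: (h _ hB) => [[t' [B' [? ? le']]]|[t' ? le']].
      by left; exists t', B'; split=> //; apply: le_trans le.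
    by right; exists t' => //; apply: le_trans le.
  by have [t' ot' le'] := so _ ot; right; exists t' => //; apply: le_trans le.
have refl t : o = Some t -> exists2 t', o = Some t' & wt w t' <= wt w t.
  by exists t.
have sub1 (B : {set T * T}) : B \subset A -> {in B :: L, forall C : {set T * T}, C \subset E}.
  by move=> BA C; rewrite inE => /orP[/eqP -> |/LE //]; apply: subset_trans AE.
have tl (B : {set T * T}) : {subset L <= B :: L} by move=> C; rewrite inE orbC => ->.
case: st sub best reduce refl AE LE sub1 tl {cov}.
- move=> {A L o L' o'} A L o u v us sub best reduce refl AE LE sub1 tl.
  apply: reduce => //; first by apply/sub1/subsetDl.
  move=> s hs; left; exists s, (A :\ (u, v)); split; rewrite ?inE ?eqxx //.
  apply: (ham_sub hs) => x; have [sA _] := hamP _ _ _ hs.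
  rewrite !inE sA andbT; apply: contraNneq (ham_useless hs us) => -[-> ->]; exact: eqxx.
- move=> {A L o L' o'} A L o de sub best reduce refl AE LE sub1 tl.
  by apply: reduce => // s /ham_dead; rewrite de.
- move=> {A L o L' o'} A L o u v _ _ sub best reduce refl AE LE sub1 tl.
  apply: reduce => //; first by move=> B; rewrite !inE orbA orbC => ->.
    move=> B; rewrite !inE => /or3P[/eqP ->|/eqP ->|/LE //].
      by apply: subset_trans AE; apply: choose_sub.
    by apply: subset_trans AE; apply: subsetDl.
  move=> s hs; left; have [sA _] := hamP _ _ _ hs.
  have [e|ne] := eqVneq (s u) v.
    exists s, (choose A u v); split; rewrite ?inE ?eqxx //; apply: (ham_sub hs) => x.
    by rewrite inE sA /=; have [->|//] := eqVneq x u; rewrite e eqxx.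
  exists s, (A :\ (u, v)); split; rewrite ?inE ?eqxx ?orbT //; apply: (ham_sub hs) => x.
  by rewrite !inE sA andbT; apply: contraNneq ne => -[-> ->].
- move=> {A L o L' o'} A L o a b c d sq mx re sub best reduce refl AE LE sub1 tl.
  apply: reduce => //; first by apply/sub1/(subset_trans (subsetDl _ _))/subsetDl.
  move=> s hs; left; have [t ht le] := ham_swap sq mx hs re.
  by exists t, (keep_cheap A a b c d); split; rewrite ?inE ?eqxx.
- move=> {A L o L' o'} A L o a b c d sq /andP[mx _] re sub best reduce refl AE LE sub1 tl.
  apply: reduce => //; first by apply/sub1/(subset_trans (subsetDl _ _))/subsetDl.
  move=> s hs; left; have ht := ham_keep_dear sq mx hs re.
  by exists s, (keep_dear A a b c d); split; rewrite ?inE ?eqxx.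
- move=> {A L o L' o'} A L o re sub best reduce refl AE LE sub1 tl.
  by apply: reduce => // s /ham_reaches; rewrite (negbTE re).
- move=> {A L o L' o'} A L s t tA le sub best reduce refl AE LE sub1 tl.
  apply: reduce => // s' /(leaf_ham tA) ->; right; by exists t.
move=> {A L o L' o'} A L o s tA re le sub best reduce refl AE LE sub1 tl.
apply: reduce => //.
- by move=> t /le; exists s.
- by move=> t [<-]; apply: (ham_subset AE); apply: leaf_reaches tA re.
- by move=> s' /(leaf_ham tA) ->; right; exists s.
Qed.

Variables (R : realType) (c : R).
Hypotheses (c3 : c ^+ 3 = 2%:R) (c0 : 0 < c).

Definition work L : R := \sum_(A <- L) potential c A.

Lemma square_proper A a b d e : square A a b d e ->
  keep_cheap A a b d e \proper A /\ keep_dear A a b d e \proper A.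
Proof.
move=> /and5P[_ _ ad ae /andP[bd be]].
by split; [apply: sub_proper_trans (properD1 ae)|apply: sub_proper_trans (properD1 ad)];
  apply: subsetDl.
Qed.

(** Every round but a branching drops the top frame or replaces it by a proper subset; only a
    branching calls on the analysis of weights. *)
Lemma step_work A L o L' o' : step r w A L o L' o' -> work L' + 1 <= work (A :: L).
Proof.
rewrite [work (A :: L)]/work big_cons -/(work L).
have pr (B A1 : {set T * T}) L1 : B \proper A1 -> work (B :: L1) + 1 <= potential c A1 + work L1.
  move=> h; rewrite /work big_cons -/(work L1) addrAC lerD2r.
  exact: potential_proper.
have drop L1 A1 : work L1 + 1 <= potential c A1 + work L1.
  by rewrite addrC lerD2r; apply: potential_ge1.
case=> {A L o L' o'}.
- by move=> A L o u v /andP[uv _]; apply/pr/properD1.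
- by move=> *; apply: drop.
- move=> A L o u v rA br; have := potential_branch c3 c0 rA br.
  rewrite /work !big_cons; lra.
- by move=> A L o a b d e _ /andP[/square_proper[h _] _] _; apply: pr.
- by move=> A L o a b d e _ /andP[/square_proper[_ h] _] _; apply: pr.
- by move=> *; apply: drop.
- by move=> *; apply: drop.
- by move=> *; apply: drop.
Qed.

Lemma work_ge1 A L : 1 <= work (A :: L).
Proof.
rewrite /work big_cons; apply: le_trans (potential_ge1 c A) _.
rewrite lerDl; apply: sumr_ge0 => B _.
by apply: le_trans (potential_ge1 c B).
Qed.

End Search.

(** * Hamiltonian cycles as cyclic permutations *)

Section Tours.
Variables (m : nat) (e : rel 'I_m.+1) (w : 'I_m.+1 -> 'I_m.+1 -> int).
Local Notation n := m.+1.

Definition arcs : {set 'I_n * 'I_n} := [set p | e p.1 p.2].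

(** The successor map of a duplicate-free cycle has [prev] as inverse, and its orbit is the whole
    list, which by counting contains every vertex. *)
Lemma ham_cycle_perm c : ham_cycle e c ->
  exists2 t, ham ord0 arcs t & cycle_weight w c = wt w t.
Proof.
move=> /and4P[_ uc /eqP sc cy].
have inc x : x \in c.
  have [||_ ->] := uniq_min_size (s2 := enum 'I_n) uc; last by rewrite mem_enum.
    by move=> y _; rewrite mem_enum.
  by rewrite size_enum_ord sc.
pose t := perm (can_inj (prev_next uc)); exists t; last first.
  rewrite /cycle_weight /wt big_uniq //=.
  apply: eq_big => [x|x _]; [by rewrite inc|by rewrite permE].
apply/hamP; split=> [u|]; first by rewrite inE permE /=; apply: next_cycle.
apply/setP => x; rewrite inE.
have /(_ ord0 (inc _) x) := fconnect_cycle (cycle_next uc); rewrite inc => h.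
have := iter_findex h => <-.
rewrite (_ : iter _ _ _ = (t ^+ findex (next c) ord0 x)%g ord0) ?mem_porbit // permX.
by apply: eq_iter => y; rewrite permE.
Qed.

(** The orbit of vertex 0 has n elements, so its first n iterates are distinct and the next one
    closes the cycle. *)
Lemma perm_ham_cycle t : ham ord0 arcs t ->
  let c := traject t ord0 n in ham_cycle e c /\ cycle_weight w c = wt w t.
Proof.
move=> /hamP[ta po] c.
have uc : uniq c by have := uniq_traject_porbit t ord0; rewrite po cardsT card_ord.
have sc : size c = n by rewrite size_traject.
have inc x : x \in c.
  have : x \in porbit t ord0 by rewrite po inE.
  by rewrite porbit_traject po cardsT card_ord.
have cy : fcycle t c.
  rewrite /c /= rcons_path fpath_traject last_traject /= -iterS.
  by have := iter_porbit t ord0; rewrite po cardsT card_ord => ->.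
have nx x : next c x = t x by apply/esym/eqP/(next_cycle cy).
split.
  apply/and4P; split=> //; first by rewrite sc.
  by apply: sub_cycle cy => x y /eqP <-; have := ta x; rewrite inE.
rewrite /cycle_weight /wt big_uniq //.
by apply: eq_big => [x|x _]; rewrite ?inc ?nx.
Qed.

End Tours.

(** * Running the program *)

Section Run.
Variables (m M W B : nat) (w : 'I_m.+1 -> 'I_m.+1 -> int).
Local Notation n := m.+1.
Local Notation vertex := 'I_n.
Hypothesis sizeM : ((n * n + 5) * (n * n) <= M)%N.
Hypothesis sizeW : ((n * n + 6) * (n * n) < 2 ^ W)%N.
Hypothesis smallw : forall u v, `|w u v| <= B%:Z.
Hypothesis sumW : (n * B < 2 ^ W)%N.
Implicit Types (s : state) (E : {set vertex * vertex}) (o : option {perm vertex}).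

Local Notation wp := (wp m M W).
Local Notation wf := (wf m M W).
Local Notation vtx := (@vtx m).
Local Notation base := (base m).
Local Notation n2 := (n * n)%N.
Local Notation Rep := (Rep M W w).

Lemma init_ok s E (Q : state -> Prop) : wf s ->
  (forall u v, (0 < page s 0 u v) = ((u, v) \in E)) ->
  (forall u v, page s 1 u v = w u v) ->
  (forall s', Rep s' [:: E] None -> Q s') -> wp init s Q.
Proof.
move=> ws hE hw fin.
have nw k : (k <= n2)%N -> `|k%:Z| < (2 ^ W)%N%:Z := @nat_word m W (word_square sizeW) k.
have bw p : (p < 5)%N -> `|base p| < (2 ^ W)%N%:Z.
  by move=> h; apply: (base_word sizeW); move: h; clear; lia.
rewrite /init; apply: wp_seq; apply: wp_assign; [exact: wf_fits ws|exact: nw|rewrite /=].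
set s1 := set_reg _ _ _; have ws1 : wf s1 by apply: wf_set_reg => //; apply: nw.
apply: wp_seq; apply: (@for_ok m M W sizeW (fun i s' => reg s' 4 = (i * n)%N%:Z /\ ram s' = ram s)) => //.
- by move=> s' _ off; rewrite (same_off_low off) //; split=> //; case: off => ->.
- move=> i s2 ws2 [r4 er] _.
  have e : eval s2 (Defs.Add (Reg 4) (Reg 0)) = (i.+1 * n)%N%:Z.
    by rewrite /= r4 (wf_n ws2) -PoszD addnC -mulSn.
  have lt : `|(i.+1 * n)%N%:Z| < (2 ^ W)%N%:Z by apply: nw; rewrite leq_mul2r ltn_ord orbT.
  apply: wp_assign; rewrite ?e //; first exact: wf_fits ws2.
  split; first exact: wf_set_reg.
  by move=> s3 _ off; rewrite (same_off_low off) //; split=> //; case: off => ->.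
move=> s2 ws2 [r4 er].
have {}r4 : reg s2 4 = base 1 by rewrite r4 /base mul1n.
have add p q : base p + base q = base (p + q) by rewrite /base -PoszD -mulnDl.
apply: wp_seq; apply: wp_assign; [exact: wf_fits ws2|by rewrite /= r4 bw|rewrite /= r4].
set s3 := set_reg _ _ _; have ws3 : wf s3 by apply: wf_set_reg => //; apply: bw.
apply: wp_seq; apply: wp_assign; [exact: wf_fits ws3|by rewrite /= r4 add bw|rewrite /= r4 add].
set s4 := set_reg _ _ _; have ws4 : wf s4 by apply: wf_set_reg => //; apply: bw.
apply: wp_seq; apply: wp_assign; [exact: wf_fits ws4|by rewrite /= r4 add bw|rewrite /= r4 add].
set s5 := set_reg _ _ _; have ws5 : wf s5 by apply: wf_set_reg => //; apply: bw.
apply: wp_seq; apply: wp_assign; [exact: wf_fits ws5|by rewrite /= r4 add bw|rewrite /= r4 add].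
set s6 := set_reg _ _ _; have ws6 : wf s6 by apply: wf_set_reg => //; apply: bw.
apply: wp_seq; apply: wp_assign; [exact: wf_fits ws6|exact: nw|rewrite /=].
set s7 := set_reg _ _ _; have ws7 : wf s7 by apply: wf_set_reg => //; apply: nw.
apply: wp_seq; apply: wp_assign; [exact: wf_fits ws7|exact: bw|rewrite /=].
set s8 := set_reg _ _ _; have ws8 : wf s8 by apply: wf_set_reg => //; apply: bw.
apply: wp_seq; apply: (copy_ok sizeM sizeW (p := 0) (q := 4)) => //.
  by rewrite addnC.
move=> s9 ws9 fr pq po.
apply: wp_seq; apply: wp_assign; [exact: wf_fits ws9|exact: nw|rewrite /=].
set s10 := set_reg _ _ _; have ws10 : wf s10 by apply: wf_set_reg => //; apply: nw.
have one : `|1 : int| < (2 ^ W)%N%:Z by apply: nw; rewrite muln_gt0.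
apply: wp_assign; [exact: wf_fits ws10|by []|rewrite /=].
have pg r (u v : vertex) : page s8 r u v = page s r u v by rewrite /page /= er.
apply: fin; split.
- exact: wf_set_reg.
- by split; rewrite /= fr.
- by rewrite /= fr.
- by [].
- by move=> u v; rewrite -hw -pg -po.
- split=> [|u v|] //; last by rewrite -hE -pg -pq.
  rewrite add0n; apply: leq_trans (max_card _) _.
  by rewrite card_prod card_ord.
- by [].
Qed.

Lemma output_ok s o (Q : state -> Prop) : Rep s [::] o ->
  (forall s', (if o is Some t then
       reg s' 0 = 1 /\ forall i, (i < n)%N -> ram s' i%:Z = ((t ^+ i)%g ord0 : nat)%:Z
     else reg s' 0 = 0) -> Q s') -> wp output s Q.
Proof.
move=> R fin; have ws := rep_wf R.
have one : `|1 : int| < (2 ^ W)%N%:Z by apply: (nat_word (word_square sizeW)); rewrite muln_gt0.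
have zero : `|0 : int| < (2 ^ W)%N%:Z by apply: (nat_word (word_square sizeW)).
have := rep_best R; case: o R fin => [t|] R fin /=; last first.
  move=> r12; apply: wp_if; rewrite /= r12 ?ltxx // => _.
  by apply: wp_assign => //; [exact: wf_fits ws|apply: fin].
move=> [r12 _ tA]; apply: wp_if; rewrite /= r12 // => _.
apply: wp_seq; apply: wp_assign => //=; first exact: wf_fits ws.
apply: wp_seq; apply: wp_assign => //=.
  exact: fits_set_reg (wf_fits ws) zero.
set s1 := set_reg _ _ _.
have ws1 : wf s1 := wf_move (word_square sizeW) 0 ord0 ws.
have v1 : vtx s1 0 = ord0 := val_move (word_square sizeW) s 0 ord0.
have [_ [_ _ r7 _] _ _ _ _ _] := R.
have c0 (i : vertex) : (i : nat)%:Z = cell 0 ord0 i by [].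
pose I i s' := [/\ reg s' 7 = base 2, (forall u v : vertex, page s' 2 u v = page s 2 u v),
  vtx s' 0 = (t ^+ i)%g ord0 &
  forall j : vertex, (j < i)%N -> page s' 0 ord0 j = ((t ^+ j)%g ord0 : nat)%:Z].
apply: wp_seq; apply: (@for_ok m M W sizeW I) => //.
- move=> s' _ off; split=> //.
  + by rewrite (same_off_low off).
  + by move=> u v; rewrite (same_off_page _ _ _ off).
  + by rewrite (same_off_val m off) // expg0 perm1.
- move=> i s2 ws2 [a7 p2 v2 out] vi.
  have ea : eval s2 (Reg (vr 1)) = cell 0 ord0 i by rewrite /= (wf_vr 1 ws2) vi.
  have ev : eval s2 (Reg (vr 0)) = ((t ^+ i)%g ord0 : nat)%:Z by rewrite /= (wf_vr 0 ws2) v2.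
  have cb : 0 <= cell 0 ord0 i < M%:Z by apply: (cell_bound sizeM); rewrite addnC.
  have vw : `|((t ^+ i)%g ord0 : nat)%:Z| < (2 ^ W)%N%:Z := vertex_word (word_square sizeW) _.
  apply: wp_seq; apply: wp_store; rewrite ?ea ?ev //; first exact: wf_fits ws2.
  set s3 := set_ram _ _ _; have ws3 : wf s3 by apply: wf_set_ram.
  have v3 : vtx s3 0 = (t ^+ i)%g ord0 by [].
  have pg3 r (u v : vertex) : page s3 r u v =
      if [&& r == 0%N, u == ord0 & v == i] then ((t ^+ i)%g ord0 : nat)%:Z else page s2 r u v.
    exact: page_set.
  have p3 (u v : vertex) : ent s3 7 u v = page s 2 u v by rewrite (ent_page (p := 2)) // pg3 p2.
  have out3 (j : vertex) : (j < i.+1)%N -> page s3 0 ord0 j = ((t ^+ j)%g ord0 : nat)%:Z.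
    rewrite ltnS leq_eqVlt pg3 !eqxx /= -val_eqE /=.
    by case: eqP => [->|_] //=; apply: out.
  have r73 : reg s3 7 = base 2 by [].
  clearbody s3; apply: check_ok => //; first exact: word_square sizeW.
    move=> s4 ws4 er fr _; rewrite /= add0r p3 tA => /eqP ti.
    have v4 : vtx s4 0 = (t ^+ i)%g ord0 by rewrite -v3; apply/val_reg/fr.
    have e2 : eval s4 (Reg (vr 2)) = (vtx s4 2 : nat)%:Z by rewrite /= (wf_vr 2 ws4).
    have f1 : `|(vtx s4 2 : nat)%:Z| < (2 ^ W)%N%:Z := vertex_word (word_square sizeW) _.
    apply: wp_seq; apply: wp_assign; rewrite ?e2 //; first exact: wf_fits ws4.
    have e3 : eval (set_reg s4 (vr 0) (vtx s4 2 : nat)%:Z) (Reg (rr 2)) = (vtx s4 2 * n)%N%:Z.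
      by rewrite /= (wf_rr 2 ws4).
    apply: wp_assign; rewrite ?e3; [exact: fits_set_reg (wf_fits ws4) f1|exact: row_word (word_square sizeW) _|].
    set s5 := set_reg _ _ _.
    have ws5 : wf s5 := wf_move (word_square sizeW) 0 (vtx s4 2) ws4.
    have v5 : vtx s5 0 = vtx s4 2 := val_move (word_square sizeW) s4 0 (vtx s4 2).
    have pg5 r (u v : vertex) : page s5 r u v = page s3 r u v by rewrite /page /= er.
    split=> // s6 _ off; split.
    + by rewrite (same_off_low off) //= fr // r73.
    + by move=> u v; rewrite (same_off_page _ _ _ off) pg5 pg3 p2.
    + by rewrite (same_off_val m off) // v5 -ti v4 expgSr permM.
    + by move=> j ji; rewrite (same_off_page _ _ _ off) pg5 out3.
  move=> s4 _ _ _ no; exfalso; move/negP: no; apply; apply/existsP; exists (t (vtx s3 0)).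
  by rewrite /upd /= add0r p3 tA.
move=> s2 ws2 [_ _ _ out]; apply: wp_assign => //; first exact: wf_fits ws2.
apply: fin; split=> // i ilt /=.
by have := out (Ordinal ilt) ilt; rewrite /page.
Qed.

Variables (R : realType) (c : R).
Hypotheses (c3 : c ^+ 3 = 2%:R) (c0 : 0 < c).

(** Here [k] is fuel. A nonempty stack has work at least 1, so the fuel cannot run out early; the 2
    in each round is the cost of the guard. *)
Lemma search_ok E k s L o : Rep s L o -> covers ord0 w E L o -> work c L <= k%:R ->
  exists t s' o', [/\ exec M W (While (Reg 13) body) s t s',
    (t <= k * (2 + cost n body) + 2)%N, Rep s' [::] o' & covers ord0 w E [::] o'].
Proof.
elim: k s L o => [|k IH] s [|A L] o Rs cv le.
- by exists 2%N, s, o; split=> //; apply: exec_while_false; rewrite /= (rep_size Rs).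
- by have := le_trans (work_ge1 c A L) le; rewrite ler10.
- exists 2%N, s, o; split; rewrite ?leq_addl //.
  by apply: exec_while_false; rewrite /= (rep_size Rs).
have [t1 [s1 [e1 l1 [L' [o' [R1 st]]]]]] : wp body s (fun s' => exists L' o',
    Rep s' L' o' /\ step ord0 w A L o L' o').
  by apply: (body_ok sizeM sizeW smallw sumW Rs) => s' L' o' ? ?; exists L', o'.
have [|t2 [s2 [o2 [e2 l2 R2 cv2]]]] := IH _ _ _ R1 (step_covers cv st).
  by have := step_work c3 c0 st; move: le; rewrite -natr1; lra.
exists (2 + t1 + t2)%N, s2, o2; split=> //.
  by apply: exec_while_true e1 e2; rewrite /= (rep_size Rs).
by rewrite mulSn -[leqRHS]addnA; apply: leq_add => //; rewrite leq_add2l.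
Qed.

Lemma run_ok s E k : wf s ->
  (forall u v, (0 < page s 0 u v) = ((u, v) \in E)) ->
  (forall u v, page s 1 u v = w u v) ->
  potential c E <= k%:R ->
  exists t s' o, [/\ exec M W program s t s',
    (t <= 2 + (cost n init + (k * (2 + cost n body) + 2 + cost n output)))%N,
    covers ord0 w E [::] o &
    if o is Some t then
       reg s' 0 = 1 /\ forall i, (i < n)%N -> ram s' i%:Z = ((t ^+ i)%g ord0 : nat)%:Z
     else reg s' 0 = 0].
Proof.
move=> ws hE hw le.
have [t1 [s1 [e1 l1 R1]]] : wp init s (fun s' => Rep s' [:: E] None) by apply: init_ok hE hw _.
have cv : covers ord0 w E [:: E] None.
  split=> [A|//|t ht]; first by rewrite inE => /eqP ->.
  by left; exists t, E; rewrite inE eqxx.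
have [|t2 [s2 [o [e2 l2 R2 cv2]]]] := search_ok (k := k) R1 cv.
  by rewrite /work big_seq1.
have [t3 [s3 [e3 l3 fin]]] : wp output s2 (fun s' => if o is Some t then
       reg s' 0 = 1 /\ forall i, (i < n)%N -> ram s' i%:Z = ((t ^+ i)%g ord0 : nat)%:Z
     else reg s' 0 = 0) by apply: output_ok R2 _.
exists (2 + (t1 + (t2 + t3)))%N, s3, o; split=> //.
  apply: exec_if_true; first by rewrite /= (wf_n ws).
  by apply: exec_seq e1 _; apply: exec_seq e2 e3.
by rewrite leq_add2l !leq_add.
Qed.

End Run.

(** * Time, space and the theorem *)

Section Constants.
Variable R : realType.

(** The claim is log_2 3 < 317/200, that is 3^200 < 2^317. *)
Lemma beta_lt : beta R < 585%:R / 1000%:R.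
Proof.
(* To keep the numbers small: 19/12 is a convergent of log_2 3, so 3^12 / 2^19 is close to 1, and
   200 = 12 * 16 + 8, 317 = 19 * 16 + 13. The 16th power is taken by four squarings, each rounded up
   to a small fraction; finally 1.246 * 3^8 < 2^13. *)
have y16 : (3%:R ^+ 12 / 2%:R ^+ 19 : R) ^+ 16 * 3%:R ^+ 8 < 2%:R ^+ 13.
  have y0 : 0 <= 3%:R ^+ 12 / 2%:R ^+ 19 :> R by rewrite divr_ge0 ?exprn_ge0.
  have y1 : 3%:R ^+ 12 / 2%:R ^+ 19 <= 74%:R / 73%:R :> R.
    by rewrite ler_pdivrMr ?exprn_gt0 // !exprS expr0; lra.
  rewrite -[16%N]/(2 * 2 * 2 * 2)%N !exprM; set y := _ / _ in y0 y1 *.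
  have sq (a b d : R) : 0 <= a -> a <= b -> b ^+ 2 <= d -> 0 <= a ^+ 2 <= d.
    by move=> a0 ab h; rewrite sqr_ge0 (le_trans _ h) // lerXn2r ?nnegrE // (le_trans a0).
  have /andP[y20 y2] : 0 <= y ^+ 2 <= 186%:R / 181%:R by apply: sq y0 y1 _; rewrite expr2; lra.
  have /andP[y40 y4] : 0 <= y ^+ 2 ^+ 2 <= 94%:R / 89%:R by apply: sq y20 y2 _; rewrite expr2; lra.
  have /andP[y80 y8] : 0 <= y ^+ 2 ^+ 2 ^+ 2 <= 279%:R / 250%:R by apply: sq y40 y4 _; rewrite expr2; lra.
  have /andP[_ y16] : 0 <= y ^+ 2 ^+ 2 ^+ 2 ^+ 2 <= 1246%:R / 1000%:R by apply: sq y80 y8 _; rewrite expr2; lra.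
  move: y16; set z := y ^+ 2 ^+ 2 ^+ 2 ^+ 2 => y16.
  apply: le_lt_trans (_ : 1246%:R / 1000%:R * 3%:R ^+ 8 < _); first by rewrite ler_wpM2r ?exprn_ge0.
  by rewrite !exprS expr0; lra.
have lt : 3%:R ^+ 200 < 2%:R ^+ 317 :> R.
  have -> : 3%:R ^+ 200 = (3%:R ^+ 12 / 2%:R ^+ 19) ^+ 16 * 3%:R ^+ 8 * 2%:R ^+ 304 :> R.
    rewrite mulrAC -[304%N]/(19 * 16)%N [2%:R ^+ (_ * _)]exprM -exprMn divfK ?expf_neq0 ?pnatr_eq0 //.
    by rewrite -exprM -exprD.
  by rewrite -[317%N]/(13 + 304)%N exprD ltr_pM2r ?exprn_gt0.
have ln2 : 0 < ln (2%:R : R) by apply: ln_gt0; rewrite ltr1n.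
have := lt; rewrite -ltr_ln ?posrE ?exprn_gt0 // !lnXn // -[ln _ *+ 200]mulr_natr -[ln _ *+ 317]mulr_natr => h.
have : ln 3%:R / ln 2%:R < 317%:R / 200%:R :> R by rewrite ltr_pdivrMr //; lra.
by rewrite /beta; lra.
Qed.

Lemma beta_ge0 : 0 <= beta R.
Proof.
have ln2 : 0 < ln (2%:R : R) by apply: ln_gt0; rewrite ltr1n.
by rewrite /beta subr_ge0 ler_pdivlMr // mul1r ler_ln ?posrE ?ler_nat.
Qed.

Lemma powR_beta : 2%:R `^ beta R = 3%:R / 2%:R :> R.
Proof.
have ln2 : 0 < ln (2%:R : R) by apply: ln_gt0; rewrite ltr1n.
rewrite /powR pnatr_eq0 /= /beta mulrBl mul1r divfK ?gt_eqF // expRB.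
by rewrite !lnK ?posrE.
Qed.

Definition cbrt2 : R := 2%:R `^ 3%:R^-1.

Lemma cbrt2_gt0 : 0 < cbrt2. Proof. exact: powR_gt0. Qed.

Lemma cbrt2K : cbrt2 ^+ 3 = 2%:R.
Proof. by rewrite -powR_mulrn ?powR_ge0 // -powRrM mulVf ?pnatr_eq0 // powRr1. Qed.

End Constants.

Section Bound.
Variables (R : realType) (m : nat) (e : rel 'I_m.+1).
Local Notation n := m.+1.
Local Notation c := (cbrt2 R).

Definition bound : R := 2%:R `^ ((n%:R - (t1 e)%:R) / 3%:R + beta R * (excess e)%:R).

Lemma out_arcs u : #|out (arcs e) u| = outdeg e u.
Proof. by apply: eq_card => v; rewrite !inE. Qed.

Lemma t1_le : (undecided (arcs e) + t1 e <= n)%N.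
Proof.
rewrite /undecided /t1 -cardsUI -[X in (_ <= X)%N](card_ord n) [X in (_ + X)%N](_ : _ = 0)%N.
  by rewrite addn0 max_card.
by apply/eqP; rewrite cards_eq0; apply/eqP/setP => u; rewrite !inE out_arcs; case: ltngtP.
Qed.

(** The input need not be reduced, but its [Phi] dominates that of all its subsets. Undecided
    vertices are disjoint from those of outdegree 1, whence n - t_1 in the exponent. *)
Lemma maxPhi_arcs : maxPhi c (arcs e) <= bound.
Proof.
apply: maxPhi_le => [|A sub _]; first exact: powR_ge0.
apply: (le_trans (y := Phi c (arcs e))).
  have := @Phi_drop _ R c (cbrt2K R) (cbrt2_gt0 R) (arcs e) A 0 0.
  rewrite !addn0 !expr0 !mulr1; apply.
    by have := undecided_drop sub (s := [::]) isT isT; rewrite addn0.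
  by have := surplus_drop sub (s := [::]) isT isT; rewrite addn0.
have -> : Phi c (arcs e) = 2%:R `^ ((undecided (arcs e))%:R / 3%:R + beta R * (surplus (arcs e))%:R).
  rewrite powRD ?pnatr_eq0 ?implybT // mulrC -[_ / _]mulrC !powRrM powR_beta mulrC.
  by rewrite !powR_mulrn ?powR_ge0 // divr_ge0.
apply: ler_powR; first by rewrite ler1n.
apply: lerD.
  by rewrite ler_wpM2r ?invr_ge0 // lerBrDr -natrD ler_nat t1_le.
rewrite ler_wpM2l ?beta_ge0 // ler_nat /excess [X in (_ <= X)%N]big_mkcond.
by apply: leq_sum => u _; rewrite out_arcs; case: ifP => // /negbT; rewrite -ltnNge; lia.
Qed.

Lemma bound_ge1 : 1 <= bound.
Proof.
rewrite -[1](powRr0 (2%:R : R)); apply: ler_powR; first by rewrite ler1n.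
rewrite addr_ge0 ?mulr_ge0 ?beta_ge0 ?invr_ge0 // subr_ge0 ler_nat.
by apply: leq_trans t1_le; rewrite leq_addl.
Qed.

(** There are at most n^2 arcs, so the quadratic factor is at most (n + 1)^4; the 2 absorbs the
    linear term. *)
Lemma potential_arcs : potential c (arcs e) <= 2%:R * bound * (n.+1)%:R ^+ 4.
Proof.
have b1 := bound_ge1.
have h : #|arcs e|%:R + 1 <= n.+1%:R ^+ 2 :> R.
  rewrite natr1 -natrX ler_nat; apply: leq_ltn_trans (max_card _) _.
  by rewrite card_prod card_ord -mulnn ltn_mul.
have N1 : 1 <= n.+1%:R ^+ 2 :> R by rewrite exprn_ege1 // ler1n.
have a0 : 0 <= #|arcs e|%:R + 1 :> R by rewrite addr_ge0.
rewrite /potential -[4%N]/(2 * 2)%N exprM.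
set N2 := n.+1%:R ^+ 2 in h N1 *.
have : (#|arcs e|%:R + 1) ^+ 2 * maxPhi c (arcs e) <= N2 ^+ 2 * bound.
  apply: ler_pM; rewrite ?maxPhi_ge0 ?maxPhi_arcs ?sqr_ge0 //.
  by rewrite lerXn2r ?nnegrE // (le_trans ler01).
have : N2 <= N2 ^+ 2 * bound.
  rewrite expr2 -mulrA ler_peMr ?(le_trans ler01) //.
  by rewrite -[1]mulr1 ler_pM.
lra.
Qed.

End Bound.

Lemma nth_allpairs (S T U : Type) (f : S -> T -> U) xs ys x0 y0 z0 i j :
  (i < size xs)%N -> (j < size ys)%N ->
  nth z0 [seq f x y | x <- xs, y <- ys] (i * size ys + j) = f (nth x0 xs i) (nth y0 ys j).
Proof.
elim: xs i => // x xs IH [|i] /= hi hj; rewrite nth_cat size_map.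
  by rewrite mul0n hj (nth_map y0).
rewrite mulSn -addnA ltnNge leq_addr /= addKn; exact: IH.
Qed.

(** * The initial state and its word length *)

Section Input.
Variables (m : nat) (e : rel 'I_m.+1) (w : 'I_m.+1 -> 'I_m.+1 -> int) (M W : nat).
Local Notation n := m.+1.
Local Notation word := (word_bits e w).
Hypothesis sizeM : (2 * (n * n) <= M)%N.
Hypothesis sizeW : (word <= W)%N.

Definition arc_weight u v : int := if e u v then w u v else 0.
Definition max_len := (\max_(p : 'I_n * 'I_n | e p.1 p.2) bitlen (w p.1 p.2))%N.

Lemma arc_weight_lt u v : `|arc_weight u v| < (2 ^ max_len)%N%:Z.
Proof.
rewrite /arc_weight; case: ifP => [uv|_]; last by rewrite normr0 ltz_nat expn_gt0.
rewrite -abszE ltz_nat; have lt := @trunc_log_ltn 2 `|w u v|%N isT.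
apply: leq_trans lt _.
rewrite leq_exp2l //; exact: (@leq_bigmax_cond _ (fun p => e p.1 p.2) (fun p => bitlen (w p.1 p.2)) (u, v)).
Qed.

Lemma n_lt : (n < 2 ^ (trunc_log 2 n).+1)%N.
Proof. exact: trunc_log_ltn. Qed.

Lemma le_word k : (k <= word)%N -> (2 ^ k <= 2 ^ W)%N.
Proof. by move=> h; rewrite leq_exp2l // (leq_trans h). Qed.

Lemma page_input p u v : (p < 2)%N ->
  page (input_state e w) p u v = if p == 0%N then (e u v : nat)%:Z else arc_weight u v.
Proof.
have cell_nth (f : 'I_n -> 'I_n -> int) (x y : 'I_n) :
    nth 0 [seq f u v | u <- enum 'I_n, v <- enum 'I_n] (x * n + y) = f x y.
  have := @nth_allpairs _ _ _ f (enum 'I_n) (enum 'I_n) ord0 ord0 0 x y.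
  by rewrite size_enum_ord !nth_ord_enum; apply.
rewrite /page /= /input_seq nth_cat size_allpairs size_enum_ord.
case: p => [|[|//]] _ /=.
  by rewrite mul0n add0n offset_lt cell_nth.
by rewrite mul1n ltnNge leq_addr /= addKn cell_nth.
Qed.

Lemma fits_input : fits M W (input_state e w).
Proof.
have w0 : `|0 : int| < (2 ^ W)%N%:Z by rewrite normr0 ltz_nat expn_gt0.
have small x : x \in input_seq e w -> `|x| < (2 ^ W)%N%:Z.
  rewrite mem_cat => /orP[]/allpairsP[[u v] [_ _ ->]] /=.
    apply: le_lt_trans (_ : (1%N%:Z) < _); first by case: (e u v).
    by rewrite ltz_nat -{1}(expn0 2) ltn_exp2l //; apply: leq_trans sizeW; rewrite /word_bits addSn.
  apply: lt_le_trans (arc_weight_lt u v) _; rewrite lez_nat; apply: le_word.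
  by rewrite /word_bits leq_addl.
split=> /= [x|[i|i]|[i|i]] //.
- case: ifP => // _; rewrite ger0_norm // ltz_nat; apply: leq_trans n_lt _.
  by apply: le_word; rewrite /word_bits leq_addr.
- have [lt|ge] := ltnP i (size (input_seq e w)); last by rewrite nth_default.
  exact/small/mem_nth.
- rewrite ltz_nat -leqNgt => h; apply: nth_default; apply: leq_trans h.
  by rewrite size_cat !size_allpairs size_enum_ord addnn -mul2n.
Qed.

Lemma wf_input : wf m M W (input_state e w).
Proof.
split=> [||x]; [exact: fits_input|by []|].
by rewrite /vtx /= inordK.
Qed.

End Input.

Lemma wt_arc_weight m (e : rel 'I_m.+1) w t :
  ham ord0 (arcs e) t -> wt (arc_weight e w) t = wt w t.
Proof.
by move=> /hamP[h _]; apply: eq_bigr => u _; have := h u; rewrite inE /arc_weight /= => ->.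
Qed.

Lemma covers_output m (e : rel 'I_m.+1) w (o : option {perm 'I_m.+1}) s :
  covers ord0 (arc_weight e w) (arcs e) [::] o ->
  (if o is Some t then
     reg s 0 = 1 /\ forall i, (i < m.+1)%N -> ram s i%:Z = ((t ^+ i)%g ord0 : nat)%:Z
   else reg s 0 = 0) -> atsp_output e w s.
Proof.
move=> [_ best cov]; case: o best cov => [t|] best cov.
  move=> [r0 out]; left; split=> //; exists (traject t ord0 m.+1).
    have ht := best _ erefl; have [hc wc] := perm_ham_cycle w ht; split=> // c' /(ham_cycle_perm w)[t' ht' ->].
    rewrite wc -(wt_arc_weight w ht) -(wt_arc_weight w ht'); have [[? [? []]]|[t2 [<-] //]] := cov _ ht'.
    by rewrite in_nil.
  move=> i lt; rewrite out // (nth_map ord0) ?size_traject // nth_traject //.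
  by rewrite -permX.
move=> r0; right; split=> // c; apply/negP => /(ham_cycle_perm w)[t' ht' _].
by have [[? [? []]]|[]] := cov _ ht'.
Qed.

Theorem theorem13 (R : realType) :
  beta R < 585%:R / 1000%:R /\
  ATSP_Ostar_polyspace (fun (n : nat) (e : rel 'I_n) =>
    2%:R `^ ((n%:R - (t1 e)%:R) / 3%:R + beta R * (excess e)%:R) : R).
Proof.
split; first exact: beta_lt.
have [Ki [ki hi]] := cost_poly init; have [Kb [kb hb]] := cost_poly body.
have [Ko [ko ho]] := cost_poly output.
(* The 7 covers the memory of at most 6 (n + 1)^4 cells and addresses of 3 + 4l <= 7l bits, l being
   the length of n. The 3 bounds the rounds: 2 from the potential and 1 for rounding it up. The 4 is
   the exponent of both. *)
pose C := (7 + Ki + Ko + 3 * (2 + Kb))%N; pose k := (ki + kb + ko + 4)%N.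
exists program, C, k => -[|m] e w M W.
  have t0 : t1 e = 0%N by apply/eqP; rewrite cards_eq0; apply/eqP/setP => -[].
  have S0 : excess e = 0%N by rewrite /excess big_ord0.
  exists 3%N, (input_state e w); split.
  - have w0 : `|0 : int| < (2 ^ W)%N%:Z by rewrite normr0 ltz_nat expn_gt0.
    have no : input_seq e w = [::] by rewrite /input_seq enum_ord0.
    by split=> [x|[i|i]|[i|i]]; rewrite /= ?if_same ?no ?nth_nil.
  - by apply: exec_if_false => //; apply: exec_skip.
  - by right; split=> // -[|[]].
  - rewrite t0 S0 subr0 mul0r mulr0 addr0 powRr0 expr1n !mulr1 ler_nat.
    by rewrite /C -!addnA.
set n := m.+1.
have C7 : (7 <= C)%N by rewrite /C -!addnA leq_addr.
have k4 : (4 <= k)%N by rewrite /k leq_addl.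
have sizeM : ((n * n + 5) * (n * n) <= M)%N.
  rewrite /M; apply: (@leq_trans (6 * n.+1 ^ 4)).
    have q : (n * n <= n.+1 ^ 2)%N by rewrite -mulnn leq_mul.
    rewrite (expnD _ 2 2) [(6 * (_ * _))%N]mulnA leq_mul //.
    have q0 : (0 < n.+1 ^ 2)%N by rewrite expn_gt0.
    by move: q q0; move: (n * n)%N (n.+1 ^ 2)%N => x y; clear; lia.
  by rewrite leq_mul ?leq_exp2l // (leq_trans _ C7).
have lenW : (7 * word_bits e w <= W)%N by rewrite /W leq_mul2r C7 orbT.
have wordW : (word_bits e w <= W)%N by apply: leq_trans lenW; rewrite leq_pmull.
pose l := (trunc_log 2 n).+1; have nl : (n < 2 ^ l)%N := n_lt m.
have sizeW : ((n * n + 6) * (n * n) < 2 ^ W)%N.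
  apply: (@leq_ltn_trans (7 * n ^ 4)).
    rewrite (expnD _ 2 2) [(7 * (_ * _))%N]mulnA -!mulnn leq_mul //.
    have q0 : (0 < n * n)%N by rewrite muln_gt0.
    by move: q0; move: (n * n)%N => x; clear; lia.
  apply: (@leq_trans (2 ^ (3 + 4 * l))).
    rewrite expnD [(4 * l)%N]mulnC expnM; apply: (@leq_ltn_trans (7 * (2 ^ l) ^ 4)).
      by rewrite leq_mul2l leq_exp2r // ltnW.
    by rewrite ltn_mul2r !expn_gt0.
  rewrite leq_exp2l //; apply: leq_trans lenW; rewrite /word_bits -/l.
  by rewrite /l; move: (trunc_log 2 n) (bigop _ _ _) => x y; clear; lia.
pose B := (2 ^ max_len e w)%N.
(* The length of n plus the largest weight length is exactly [word_bits], so a sum of n weights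
   fits. *)
have sumW : (n * B < 2 ^ W)%N.
  apply: leq_trans (_ : 2 ^ word_bits e w <= _)%N; last by rewrite leq_exp2l.
  by rewrite /word_bits expnD ltn_mul2r expn_gt0.
have smallw u v : `|arc_weight e w u v| <= B%:Z by apply/ltW/arc_weight_lt.
have size2 : (2 * (n * n) <= M)%N.
  apply: leq_trans sizeM; rewrite leq_mul2r -[2%N]/(1 + 1)%N leq_add ?orbT //.
pose c := cbrt2 R; pose P := potential c (arcs e).
have P1 : 1 <= P := potential_ge1 c (arcs e).
(* The potential is real, whereas fuel is a natural number. *)
have /andP[Pge Plt] : (Num.truncn P)%:R <= P < (Num.truncn P).+1%:R.
  by apply: truncn_itv; apply: le_trans P1.
have hE u v : (0 < page (input_state e w) 0 u v) = ((u, v) \in arcs e).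
  by rewrite page_input // inE /=; case: (e u v).
have hw u v : page (input_state e w) 1 u v = arc_weight e w u v by rewrite page_input.
have [t [s [o [ex le cov out]]]] := run_ok sizeM sizeW smallw sumW (cbrt2K R) (cbrt2_gt0 R)
  (wf_input size2 wordW) hE hw (ltW Plt).
exists t, s; split=> //; [exact: fits_input|exact: covers_output cov out|].
rewrite -/(bound R e); have f1 := bound_ge1 R e; have Ple := potential_arcs R e.
pose N := n.+1; pose X := (N ^ (ki + kb + ko))%N.
have X1 : (0 < X)%N by rewrite expn_gt0.
have up K j x : (j <= ki + kb + ko)%N -> (x <= K * n ^ j)%N -> (x <= K * X)%N.
  move=> hj h; apply: leq_trans h _; rewrite leq_mul2l; apply/orP; right.
  apply: (@leq_trans (N ^ j)); last by rewrite leq_exp2l.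
  by case: j {hj} => // j; rewrite leq_exp2r.
have n0 : (0 < n)%N by [].
have li := up _ ki _ (leq_trans (leq_addr kb ki) (leq_addr ko _)) (hi _ n0).
have lb := up _ kb _ (leq_trans (leq_addl ki kb) (leq_addr ko _)) (hb _ n0).
have lo := up _ ko _ (leq_addl _ ko) (ho _ n0).
pose K := (Num.truncn P).+1.
have {}le : (t <= ((4 + Ki + Ko) + K * (2 + Kb)) * X)%N.
  apply: leq_trans le _; rewrite -/K mulnDl -mulnA.
  have : (K * (2 + cost n body) <= K * ((2 + Kb) * X))%N.
    rewrite leq_mul2l mulnDl leq_add ?orbT // leq_pmulr //.
  move: li lo X1; rewrite !mulnDl -/n.
  move: (cost _ init) (cost _ output) (_ * (2 + _))%N (_ * (_ * X + _))%N (Ki * X)%N (Ko * X)%N.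
  by clear; lia.
have fN : 1 <= bound R e * N%:R ^+ 4.
  by rewrite mulr_ege1 // exprn_ege1 // ler1n.
have Kle : K%:R <= 3%:R * bound R e * N%:R ^+ 4.
  by move: fN Ple; rewrite -/c -/P -/N /K -natr1; lra.
apply: (le_trans (y := ((4 + Ki + Ko)%:R + K%:R * (2 + Kb)%:R) * X%:R)).
  by rewrite -natrM -natrD -natrM ler_nat.
have -> : C%:R * bound R e * m.+2%:R ^+ k = C%:R * (bound R e * N%:R ^+ 4) * X%:R.
  by rewrite /k exprD /X natrX -/N; ring.
rewrite ler_wpM2r //; apply: (le_trans (y :=
    (4 + Ki + Ko)%:R * (bound R e * N%:R ^+ 4) + (3 * (2 + Kb))%:R * (bound R e * N%:R ^+ 4))).
  apply: lerD; first by rewrite ler_peMr.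
  rewrite natrM mulrAC ler_wpM2r // mulrA; exact: Kle.
rewrite -mulrDl -natrD ler_wpM2r ?(le_trans ler01) // ler_nat.
by rewrite /C; clear; lia.
Qed.
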